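(* Let $A$ be a finite set. Let $\mathbf{P}(A)$ be the poset of nontrivial partitions of $A$, let $\mathbf{\Delta}/N\mathbf{P}(A)$ be the category of simplices of its nerve, and let $\mathbf{T}^+(A)$ be the category of trees with set of leaves $A$ having at least one inner edge (all as defined in the context). There is a functor $$\varphi\colon \mathbf{\Delta}/N\mathbf{P}(A) \longrightarrow \mathbf{T}^+(A),$$ namely the one sending a simplex of $N\mathbf{P}(A)$ to the tree obtained from the corresponding layered tree by forgetting the layers and deleting all unary vertices, with the property that for every object $T$ of $\mathbf{T}^+(A)$ the slice category $\varphi/T$ is weakly contractible. In particular, $\varphi$ induces a weak homotopy equivalence between the classifying spaces of $\mathbf{\Delta}/N\mathbf{P}(A)$ and $\mathbf{T}^+(A)$.
   Context: **Partitions.** The partitions of $A$ are partially ordered by refinement: $P \leq Q$ if $Q$ refines $P$, i.e. every block of $Q$ is contained in a block of $P$. Thus the indiscrete partition $\{A\}$ is the initial object and the discrete partition (all blocks singletons) is the final object. $\mathbf{P}(A)$ is the poset obtained by removing these two extreme partitions. Its nerve $N\mathbf{P}(A)$ is the simplicial set whose $p$-simplices are chains $P_0 \leq \cdots \leq P_p$ in $\mathbf{P}(A)$. **Category of simplices.** For a simplicial set $X$, the objects of $\mathbf{\Delta}/X$ are pairs $([p],\sigma)$ with $p \geq 0$ and $\sigma \in X_p$. A morphism $([p],\sigma) \to ([q],\tau)$ is an order-preserving map $\alpha\colon [p]\to[q]$ with $\alpha^*\tau = \sigma$. **Trees.** Trees are finite rooted trees, oriented towards the root. Every vertex has exactly one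 outgoing edge and a set of incoming edges. The leaves are the edges that are not the outgoing edge of any vertex. The root is the unique edge that is not an incoming edge of any vertex. An inner edge is an edge connecting two vertices, i.e. it is outgoing for one vertex and incoming for another. A vertex is unary if it has exactly one incoming edge. **The categories $\mathbf{T}(A)$ and $\mathbf{T}^+(A)$.** The objects of $\mathbf{T}(A)$ are isomorphism classes (isomorphisms being the identity on $A$) of finite rooted trees whose set of leaves is $A$ and in which every vertex has at least two incoming edges. There is a morphism $S \to T$, which is then unique, if and only if $S$ can be obtained from $T$ by contracting a (possibly empty) set of inner edges of $T$. Hence $\mathbf{T}(A)$ is a poset. Its initial object is the corolla $C_A$, the tree with a single vertex and no inner edges. $\mathbf{T}^+(A)$ is the full subcategory of $\mathbf{T}(A)$ obtained by omitting this initial object, i.e. the full subcategory on the trees with at least one inner edge. **Layered tree of a simplex.** Let $\sigma = (P_0 \leq \cdots \leq P_p)$ be a simplex of $N\mathbf{P}(A)$. Put $P_{-1} = \{A\}$ and let $P_{p+1}$ be the discrete partition. The layered tree of $\sigma$ has an edge $(i,b)$ for each $-1 \leq i \leq p+1$ and each block $b\in P_i$. For each $-1 \leq i \leq p$ and each block $b \in P_i$ it has a vertex with outgoing edge $(i,b)$ and with incoming edges the $(i+1,b')$ with $b' \in P_{i+1}$ and $b' \subseteq b$. The root is $(-1,A)$, and the leaves are the edges $(p+1,\{a\})$, identified with the elements $a \in A$. Deleting a unary vertex means removing it and merging its incoming and outgoing edges into one edge. **Slice categories.** For a functor $\varphi\colon \mathbf{D}\to\mathbf{C}$ and an object $c$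 of $\mathbf{C}$, the category $\varphi/c$ has as objects the pairs $(d, \alpha\colon \varphi(d)\to c)$ with $d$ an object of $\mathbf{D}$. A morphism $(d,\alpha)\to(d',\alpha')$ is a morphism $\beta\colon d\to d'$ in $\mathbf{D}$ with $\alpha'\circ\varphi(\beta) = \alpha$. A category is weakly contractible if its classifying space (the geometric realization of its nerve) is weakly contractible. *)

(* Defs.v *)
From HB Require Import structures.
From Stdlib Require Import Relation_Operators.
From mathcomp Require Import all_boot all_order.

Set Implicit Arguments.
Unset Strict Implicit.
Unset Printing Implicit Defensive.

Import Order.TTheory.

(** Edges are oriented towards the root.  [step_through out inn D e e'] holds when
    [e] is an incoming edge, and [e'] the outgoing edge, of a vertex in [D]. *)
Definition step_through (E V : finType) (out : V -> E) (inn : V -> {set E})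
    (D : {set V}) : rel E :=
  fun e e' => [exists d in D, (e \in inn d) && (out d == e')].

(** [V] and [E] are the vertices and the edges of a finite rooted tree: each vertex
    [v] has one outgoing edge [out v] and a set [inn v] of incoming edges.  The root
    is the edge that is incoming to no vertex; every edge leads down to it, which
    forces it to be unique and the graph to have no cycles.  The map [leaf]
    identifies [A] with the set of leaves, i.e. of edges that are not outgoing. *)
Record is_tree (A E V : finType) (out : V -> E) (inn : V -> {set E})
    (leaf : A -> E) : Prop := IsTree {
  is_tree_out_inj : injective out;
  is_tree_inn_inj : forall e v w, e \in inn v -> e \in inn w -> v = w;
  is_tree_rooted : exists2 r, forall v, r \notin inn v
    & forall e, connect (step_through out inn setT) e r;
  is_tree_leaf_inj : injective leaf;
  is_tree_leafP : forall e, (e \in codom leaf) = (e \notin codom out)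
}.

Record ltree (A : finType) := LTree {
  edge : finType;
  vertex : finType;
  out : vertex -> edge;
  inn : vertex -> {set edge};
  leaf_lab : A -> edge;
  ltreeP : is_tree out inn leaf_lab
}.

(** Trees whose edges and vertices are initial segments of [nat].  Every [ltree] is
    isomorphic to one of these (lemma [ord_tree_exists]), so isomorphism classes of
    trees may be formed from them; unlike [ltree A], which quantifies over [finType]
    and is therefore too large to be a [choiceType], [ord_tree A] is small. *)
Record ord_tree (A : finType) := OrdTree {
  edge_card : nat;
  vertex_card : nat;
  ord_out : 'I_vertex_card -> 'I_edge_card;
  ord_inn : 'I_vertex_card -> {set 'I_edge_card};
  ord_leaf : A -> 'I_edge_card;
  ord_treeP : is_tree ord_out ord_inn ord_leaf
}.

Coercion ltree_of_ord (A : finType) (t : ord_tree A) : ltree A := LTree (ord_treeP t).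

Section TreeTheory.
Variables (A : finType).
Implicit Types (s t u : ltree A).

Lemma out_inj t : injective (@out A t).
Proof. exact: is_tree_out_inj (ltreeP t). Qed.
Lemma inn_inj t e v w : e \in @inn A t v -> e \in inn w -> v = w.
Proof. exact: (is_tree_inn_inj (ltreeP t)). Qed.
Lemma rooted t : exists2 r : edge t, forall v, r \notin inn v
    & forall e, connect (step_through (@out A t) (@inn A t) setT) e r.
Proof. exact: is_tree_rooted (ltreeP t). Qed.
Lemma leaf_lab_inj t : injective (leaf_lab t).
Proof. exact: is_tree_leaf_inj (ltreeP t). Qed.
Lemma leaf_labP t e : (e \in codom (leaf_lab t)) = (e \notin codom (@out A t)).
Proof. exact: (is_tree_leafP (ltreeP t)). Qed.

Definition down t := step_through (@out A t) (@inn A t).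

Definition below t : rel (edge t) := connect (down setT).
Arguments below : clear implicits.

Lemma downP t (D : {set vertex t}) e e' :
  reflect (exists d, [/\ d \in D, e \in inn d & out d = e']) (down D e e').
Proof.
apply: (iffP existsP) => [[d /and3P[dD ed /eqP de]]|[d [dD ed de]]]; exists d=> //.
by rewrite dD ed de eqxx.
Qed.

Lemma down_det t (D D' : {set vertex t}) e x y : down D e x -> down D' e y -> x = y.
Proof.
by move=> /downP[d [_ ed <-]] /downP[d' [_ ed' <-]]; rewrite (inn_inj ed ed').
Qed.

Lemma downT t (D : {set vertex t}) e e' : down D e e' -> down setT e e'.
Proof. by move=> /downP[d [_ ed de]]; apply/downP; exists d; rewrite inE. Qed.

Lemma connect_downT t (D : {set vertex t}) e e' :
  connect (down D) e e' -> below t e e'.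
Proof. by apply: connect_sub => x y /downT; exact: connect1. Qed.

Lemma connect_cases (T : finType) (r : rel T) x y : connect r x y ->
  x = y \/ exists2 z, r x z & connect r z y.
Proof.
move=> /connectP[[|z p] /= ]; first by left.
by move=> /andP[xz pz] ->; right; exists z => //; apply/connectP; exists p.
Qed.

Lemma connect_last (T : finType) (r : rel T) x y : connect r x y ->
  x = y \/ exists2 z, connect r x z & r z y.
Proof.
move=> /connectP[p]; case/lastP: p => [|p z] /=; first by left.
rewrite last_rcons rcons_path => /andP[xp zp] ->; right.
by exists (last x p) => //; apply/connectP; exists p.
Qed.

Lemma connect_ind (T : finType) (r : rel T) y (P : T -> Prop) :
  P y -> (forall x z, r x z -> connect r z y -> P z -> P x) ->
  forall x, connect r x y -> P x.
Proof.
move=> Py IH x /connectP[p]; elim: p x => [|z p IHp] x /=.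
  by move=> _ <-.
move=> /andP[xz pz] yE; apply: (IH x z) => //; last exact: IHp.
by apply/connectP; exists p.
Qed.

Lemma connect_det t (D D' : {set vertex t}) e x y :
  connect (down D) e x -> connect (down D') e y ->
  connect (down D') x y \/ connect (down D) y x.
Proof.
move=> ex; move: y; elim/connect_ind: ex => [|{}e z ez zx IH] y.
  by left.
move=> /connect_cases[<-|[z' ez' z'y]].
  by right; apply: connect_trans zx; exact: connect1.
by apply: IH; rewrite (down_det ez ez').
Qed.

Lemma below_anti t x y : below t x y -> below t y x -> x = y.
Proof.
have [r rN er] := rooted t.
have rtop z : below t r z -> r = z.
  by move=> /connect_cases[//|[w /downP[d [_ rd _]]]]; move: (rN d); rewrite rd.
move: (er x) y; elim/connect_ind => [|{}x x1 xx1 _ IH] y.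
  by move=> /rtop.
move=> xy yx; case: (connect_cases xy) => // -[z xz zy].
have zE := down_det xz xx1; rewrite zE in zy.
have x1x : x1 = x by apply: IH (connect_trans zy yx) _; exact: connect1.
by rewrite -x1x; apply: IH => //; rewrite x1x.
Qed.

Lemma below_root t r : (forall v, r \notin inn v) -> forall e, below t r e -> e = r.
Proof.
move=> rN e /connect_cases[//|[w /downP[d [_ rd _]]]].
by move: (rN d); rewrite rd.
Qed.

Lemma down_irr t e : ~ down (t := t) setT e e.
Proof.
move=> ee; have [r rN er] := rooted t.
suff H : forall x, below t e x -> x = e.
  by move/downP: ee => [d [_ ed _]]; move: (rN d); rewrite -(H r (er e)) in ed *;
     rewrite ed.
move=> x /connectP[p]; elim: p => [|y p IHp] //= /andP[ey py] xE.
by have yE := down_det ey ee; subst y; exact: IHp.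
Qed.

Lemma down_coverP t e e' :
  down setT e e' <->
  [/\ e != e', below t e e' &
      forall x, below t e x -> x = e \/ below t e' x].
Proof.
split=> [ee'|[neq ee' cov]].
  split.
  - by apply/eqP => E; subst e'; exact: down_irr ee'.
  - exact: connect1.
  - move=> x /connect_cases[<-|[z ez zx]]; first by left.
    by right; rewrite (down_det ee' ez).
case: (connect_cases ee') => [E|[z ez ze']]; first by rewrite E eqxx in neq.
have [E|e'z] := cov z (connect1 ez); first by subst z; case: (down_irr ez).
by rewrite (below_anti e'z ze').
Qed.

Definition ltree_iso s t : Prop :=
  exists (f : edge s -> edge t) (g : vertex s -> vertex t),
    [/\ bijective f, bijective g,
        forall v, f (out v) = out (g v),
        forall v, f @: inn v = inn (g v) &
        forall a, f (leaf_lab s a) = leaf_lab t a].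

(** Auxiliary: an embedding of edge posets fixing the leaves and the root; see
    [contractsP]. *)
Definition embeds s t (f : edge s -> edge t) : Prop :=
  [/\ injective f, forall a, f (leaf_lab s a) = leaf_lab t a,
      forall e e', below s e e' = below t (f e) (f e') &
      forall r, (forall v, r \notin inn v) -> forall v, f r \notin inn v].

Lemma embeds_comp s t u f g :
  @embeds s t f -> @embeds t u g -> embeds (g \o f).
Proof.
move=> [fi fl fb fr] [gi gl gb gr]; split.
- exact: inj_comp.
- by move=> a /=; rewrite fl gl.
- by move=> e e'; rewrite fb gb.
- by move=> r /fr /gr.
Qed.

Lemma iso_embeds s t : ltree_iso s t -> exists f, @embeds s t f.
Proof.
move=> [f [g [fb gb fo fi fl]]]; have finj := bij_inj fb.
have [f' fK f'K] := fb; have [g' gK g'K] := gb.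
have fd e e' : down setT (f e) (f e') = down setT e e'.
  apply/downP/downP => -[d [_ ed de]]; last first.
    by exists (g d); rewrite inE -fi mem_imset // -fo de.
  exists (g' d); rewrite inE -(mem_imset _ _ finj) fi g'K ed; split => //.
  by apply: finj; rewrite fo g'K.
exists f; split=> //.
- move=> e e'; apply/idP/idP.
    elim/connect_ind => [|x z xz _ H]; first exact: connect0.
    by apply: connect_trans H; apply: connect1; rewrite fd.
  rewrite -{2}(fK e) -{2}(fK e').
  elim/connect_ind => [|x z xz _ H]; first exact: connect0.
  by apply: connect_trans H; apply: connect1; rewrite -fd !f'K.
- by move=> r rN v; rewrite -(g'K v) -fi mem_imset.
Qed.

Lemma embeds_nonleaf s t f : @embeds s t f ->
  forall e, (f e \in codom (@out _ t)) = (e \in codom (@out _ s)).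
Proof.
move=> [fi fl fb fr] e; apply: negb_inj; rewrite -!leaf_labP.
by apply/codomP/codomP => -[a ae]; exists a; [apply: fi; rewrite fl|rewrite -fl ae].
Qed.

Lemma embeds_iso s t f : @embeds s t f -> bijective f -> ltree_iso s t.
Proof.
move=> fE fb; have [fi fl fbl fr] := fE; have [f' fK f'K] := fb.
have gP v : {w | out w = f (out v)}.
  have fo : f (out v) \in codom (@out _ t) by rewrite (embeds_nonleaf fE) codom_f.
  by exists (iinv fo); rewrite f_iinv.
pose g v := sval (gP v).
have gE v : out (g v) = f (out v) by exact: svalP (gP v).
have fd e e' : down setT (f e) (f e') <-> down setT e e'.
  split=> /down_coverP[neq ee' cov]; apply/down_coverP; split.
  - by apply: contra neq => /eqP ->.
  - by rewrite fbl.
  - by move=> x; rewrite !fbl => /cov [/fi|]; [left|right].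
  - by apply: contra neq => /eqP/fi ->.
  - by rewrite -fbl.
  - by move=> x; rewrite -(f'K x) -!fbl => /cov [->|]; [left|right].
have downE u (e : edge u) v : e \in inn v <-> down setT e (out v).
  split=> [ev|/downP[d [_ ed /out_inj <-] //]].
  by apply/downP; exists v; rewrite inE.
exists f, g; split=> //.
- have ginj : injective g by move=> v w E; apply: out_inj; apply: fi; rewrite -!gE E.
  apply: inj_card_bij ginj _.
  have hP (w : vertex t) : {v | out v = f' (out w)}.
    have fo : f' (out w) \in codom (@out _ s).
      by rewrite -(embeds_nonleaf fE) f'K codom_f.
    by exists (iinv fo); rewrite f_iinv.
  have hinj : injective (fun w => sval (hP w)).
    move=> w w' /= E; apply: out_inj; apply: (can_inj f'K).
    by rewrite -(svalP (hP w)) -(svalP (hP w')) E.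
  exact: leq_card hinj.
- move=> v; apply/setP => e'; rewrite -(f'K e') mem_imset //.
  apply/idP/idP.
    by move=> /downE ev; apply/downE; rewrite gE; apply/fd.
  by move=> /downE ev; apply/downE; apply/fd; rewrite -gE.
Qed.

Lemma ltree_iso_refl s : ltree_iso s s.
Proof.
exists id, id; split=> //; try by exists id.
by move=> v; rewrite imset_id.
Qed.

Lemma ltree_iso_sym s t : ltree_iso s t -> ltree_iso t s.
Proof.
move=> [f [g [[f' fK f'K] [g' gK g'K] fo fi fl]]]; exists f', g'; split.
- by exists f.
- by exists g.
- by move=> v; apply: (can_inj fK); rewrite f'K fo g'K.
- move=> v; apply: (imset_inj (can_inj fK)); rewrite fi g'K -imset_comp.
  by rewrite (eq_imset _ (g := id)) ?imset_id // => x /=; rewrite f'K.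
- by move=> a; apply: (can_inj fK); rewrite f'K fl.
Qed.

Lemma ltree_iso_trans t s u : ltree_iso s t -> ltree_iso t u -> ltree_iso s u.
Proof.
move=> [f [g [fb gb fo fi fl]]] [f' [g' [fb' gb' fo' fi' fl']]].
exists (f' \o f), (g' \o g); split; [exact: bij_comp|exact: bij_comp|..].
- by move=> v; rewrite /= fo fo'.
- by move=> v; rewrite imset_comp fi fi'.
- by move=> a; rewrite /= fl fl'.
Qed.

(** Removing a set [D] of vertices together with their outgoing edges.

    - If [out d] is an inner edge, contracting it merges [d] with the vertex below;
      the merged vertex is represented by the lower one and receives the incoming
      edges of [d].
    - If [d] is unary, deleting it merges its outgoing and incoming edges; the
      merged edge is represented by the incoming (upper) one.

    In both cases the remaining incoming edges of a remaining vertex [v] are those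
    from which an edge of [inn v] is reached by passing through vertices of [D]
    only. *)
Section Suppress.
Variables (t : ltree A) (D : {set vertex t}).

Let kept_edge e := e \notin [set out d | d in D].
Let kept_vertex v := v \notin D.
Definition sup_edge : finType := {e : edge t | kept_edge e}.
Definition sup_vertex : finType := {v : vertex t | kept_vertex v}.

Lemma sup_edgeP (e : sup_edge) : val e \notin [set out d | d in D].
Proof. exact: valP e. Qed.

Lemma sup_vertexP (v : sup_vertex) : val v \notin D.
Proof. exact: valP v. Qed.

Lemma sup_outP (v : sup_vertex) : out (val v) \notin [set out d | d in D].
Proof. by rewrite (mem_imset _ _ (@out_inj t)) (sup_vertexP v). Qed.

Definition sup_out (v : sup_vertex) : sup_edge := exist kept_edge _ (sup_outP v).

Definition sup_inn (v : sup_vertex) : {set sup_edge} :=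
  [set e : sup_edge | [exists e' in inn (val v), connect (down D) (val e) e']].

Lemma sup_labP a : leaf_lab t a \notin [set out d | d in D].
Proof.
apply/imsetP => -[d _ E].
have := leaf_labP (leaf_lab t a); rewrite codom_f => /esym.
by rewrite E codom_f.
Qed.

Definition sup_lab a : sup_edge := exist kept_edge _ (sup_labP a).

(** There is exactly one remaining edge above, or equal to, the root [r0] and joined
    to it through [D] only; it becomes the new root. *)
Definition suppressible : Prop := exists r r0 : edge t,
  [/\ forall v, r0 \notin inn v, r \notin [set out d | d in D],
      connect (down D) r r0 &
      forall e, e \notin [set out d | d in D] -> connect (down D) e r0 -> e = r].

Hypothesis supD : suppressible.

Lemma sup_out_inj : injective sup_out.
Proof. by move=> v w /(congr1 val)/out_inj/val_inj. Qed.

Lemma no_down_out e v : v \notin D -> e \in inn v -> forall x, ~~ down D e x.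
Proof.
move=> vD ev x; apply/downP => -[d [dD ed _]].
by rewrite (inn_inj ev ed) dD in vD.
Qed.

Lemma connect_out e v x : v \notin D -> e \in inn v -> connect (down D) e x -> e = x.
Proof.
by move=> vD ev /connect_cases[//|[z ez _]]; move: (no_down_out vD ev z); rewrite ez.
Qed.

Lemma sup_inn_inj e v w : e \in sup_inn v -> e \in sup_inn w -> v = w.
Proof.
rewrite !inE => /existsP[x /andP[xv ex]] /existsP[y /andP[yw ey]].
apply: val_inj; have [xy|yx] := connect_det ex ey.
  by have E := connect_out (sup_vertexP v) xv xy; subst y; exact: inn_inj xv yw.
by have E := connect_out (sup_vertexP w) yw yx; subst y; exact: inn_inj xv yw.
Qed.

Lemma connect_removed e x : x \notin [set out d | d in D] ->
  connect (down D) e x -> e = x.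
Proof.
move=> xD; elim/connect_ind => // y z /downP[d [dD _ dz]] _ zx.
by move: xD; rewrite -zx -dz imset_f.
Qed.

Notation sdown := (step_through sup_out sup_inn setT).

Lemma sup_walk x z : below t x z -> forall e : sup_edge, connect (down D) (val e) x ->
  exists2 e' : sup_edge, connect sdown e e' & connect (down D) (val e') z.
Proof.
elim/connect_ind => [|{}x y /downP[v [_ xv vy]] _ IH] e ex.
  by exists e; first exact: connect0.
have [vD|vD] := boolP (v \in D).
  apply: IH; apply: connect_trans ex (connect1 _).
  by apply/downP; exists v.
pose v' : sup_vertex := exist kept_vertex v vD.
have [|e' e'1 e'2] := IH (sup_out v'); first by rewrite /= vy.
exists e' => //; apply: connect_trans e'1; apply: connect1.
apply/existsP; exists v'; rewrite !inE eqxx andbT.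
by apply/existsP; exists x; rewrite xv.
Qed.

Lemma sup_below (e e' : sup_edge) : connect sdown e e' = below t (val e) (val e').
Proof.
apply/idP/idP => [|ee'].
  elim/connect_ind => [|x y /existsP[v /and3P[_ xv /eqP vy]] _ H].
    exact: connect0.
  apply: connect_trans H; move: xv; rewrite inE => /existsP[z /andP[zv xz]].
  apply: (connect_trans (connect_downT xz)); apply: connect1.
  by apply/downP; exists (val v); rewrite inE -vy.
have [e1 H1 H2] := sup_walk ee' (connect0 _ _).
by rewrite (_ : e' = e1) //; apply/esym/val_inj/(connect_removed (sup_edgeP e')).
Qed.

Lemma sup_rooted : exists2 r : sup_edge, forall v, r \notin sup_inn v
  & forall e, connect sdown e r.
Proof.
have [r [r0 [r0N rN rr0 rU]]] := supD; exists (exist kept_edge r rN : sup_edge).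
  move=> v; rewrite inE; apply/existsP => -[x /andP[xv /= rx]].
  suff E : x = r0 by move: (r0N (val v)); rewrite -E xv.
  have [H|/connect_downT H] := connect_det rx rr0.
    exact: connect_out (sup_vertexP v) xv H.
  exact: below_root H.
have [r1 r1N r1top] := rooted t.
have r01 : r0 = r1 by exact/esym/below_root/r1top.
move=> e; have := r1top (val e); rewrite -r01 => er.
have [e' ee' e'r] := sup_walk er (connect0 _ _).
by rewrite (_ : exist kept_edge r rN = e') //; apply: val_inj => /=; rewrite (rU _ (sup_edgeP e') e'r).
Qed.

Lemma sup_lab_inj : injective sup_lab.
Proof. by move=> a b /(congr1 val)/leaf_lab_inj. Qed.

Lemma sup_labE (e : sup_edge) : (e \in codom sup_lab) = (e \notin codom sup_out).
Proof.
have -> : (e \in codom sup_lab) = (val e \in codom (leaf_lab t)).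
  apply/codomP/codomP => -[a aE]; exists a; first by rewrite aE.
  exact: val_inj.
rewrite leaf_labP; congr (~~ _).
apply/codomP/codomP => -[v vE]; last by exists (val v); rewrite vE.
have vD : v \notin D.
  by have := sup_edgeP e; rewrite vE (mem_imset _ _ (@out_inj t)).
by exists (exist kept_vertex v vD : sup_vertex); exact: val_inj.
Qed.

Definition suppress : ltree A :=
  LTree (IsTree sup_out_inj sup_inn_inj sup_rooted sup_lab_inj sup_labE).

End Suppress.


Definition inner_edges t : {set edge t} :=
  [set e | (e \in codom (@out _ t)) && [exists v, e \in @inn _ t v]].

Definition unary t : {set vertex t} := [set v : vertex t | #|inn v| == 1].

Lemma contract_suppressible t (I : {set edge t}) : I \subset inner_edges t ->
  suppressible [set v | out v \in I].
Proof.
move=> sI; have [r rN _] := rooted t.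
have rD : r \notin [set out d | d in [set v | out v \in I]].
  apply/imsetP => -[d]; rewrite inE => dI dr.
  move/subsetP/(_ _ dI): sI; rewrite !inE -dr => /andP[_ /existsP[v]].
  by rewrite (negPf (rN v)).
exists r, r; split => // e _ er; exact: connect_removed er.
Qed.

Lemma unary_suppressible t : suppressible (unary t).
Proof.
have [r0 r0N r0top] := rooted t.
have uni e e' x : down (unary t) e x -> down (unary t) e' x -> e = e'.
  move=> /downP[d [dD ed dx]] /downP[d' [dD' ed' dx']].
  have /out_inj E : out d = out d' by rewrite dx.
  move: dD ed ed'; rewrite E inE => /cards1P[y ->].
  by rewrite !inE => /eqP -> /eqP ->.
pose P := [pred e | connect (down (unary t)) e r0].
have P0 : P r0 by exact: connect0.
pose ht (e : edge t) := #|[set x | below t e x]|.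
pose r := [arg max_(e > r0 | P e) ht e].
have [rP rmax] : P r /\ forall e, P e -> ht e <= ht r.
  by rewrite /r; case: arg_maxnP => // i Pi H; split.
have rN : r \notin [set out d | d in unary t].
  apply/imsetP => -[d dD rd].
  have : 0 < #|inn d| by move: dD; rewrite inE => /eqP ->.
  move=> /card_gt0P[e ed].
  have er : down (unary t) e r by apply/downP; exists d; rewrite rd.
  have Pe : P e by exact: connect_trans (connect1 er) rP.
  have := rmax e Pe; rewrite leqNgt => /negP; apply; apply: proper_card.
  apply/properP; split.
    apply/subsetP => x; rewrite !inE => rx.
    by apply: connect_trans rx; apply: connect_downT (connect1 er).
  exists e; first by rewrite inE; exact: connect0.
  rewrite inE; apply/negP => re.
  have E := below_anti re (connect_downT (connect1 er)); rewrite E in er.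
  exact: down_irr (downT er).
have bwd e : connect (down (unary t)) e r0 -> forall e',
    connect (down (unary t)) e' r0 ->
    connect (down (unary t)) e e' \/ connect (down (unary t)) e' e.
  elim/connect_ind => [e'|x z xz _ IH e' e'r0]; first by right.
  have [ze'|/connect_last[->|[w e'w wz]]] := IH e' e'r0.
  - by left; exact: connect_trans (connect1 xz) ze'.
  - by left; exact: connect1.
  - by right; rewrite (uni _ _ _ xz wz).
exists r, r0; split => // e eN er0.
have [H|H] := bwd _ er0 _ rP; first exact: connect_removed rN H.
exact/esym/(connect_removed eN H).
Qed.

Definition contract t (I : {set edge t}) (sI : I \subset inner_edges t) : ltree A :=
  suppress (contract_suppressible sI).

Definition delete_unary t : ltree A := suppress (unary_suppressible t).

(** [s] is obtained, up to isomorphism, from [t] by contracting inner edges. *)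
Definition contracts s t : Prop :=
  exists (I : {set edge t}) (sI : I \subset inner_edges t), ltree_iso s (contract sI).

Lemma suppress_embeds t (D : {set vertex t}) (supD : suppressible D) :
  (forall r0, (forall v, r0 \notin inn v) -> r0 \notin [set out d | d in D]) ->
  @embeds (suppress supD) t val.
Proof.
move=> rD; split.
- exact: val_inj.
- by [].
- by move=> e e'; exact: sup_below.
- move=> r rN.
  have [r1 r1N r1top] := rooted t.
  have : below t (val r) r1 by exact: r1top.
  rewrite -[r1]/(val (exist _ r1 (rD r1 r1N) : edge (suppress supD))) -sup_below.
  by move/(below_root rN)/(congr1 val) => /= <-.
Qed.

Lemma contractsP s t : contracts s t <-> exists f, @embeds s t f.
Proof.
split=> [[I [sI /iso_embeds[f fE]]]|[f fE]].
  exists (val \o f); apply: embeds_comp fE _; apply: suppress_embeds.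
  move=> r0 r0N; apply/imsetP => -[d]; rewrite inE => dI dr.
  move/subsetP/(_ _ dI): (sI); rewrite !inE -dr => /andP[_ /existsP[v]].
  by rewrite (negPf (r0N v)).
have [fi fl fb fr] := fE.
pose I := ~: (f @: setT).
have sI : I \subset inner_edges t.
  apply/subsetP => e; rewrite !inE => eI; apply/andP; split.
    apply/negbNE; rewrite -leaf_labP; apply/negP => /codomP[a ea].
    by move: eI; rewrite ea -fl imset_f.
  apply: contraT => /existsPn eN.
  have [r rN _] := rooted s; have [r1 r1N r1top] := rooted t.
  move: eI; rewrite -(below_root eN (r1top e)).
  by rewrite (below_root (fr r rN) (r1top (f r))) imset_f.
have outI v : (out v \in [set out d | d in [set v | out v \in I]]) = (out v \in I).
  by rewrite (mem_imset _ _ (@out_inj t)) inE.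
have fP e : f e \notin [set out d | d in [set v | out v \in I]].
  apply/imsetP => -[d]; rewrite !inE => + fe.
  by rewrite -fe imset_f.
pose g e : edge (contract sI) :=
  exist (fun e => e \notin [set out d | d in [set v | out v \in I]]) (f e) (fP e).
exists I, sI; apply: (@embeds_iso _ _ g); first split.
- by move=> x y /(congr1 val)/fi.
- by move=> a; apply: val_inj; rewrite /= fl.
- by move=> e e'; rewrite fb; exact/esym/sup_below.
- move=> r rN v; have [r1 r1N r1top] := rooted (contract sI).
  have : below t (val (g r)) (val r1).
    by rewrite -sup_below; exact: r1top.
  by move=> H; rewrite (val_inj (below_root (fr r rN) H : val r1 = val (g r))) in r1N *; exact: r1N.
- apply: inj_card_bij; first by move=> x y /(congr1 val)/fi.
  have hP (e : edge (contract sI)) : {x | f x = val e}.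
    suff ev : val e \in codom f by exists (iinv ev); rewrite f_iinv.
    suff /imsetP[x _ ->] : val e \in f @: setT by exact: codom_f.
    apply: contraT => eI; have {}eI : val e \in I by rewrite inE.
    have /subsetP/(_ _ eI) := sI; rewrite inE => /andP[/codomP[v ve] _].
    by move: (sup_edgeP e); rewrite ve outI -ve eI.
  have hinj : injective (fun e => sval (hP e)).
    by move=> x y /= E; apply: val_inj; rewrite -(svalP (hP x)) -(svalP (hP y)) E.
  exact: leq_card hinj.
Qed.

Lemma contracts_refl s : contracts s s.
Proof. by apply/contractsP/iso_embeds/ltree_iso_refl. Qed.

Lemma contracts_trans t s u : contracts s t -> contracts t u -> contracts s u.
Proof.
move=> /contractsP[f fE] /contractsP[g gE]; apply/contractsP.
by exists (g \o f); exact: embeds_comp fE gE.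
Qed.

Lemma contracts_anti s t : contracts s t -> contracts t s -> ltree_iso s t.
Proof.
move=> /contractsP[f fE] /contractsP[g gE]; apply: (embeds_iso fE).
apply: inj_card_bij; first by case: fE.
by case: gE => /leq_card.
Qed.

Lemma iso_contracts s t : ltree_iso s t -> contracts s t.
Proof. by move=> /iso_embeds st; apply/contractsP. Qed.

Section OrdTreeOf.
Variable t : ltree A.

Definition rank_out (v : 'I_#|vertex t|) : 'I_#|edge t| :=
  enum_rank (out (enum_val v)).
Definition rank_inn (v : 'I_#|vertex t|) : {set 'I_#|edge t|} :=
  enum_rank @: inn (enum_val v).
Definition rank_leaf (a : A) : 'I_#|edge t| := enum_rank (leaf_lab t a).

Lemma rank_innE e v : (e \in rank_inn v) = (enum_val e \in inn (enum_val v)).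
Proof. by rewrite -{1}(enum_valK e) (mem_imset _ _ enum_rank_inj). Qed.

Lemma rank_is_tree : is_tree rank_out rank_inn rank_leaf.
Proof.
split.
- by move=> v w /enum_rank_inj/out_inj/enum_val_inj.
- by move=> e v w; rewrite !rank_innE => ev ew; exact: enum_val_inj (inn_inj ev ew).
- have [r rN rtop] := rooted t; exists (enum_rank r) => [v|e].
    by rewrite rank_innE enum_rankK.
  rewrite -(enum_valK e); elim/connect_ind: (rtop (enum_val e)) => [|x z].
    exact: connect0.
  move=> /downP[d [_ xd dz]] _; apply: connect_trans; apply: connect1.
  apply/existsP; exists (enum_rank d); rewrite !inE rank_innE !enum_rankK xd /=.
  by rewrite /rank_out enum_rankK dz.
- by move=> a b /enum_rank_inj/leaf_lab_inj.
- move=> e; rewrite -(enum_valK e).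
  transitivity (enum_val e \in codom (leaf_lab t)).
    by apply/codomP/codomP => -[a aE]; exists a; [exact: enum_rank_inj|rewrite aE].
  rewrite leaf_labP; congr (~~ _).
  apply/codomP/codomP => -[v vE]; last by exists (enum_val v); exact: enum_rank_inj.
  by exists (enum_rank v); rewrite /rank_out enum_rankK vE.
Qed.

Lemma ord_tree_exists : exists u : ord_tree A, ltree_iso t u.
Proof.
exists (OrdTree rank_is_tree).
exists (fun e => enum_rank e), (fun v => enum_rank v); split=> //=.
- exact: enum_rank_bij.
- exact: enum_rank_bij.
- by move=> v; rewrite /rank_out enum_rankK.
- by move=> v; rewrite /rank_inn enum_rankK.
Qed.

End OrdTreeOf.
(** Being [reduced] and having an inner edge are invariant under isomorphism
    ([reduced_iso], [has_inner_edge_iso]), so they can be tested on a representative. *)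
Definition reduced (t : ltree A) : bool := [forall v : vertex t, (1 < #|inn v|)%N].

Lemma reduced_iso (s t : ltree A) : ltree_iso s t -> reduced s = reduced t.
Proof.
move=> [f [g [fb [g' gK g'K] _ fi _]]].
apply/forallP/forallP => H v; last by rewrite -(card_imset _ (bij_inj fb)) fi.
by rewrite -(g'K v) -fi (card_imset _ (bij_inj fb)).
Qed.

Definition has_inner_edge (t : ltree A) : bool := inner_edges t != set0.

Lemma has_inner_edge_iso (s t : ltree A) :
  ltree_iso s t -> has_inner_edge s = has_inner_edge t.
Proof.
suff H (u v : ltree A) : ltree_iso u v -> has_inner_edge u -> has_inner_edge v.
  by move=> st; apply/idP/idP; apply: H => //; exact: ltree_iso_sym.
move=> [f [g [fb _ fo fi _]]] /set0Pn[e]; rewrite inE => /andP[/codomP[w ->]].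
move=> /existsP[x wx]; apply/set0Pn; exists (f (out w)); rewrite inE; apply/andP; split.
  by rewrite fo codom_f.
by apply/existsP; exists (g x); rewrite -fi imset_f.
Qed.

End TreeTheory.

Section Partitions.
Variable A : finType.

Definition setpart := {P : {set {set A}} | partition P [set: A]}.

HB.instance Definition _ := SubFinite.on setpart.

(** [refined P Q], the order [P <= Q], means that [Q] refines [P]. *)
Definition refined (P Q : setpart) : bool :=
  [forall b in val Q, exists c in val P, b \subset c].

Fact refinement_display : Order.disp_t. Proof. exact: Order.Disp tt tt. Qed.

Lemma refinedP (P Q : setpart) :
  reflect (forall b, b \in val Q -> exists2 c, c \in val P & b \subset c)
          (refined P Q).
Proof.
apply: (iffP forall_inP) => H b /H; first by move=> /exists_inP.
by move=> cP; apply/exists_inP.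
Qed.

Lemma part_neq0 (P : {set {set A}}) b : partition P [set: A] -> b \in P -> b != set0.
Proof. by move=> /and3P[_ _ P0] bP; apply: contraNneq P0 => <-. Qed.

Lemma part_eq (P : {set {set A}}) b c x : partition P [set: A] ->
  b \in P -> c \in P -> x \in b -> x \in c -> b = c.
Proof.
move=> /and3P[_ tP _] bP cP xb xc.
by rewrite -(def_pblock tP bP xb) (def_pblock tP cP xc).
Qed.

Lemma refined_refl : reflexive refined.
Proof. by move=> P; apply/refinedP => b bP; exists b. Qed.

Lemma refined_trans : transitive refined.
Proof.
move=> P Q R /refinedP QP /refinedP PR; apply/refinedP => b /PR[c /QP[d dQ cd] bc].
by exists d => //; exact: subset_trans bc cd.
Qed.

Lemma refined_anti : antisymmetric refined.
Proof.
suff H P Q : refined P Q -> refined Q P -> val Q \subset val P.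
  move=> P Q /andP[PQ QP]; apply: val_inj; apply/eqP.
  by rewrite eqEsubset !H.
move=> /refinedP PQ /refinedP QP; apply/subsetP => b bQ.
have [c cP bc] := PQ b bQ; have [d dQ cd] := QP c cP.
have /set0Pn[x xb] := part_neq0 (valP Q) bQ.
have bd := part_eq (valP Q) bQ dQ xb (subsetP (subset_trans bc cd) _ xb).
suff -> : b = c by [].
by apply/eqP; rewrite eqEsubset bc bd cd.
Qed.

HB.instance Definition _ := Order.isPOrder.Build refinement_display setpart
  (fun P Q => erefl ((Q != P) && refined P Q)) refined_refl refined_anti refined_trans.

Definition indiscrete : {set {set A}} := [set [set: A]].
Definition discrete : {set {set A}} := [set [set a] | a : A].

Definition ntpart :=
  {P : setpart | (val P != indiscrete) && (val P != discrete)}.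

HB.instance Definition _ := SubFinite.on ntpart.
HB.instance Definition _ :=
  [SubChoice_isSubPOrder of ntpart by <: with refinement_display].

Section Layered.
Variables (p : nat) (c : 'I_p.+1 -> ntpart).
Hypothesis c_homo : {homo c : i j / (i <= j)%O}.

(** The indices are shifted by one: [layer i] is the partition [P_(i-1)] of the
    extended chain [P_(-1) <= P_0 <= ... <= P_p <= P_(p+1)]. *)
Definition layer (i : nat) : {set {set A}} :=
  if i is j.+1 then
    if j <= p then val (val (c (inord j))) else discrete
  else indiscrete.

Definition lay_edge : finType := {x : 'I_p.+3 * {set A} | x.2 \in layer x.1}.
Definition lay_vertex : finType := {x : 'I_p.+2 * {set A} | x.2 \in layer x.1}.

Definition lay_out (v : lay_vertex) : lay_edge :=
  exist (fun x : 'I_p.+3 * {set A} => x.2 \in layer x.1)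
    (widen_ord (leqnSn _) (val v).1, (val v).2) (valP v).

Definition lay_inn (v : lay_vertex) : {set lay_edge} :=
  [set e : lay_edge | ((val e).1 == (val v).1.+1 :> nat)
                      && ((val e).2 \subset (val v).2)].

Lemma lay_labP a : [set a] \in layer (@ord_max p.+2).
Proof. by rewrite /= ltnn imset_f. Qed.

Definition lay_lab (a : A) : lay_edge :=
  exist (fun x : 'I_p.+3 * {set A} => x.2 \in layer x.1) (ord_max, [set a]) (lay_labP a).

Lemma discrete_part : partition discrete [set: A].
Proof.
apply/and3P; split.
- apply/eqP/setP => a; rewrite inE; apply/bigcupP; exists [set a]; last by rewrite inE.
  by rewrite imset_f.
- apply/trivIsetP => _ _ /imsetP[a _ ->] /imsetP[b _ ->] ab.
  rewrite disjoints1 inE; apply: contraNN ab => /eqP ->; exact: eqxx.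
- by apply/imsetP => -[a _] /setP/(_ a); rewrite !inE eqxx.
Qed.

Lemma layer_part i : partition (layer i) [set: A].
Proof.
case: i => [|j] /=; last first.
  by case: ifP => _; [exact: (valP (val (c (inord j))))|exact: discrete_part].
apply/and3P; split; [by rewrite /cover big_set1|exact: trivIset1|].
rewrite inE eq_sym; apply/negP => /eqP A0.
have /andP[_ /eqP] := valP (c ord0); apply.
have part0 (P : {set {set A}}) : partition P [set: A] -> P = set0.
  by rewrite A0 partition_set0 => /eqP.
by rewrite [LHS](part0 _ (valP (val (c ord0)))) [RHS](part0 _ discrete_part).
Qed.

Lemma layer_refined i b : i <= p.+1 -> b \in layer i.+1 ->
  exists2 b', b' \in layer i & b \subset b'.
Proof.
case: i => [|i] /= ip; first by exists [set: A]; rewrite ?inE.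
rewrite ltnS in ip; rewrite ip; case: ltnP => [ip'|_] bb.
  have : (c (inord i) <= c (inord i.+1))%O.
    have H1 : inord i = i :> nat := inordK (ip : i < p.+1).
    have H2 : inord i.+1 = i.+1 :> nat := inordK (ip' : i.+1 < p.+1).
    by apply: c_homo; rewrite leEord H1 H2 leqnSn.
  by move=> /refinedP/(_ _ bb).
move: bb => /imsetP[a _ ->].
have : a \in cover (val (val (c (inord i)))).
  by rewrite (cover_partition (valP (val (c (inord i))))).
by move=> /bigcupP[b' bP ab]; exists b' => //; rewrite sub1set.
Qed.

Lemma lay_out_inj : injective lay_out.
Proof.
move=> v w /(congr1 val) [iE bE]; apply: val_inj.
by rewrite [LHS]surjective_pairing [RHS]surjective_pairing bE (val_inj iE).
Qed.

Lemma lay_inn_inj e v w : e \in lay_inn v -> e \in lay_inn w -> v = w.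
Proof.
rewrite !inE => /andP[/eqP ev bv] /andP[/eqP ew bw].
have /set0Pn[x xe] := part_neq0 (layer_part _) (valP e).
have E : (val v).1 = (val w).1 by apply: val_inj; apply: succn_inj; rewrite -ev -ew.
have wP := valP w; rewrite -E in wP.
have := part_eq (layer_part _) (valP v) wP (subsetP bv _ xe) (subsetP bw _ xe).
by move=> E2; apply: val_inj; rewrite [LHS]surjective_pairing [RHS]surjective_pairing E E2.
Qed.

Lemma lay_rooted : exists2 r, forall v, r \notin lay_inn v
  & forall e, connect (step_through lay_out lay_inn setT) e r.
Proof.
have rP : [set: A] \in layer (@ord0 p.+2) by rewrite /= inE.
exists (exist (fun x : 'I_p.+3 * {set A} => x.2 \in layer x.1) (ord0, [set: A]) rP).
  by move=> v; rewrite inE.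
move=> [[[i ip] b] bP]; elim: i ip b bP => [|i IH] ip b bP.
  apply: eq_connect0; apply: val_inj => /=; congr (_, _); first exact: val_inj.
  by move: (bP); rewrite /= inE => /eqP.
have [b' b'P bb'] := layer_refined ip bP.
have ip' : i < p.+3 by exact: ltnW.
apply: connect_trans (IH ip' b' b'P); apply: connect1.
pose v : lay_vertex :=
  exist (fun x : 'I_p.+2 * {set A} => x.2 \in layer x.1) (Ordinal (ip : i < p.+2), b') b'P.
apply/existsP; exists v; rewrite !inE /= eqxx bb' /=.
by apply/eqP; apply: val_inj => /=; congr (_, _); exact: val_inj.
Qed.

Lemma lay_lab_inj : injective lay_lab.
Proof. by move=> a b /(congr1 val) [] /set1_inj. Qed.

Lemma lay_labE e : (e \in codom lay_lab) = (e \notin codom lay_out).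
Proof.
apply/idP/idP => [/codomP[a ->]|].
  apply/codomP => -[v /(congr1 val)[iE _]].
  by have := ltn_ord (val v).1; rewrite -iE ltnn.
move: e => [[[i ip] b] bP] eN.
have := ip; rewrite leq_eqVlt => /orP[/eqP[iE]|ip'].
  have : b \in layer p.+2 by rewrite -iE.
  rewrite /= ltnn => /imsetP[a _ ba].
  apply/codomP; exists a; apply: val_inj => /=; rewrite ba; congr (_, _).
  exact: val_inj.
case/negP: eN; apply/codomP.
exists (exist (fun x : 'I_p.+2 * {set A} => x.2 \in layer x.1) (Ordinal (ip' : i < p.+2), b) bP).
by apply: val_inj => /=; congr (_, _); exact: val_inj.
Qed.

Definition layered : ltree A :=
  LTree (IsTree lay_out_inj lay_inn_inj lay_rooted lay_lab_inj lay_labE).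

End Layered.
End Partitions.

From mathcomp Require Import all_algebra.
From mathcomp Require Import all_classical all_reals all_analysis.

Import GRing.Theory Num.Theory.
Import numFieldNormedType.Exports.

Record category := Category {
  ob :> Type;
  hom : ob -> ob -> Type;
  idm : forall x, hom x x;
  cmp : forall x y z, hom y z -> hom x y -> hom x z;
  cmp1m : forall x y (f : hom x y), cmp (idm y) f = f;
  cmpm1 : forall x y (f : hom x y), cmp f (idm x) = f;
  cmpA : forall w x y z (h : hom y z) (g : hom x y) (f : hom w x),
    cmp h (cmp g f) = cmp (cmp h g) f
}.
Arguments idm {c} x.

Record functor (C D : category) := Functor {
  fob :> C -> D;
  fmap : forall x y, hom x y -> hom (fob x) (fob y);
  fmap1 : forall x, fmap (idm x) = idm (fob x);
  fmapM : forall x y z (g : hom y z) (f : hom x y),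
    fmap (cmp g f) = cmp (fmap g) (fmap f)
}.

Lemma functor_eq (C D : category) (F G : functor C D) (E : fob F = fob G) :
  (forall x y (f : hom x y),
     eq_rect _ (fun o : C -> D => hom (o x) (o y)) (fmap F f) _ E = fmap G f) ->
  F = G.
Proof.
case: F E => o m m1 mM; case: G => o' m' m1' mM' /= E; subst o' => /= mE.
have {mE}E : m = m'.
  apply: functional_extensionality_dep => x; apply: functional_extensionality_dep => y.
  by apply: functional_extensionality_dep => f; exact: mE.
by subst m'; congr Functor; exact: Prop_irrelevance.
Qed.

Section FunctorComp.
Variables (B C D : category) (G : functor C D) (F : functor B C).
Lemma fcomp1 x : fmap G (fmap F (idm x)) = idm (G (F x)).
Proof. by rewrite !fmap1. Qed.
Lemma fcompM x y z (g : hom y z) (f : hom x y) :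
  fmap G (fmap F (cmp g f)) = cmp (fmap G (fmap F g)) (fmap G (fmap F f)).
Proof. by rewrite !fmapM. Qed.
Definition fcomp : functor B D := Functor fcomp1 fcompM.
End FunctorComp.

Section PosetCategory.
Variables (d : Order.disp_t) (P : porderType d).
Definition poset_hom (x y : P) : Type := (x <= y)%O.
Definition poset_idm (x : P) : poset_hom x x := lexx x.
Definition poset_cmp (x y z : P) (g : poset_hom y z) (f : poset_hom x y) :
  poset_hom x z := le_trans f g.
Definition poset_category : category :=
  @Category P poset_hom poset_idm poset_cmp
    (fun _ _ _ => bool_irrelevance _ _) (fun _ _ _ => bool_irrelevance _ _)
    (fun _ _ _ _ _ _ _ => bool_irrelevance _ _).
End PosetCategory.

Definition linear_category (p : nat) : category := poset_category 'I_p.+1.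

(** Morphisms [p] -> [q] of the simplex category. *)
Record Delta (p q : nat) := DeltaMap {
  Delta_fun :> 'I_p.+1 -> 'I_q.+1;
  Delta_homo : {homo Delta_fun : i j / (i <= j)%O}
}.

Lemma Delta_eq p q (f g : Delta p q) : Delta_fun f = Delta_fun g -> f = g.
Proof.
case: f g => [f fP] [g gP] /= fg; subst g.
by congr DeltaMap; exact: Prop_irrelevance.
Qed.

Definition Delta_id p : Delta p p := @DeltaMap p p id (fun _ _ => id).

Definition Delta_comp p q r (g : Delta q r) (f : Delta p q) : Delta p r :=
  @DeltaMap p r (g \o f) (fun _ _ ij => Delta_homo g (Delta_homo f ij)).

Definition Delta_functor p q (f : Delta p q) :
    functor (linear_category p) (linear_category q) :=
  @Functor (linear_category p) (linear_category q) f (@Delta_homo _ _ f)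
    (fun _ => bool_irrelevance _ _) (fun _ _ _ _ _ => bool_irrelevance _ _).

Record sset := SSet {
  simplex :> nat -> Type;
  act : forall p q, Delta p q -> simplex q -> simplex p;
  act1 : forall p (s : simplex p), act (Delta_id p) s = s;
  actM : forall p q r (g : Delta q r) (f : Delta p q) (s : simplex r),
    act (Delta_comp g f) s = act f (act g s)
}.

Record smap (X Y : sset) := SMap {
  smap_fun :> forall p, X p -> Y p;
  smap_act : forall p q (f : Delta p q) (s : X q),
    smap_fun (act f s) = act f (smap_fun s)
}.

Section Nerve.
Variable C : category.

Lemma nerve_act1 p (s : functor (linear_category p) C) :
  fcomp s (Delta_functor (Delta_id p)) = s.
Proof.
have E : fob (fcomp s (Delta_functor (Delta_id p))) = fob s by [].
apply: (functor_eq (E := E)) => x y f; rewrite (Prop_irrelevance E erefl) /=.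
by congr fmap; exact: bool_irrelevance.
Qed.

Lemma nerve_actM p q r (g : Delta q r) (f : Delta p q)
    (s : functor (linear_category r) C) :
  fcomp s (Delta_functor (Delta_comp g f)) =
  fcomp (fcomp s (Delta_functor g)) (Delta_functor f).
Proof.
have E : fob (fcomp s (Delta_functor (Delta_comp g f))) =
  fob (fcomp (fcomp s (Delta_functor g)) (Delta_functor f)) by [].
apply: (functor_eq (E := E)) => x y h; rewrite (Prop_irrelevance E erefl) /=.
by congr fmap; exact: bool_irrelevance.
Qed.

Definition nerve : sset :=
  @SSet (fun p => functor (linear_category p) C)
    (fun p q f s => fcomp s (Delta_functor f)) nerve_act1 nerve_actM.
End Nerve.

Section NerveMap.
Variables (C D : category) (F : functor C D).
Lemma nerve_map_act p q (f : Delta p q) (s : nerve C q) :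
  fcomp F (act f s) = act f (fcomp F s : nerve D q).
Proof.
have E : fob (fcomp F (act f s)) = fob (act f (fcomp F s : nerve D q)) by [].
by apply: (functor_eq (E := E)) => x y h; rewrite (Prop_irrelevance E erefl).
Qed.
Definition nerve_map : smap (nerve C) (nerve D) :=
  @SMap (nerve C) (nerve D) (fun p s => fcomp F s) nerve_map_act.
End NerveMap.

Section Simplices.
Variable X : sset.
Definition simplices_ob : Type := {p : nat & X p}.
Definition simplices_hom (s t : simplices_ob) : Type :=
  {f : Delta (projT1 s) (projT1 t) | act f (projT2 t) = projT2 s}.
Definition simplices_id s : simplices_hom s s :=
  exist _ (Delta_id _) (act1 _).
Lemma simplices_cmpP s t u (g : simplices_hom t u) (f : simplices_hom s t) :
  act (Delta_comp (sval g) (sval f)) (projT2 u) = projT2 s.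
Proof. by rewrite actM (svalP g) (svalP f). Qed.
Definition simplices_cmp s t u (g : simplices_hom t u) (f : simplices_hom s t) :
  simplices_hom s u := exist _ _ (simplices_cmpP g f).

Lemma simplices_hom_eq s t (f g : simplices_hom s t) :
  Delta_fun (sval f) = Delta_fun (sval g) -> f = g.
Proof. by move=> E; apply: eq_sig_hprop (Delta_eq E) => *; exact: Prop_irrelevance. Qed.

Definition simplices : category :=
  @Category simplices_ob simplices_hom simplices_id simplices_cmp
    (fun s t f => @simplices_hom_eq s t (simplices_cmp (simplices_id t) f) f erefl)
    (fun s t f => @simplices_hom_eq s t (simplices_cmp f (simplices_id s)) f erefl)
    (fun s t u v h g f => @simplices_hom_eq s v (simplices_cmp h (simplices_cmp g f))
       (simplices_cmp (simplices_cmp h g) f) erefl).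
End Simplices.

Section Slice.
Variables (D C : category) (F : functor D C) (c : C).
Definition slice_ob : Type := {d : D & hom (F d) c}.
Definition slice_hom (x y : slice_ob) : Type :=
  {b : hom (projT1 x) (projT1 y) | cmp (projT2 y) (fmap F b) = projT2 x}.
Lemma slice_idP (x : slice_ob) : cmp (projT2 x) (fmap F (idm (projT1 x))) = projT2 x.
Proof. by rewrite fmap1 cmpm1. Qed.
Lemma slice_cmpP (x y z : slice_ob) (g : slice_hom y z) (f : slice_hom x y) :
  cmp (projT2 z) (fmap F (cmp (sval g) (sval f))) = projT2 x.
Proof. by rewrite fmapM cmpA (svalP g) (svalP f). Qed.
Definition slice_id (x : slice_ob) : slice_hom x x := exist _ _ (slice_idP x).
Definition slice_cmp (x y z : slice_ob) (g : slice_hom y z) (f : slice_hom x y) :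
  slice_hom x z := exist _ _ (slice_cmpP g f).
Lemma slice_hom_eq (x y : slice_ob) (f g : slice_hom x y) : sval f = sval g -> f = g.
Proof. by apply: eq_sig_hprop => *; exact: Prop_irrelevance. Qed.
Definition slice : category :=
  @Category slice_ob slice_hom slice_id slice_cmp
    (fun x y f => @slice_hom_eq x y (slice_cmp (slice_id y) f) f (cmp1m (sval f)))
    (fun x y f => @slice_hom_eq x y (slice_cmp f (slice_id x)) f (cmpm1 (sval f)))
    (fun w x y z h g f => @slice_hom_eq w z (slice_cmp h (slice_cmp g f))
       (slice_cmp (slice_cmp h g) f) (cmpA (sval h) (sval g) (sval f))).
End Slice.

Local Open Scope ring_scope.
Local Open Scope classical_set_scope.
Local Open Scope quotient_scope.

Section Realization.
Variable R : realType.

Definition std_simplex (n : nat) : set 'rV[R]_n.+1 :=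
  [set t | (forall i, 0 <= t ord0 i) /\ \sum_i t ord0 i = 1].

Arguments std_simplex : clear implicits.

Definition std_simplexT (n : nat) : topologicalType := set_type (std_simplex n).

Lemma push_subproof p q (f : Delta p q) (t : std_simplexT p) :
  (\row_j \sum_(i | f i == j) (val t) ord0 i) \in std_simplex q.
Proof.
have [t0 t1] : std_simplex p (val t) by apply/set_mem; exact: valP t.
apply/mem_set; split=> [j|].
  by rewrite mxE; apply: sumr_ge0 => i _; exact: t0.
rewrite -t1 (partition_big f xpredT) //=.
by apply: eq_bigr => j _; rewrite mxE.
Qed.

(** The affine map of standard simplices induced by [f]. *)
Definition push p q (f : Delta p q) (t : std_simplexT p) : std_simplexT q :=
  exist (fun x => x \in std_simplex q) _ (push_subproof f t).

Variable X : sset.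

(** The disjoint union of one standard [p]-simplex for each [p]-simplex of [X], that
    is, of the products of [X p] (discrete) with the standard [p]-simplex. *)
Definition cells : Type := {s : {classic simplices_ob X} & std_simplexT (projT1 s)}.

HB.instance Definition _ := Topological.on cells.

Definition cell p (s : X p) (t : std_simplexT p) : cells :=
  existT (fun s : {classic simplices_ob X} => std_simplexT (projT1 s))
    (existT (simplex X) p s) t.

Inductive glue_step : cells -> cells -> Prop :=
  Glue p q (f : Delta p q) (s : X q) (t : std_simplexT p) :
    glue_step (cell (act f s) t) (cell s (push f t)).

Definition glued : rel cells := fun x y => `[< clos_refl_sym_trans _ glue_step x y >].

Lemma glued_equiv : equiv_class_of glued.
Proof.
split.
- by move=> x; apply/asboolP; exact: rst_refl.
- by move=> x y; apply/asboolP/asboolP; exact: rst_sym.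
- by move=> y x z /asboolP xy /asboolP yz; apply/asboolP; exact: rst_trans xy yz.
Qed.

Canonical glued_equivRel := EquivRelPack glued_equiv.

Definition realization : topologicalType :=
  quotient_topology {eq_quot glued_equivRel}.

Definition point_of (c : cells) : realization :=
  \pi_(quotient_topology {eq_quot glued_equivRel}) c.

Lemma realization_openP (U : set realization) :
  open U <->
  forall p (s : X p), open ((fun t : std_simplexT p => point_of (cell s t)) @^-1` U).
Proof.
have UP := @sigT_openP _ _ (point_of @^-1` U).
split=> [oU p s|oU]; first exact: (UP.1 oU (existT _ p s)).
by apply/UP => -[p s]; exact: oU.
Qed.

End Realization.

Section RealizationMap.
Variables (R : realType) (X Y : sset) (f : smap X Y).

Let F (c : cells R X) : cells R Y := cell (f _ (projT2 (projT1 c))) (projT2 c).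

(** Well defined on classes by [realization_map_cell]. *)
Definition realization_map (x : realization R X) : realization R Y :=
  point_of (F (repr x)).

Lemma realization_map_cell p (s : X p) (t : std_simplexT R p) :
  realization_map (point_of (cell s t)) = point_of (cell (f p s) t).
Proof.
have glueF x y : glue_step x y -> glue_step (F x) (F y).
  case=> {}p q g {}s {}t; rewrite /F /cell /= smap_act; exact: Glue.
have FE a b : glued a b -> point_of (F a) = point_of (F b).
  move=> /asboolP ab; apply/eqmodP; apply/asboolP.
  elim: ab => {a b} [x y /glueF xy|x|x y _|x y z _ xy _].
  - exact: rst_step.
  - exact: rst_refl.
  - exact: rst_sym.
  - exact: rst_trans.
rewrite /realization_map -[cell (f p s) t]/(F (cell s t)); apply: FE.
by rewrite -eqmodE; apply/eqP; exact: reprK.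
Qed.
End RealizationMap.

Section HomotopyGroups.
Variable R : realType.

Definition cube (n : nat) : set 'rV[R]_n := [set t | forall i, 0 <= t ord0 i <= 1].
Arguments cube : clear implicits.

Definition cube_boundary (n : nat) : set 'rV[R]_n :=
  cube n `&` [set t | exists i, t ord0 i = 0 \/ t ord0 i = 1].
Arguments cube_boundary : clear implicits.

Section Space.
Variable T : topologicalType.

(** Maps of pairs from ([0,1]^n, boundary) to (T, x); modulo [spheroid_homotopic],
    homotopy relative to the boundary, these form the homotopy group pi_n(T, x). *)
Definition spheroid (n : nat) (x : T) (g : 'rV[R]_n -> T) : Prop :=
  {within cube n, continuous g} /\ forall t, cube_boundary n t -> g t = x.

Definition spheroid_homotopic (n : nat) (x : T) (g h : 'rV[R]_n -> T) : Prop :=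
  exists H : R * 'rV[R]_n -> T,
    [/\ {within `[0, 1] `*` cube n, continuous H},
        forall t, cube n t -> H (0, t) = g t,
        forall t, cube n t -> H (1, t) = h t &
        forall (s : R) t, `[0, 1] s -> cube_boundary n t -> H (s, t) = x].

Definition path_joined (x y : T) : Prop :=
  exists2 g : R -> T, {within `[0, 1], continuous g} & g 0 = x /\ g 1 = y.

Definition weakly_contractible : Prop :=
  [/\ exists x : T, True,
      forall x y, path_joined x y &
      forall (n : nat) (x : T) (g : 'rV[R]_n.+1 -> T),
        spheroid x g -> spheroid_homotopic x g (fun=> x)].
End Space.

Definition pi0_bijective (T U : topologicalType) (f : T -> U) : Prop :=
  (forall x y, path_joined (f x) (f y) -> path_joined x y) /\
  (forall z, exists x, path_joined (f x) z).

(** [f] induces a bijection from pi_n(T, x) to pi_n(U, f x): injectivity and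
    surjectivity on homotopy classes of representatives. *)
Definition pi_bijective (T U : topologicalType) (f : T -> U) (n : nat) (x : T) : Prop :=
  (forall g h : 'rV[R]_n -> T, spheroid x g -> spheroid x h ->
     spheroid_homotopic (f x) (f \o g) (f \o h) -> spheroid_homotopic x g h) /\
  (forall k : 'rV[R]_n -> U, spheroid (f x) k ->
     exists2 g, spheroid x g & spheroid_homotopic (f x) (f \o g) k).

Definition weak_equivalence (T U : topologicalType) (f : T -> U) : Prop :=
  [/\ continuous f, pi0_bijective f &
      forall (n : nat) (x : T), pi_bijective f n.+1 x].

End HomotopyGroups.

Section ClassifyingSpace.
Variable R : realType.

Definition classifying_space (C : category) : topologicalType :=
  realization R (nerve C).

Definition classifying_map (C D : category) (F : functor C D) :
    classifying_space C -> classifying_space D :=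
  realization_map (nerve_map F).

End ClassifyingSpace.

Section TreePoset.
Variable A : finType.

HB.instance Definition _ := gen_eqMixin (ord_tree A).
HB.instance Definition _ := gen_choiceMixin (ord_tree A).

Definition isob : rel (ord_tree A) := fun s t => `[< ltree_iso s t >].

Lemma isob_equiv : equiv_class_of isob.
Proof.
split.
- by move=> s; apply/asboolP; exact: ltree_iso_refl.
- by move=> s t; apply/asboolP/asboolP; exact: ltree_iso_sym.
- by move=> t s u /asboolP st /asboolP tu; apply/asboolP; exact: ltree_iso_trans st tu.
Qed.
Canonical isob_equivRel := EquivRelPack isob_equiv.

Definition tree_class := {eq_quot isob_equivRel}.
HB.instance Definition _ := EqQuotient.on tree_class.
HB.instance Definition _ := Choice.on tree_class.

(** The order [S <= T] of the poset of trees. *)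
Definition contractsb (S T : tree_class) : bool :=
  `[< exists s t, [/\ \pi s = S, \pi t = T & contracts s t] >].

Lemma contractsb_pi (s t : ord_tree A) :
  reflect (contracts s t) (contractsb (\pi s) (\pi t)).
Proof.
apply: (iffP (asboolP _)) => [[s' [t' [ss tt st]]]|st]; last by exists s, t.
have /asboolP/iso_contracts st1 : isob s s' by rewrite -eqmodE ss.
have /asboolP/iso_contracts st2 : isob t' t by rewrite -eqmodE tt.
exact: contracts_trans st1 (contracts_trans st st2).
Qed.

Lemma contractsb_refl : reflexive contractsb.
Proof.
by move=> S; rewrite -[S]reprK; apply/contractsb_pi; exact: contracts_refl.
Qed.

Lemma contractsb_trans : transitive contractsb.
Proof.
move=> S T U; rewrite -[S]reprK -[T]reprK -[U]reprK.
move=> /contractsb_pi TS /contractsb_pi SU; apply/contractsb_pi.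
exact: contracts_trans TS SU.
Qed.

Lemma contractsb_anti : antisymmetric contractsb.
Proof.
move=> S T /andP[]; rewrite -[S]reprK -[T]reprK.
move=> /contractsb_pi ST /contractsb_pi TS.
by apply/eqmodP/asboolP; exact: contracts_anti ST TS.
Qed.

Fact contraction_display : Order.disp_t. Proof. exact: Order.Disp tt tt. Qed.
HB.instance Definition _ := Order.Le_isPOrder.Build contraction_display tree_class
  contractsb_refl contractsb_anti contractsb_trans.

Definition tree_poset := {T : tree_class | reduced (repr T)}.
HB.instance Definition _ := SubChoice.on tree_poset.
HB.instance Definition _ :=
  [SubChoice_isSubPOrder of tree_poset by <: with contraction_display].

Definition tree_poset_plus :=
  {T : tree_poset | has_inner_edge (repr (val T))}.
HB.instance Definition _ := SubChoice.on tree_poset_plus.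
HB.instance Definition _ :=
  [SubChoice_isSubPOrder of tree_poset_plus by <: with contraction_display].

End TreePoset.

Section LayeredTree.
Variable A : finType.

Definition NP : sset := nerve (poset_category (ntpart A)).

Definition Tplus : category := poset_category (tree_poset_plus A).

Definition chain p (s : NP p) : 'I_p.+1 -> ntpart A := fob s.

Lemma chain_homo p (s : NP p) : {homo chain s : i j / (i <= j)%O}.
Proof. by move=> i j ij; exact: (fmap s (ij : @hom (linear_category p) i j)). Qed.

Definition layered_tree p (s : NP p) : ltree A := layered (@chain_homo p s).

Definition underlying_tree (T : Tplus) : ltree A := repr (val (val (T : tree_poset_plus A))).

End LayeredTree.

(* Main.v *)
(** Every simplex [s] of [NP A] has a set of vertices [r s], a nonempty chain of
partitions, and a chain [c] has an increasing enumeration [i c], a nondegenerate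
simplex.  A morphism from [s] to [i c] exists if and only if [r s] is contained in
[c], and it is then unique; so any two functors to the category of simplices, the
second of which factors through [i], are related by a natural transformation as soon
as the vertices of the first belong to the chains of the second.

A reduced tree is determined by its clusters (the sets of leaves above its edges), and
contraction corresponds to inclusion of sets of clusters.  The clusters of the tree
[phi s] are the blocks of the vertices of [s], the singletons and [A].  Let [M T] be
the partition of [A] into the maximal proper clusters of [T].  It is nontrivial,
order-reversing in [T], and [M (phi s)] is the first vertex of [s].  If [phi s <= T],
then [M T] is below all vertices of [s], and adding it to [s] gives a tree that is
still [<= T]; thus [s -> i (r s + M T) <- i (M T)] contracts the slice over [T].

For the weak equivalence, let [sd Q] be the poset of nonempty chains of a finite poset
[Q].  The functor [max : sd Q -> Q] is a homotopy equivalence, with inverse given by the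
barycentric subdivision.  The functor [G : sd T+ -> Delta / NP], sending a chain of
trees [S] to [i {M S}], satisfies [phi G <= max]; and [G (sd (phi i))] maps naturally to
[i max].  Hence [G] composed with the subdivision of [T+] is a homotopy inverse of
[phi].  No finiteness of the category of simplices is involved: a natural
transformation always gives a homotopy. *)
From HB Require Import structures.
Require Import Defs.
From mathcomp Require Import all_boot all_order boolp.

Set Implicit Arguments.
Unset Strict Implicit.
Unset Printing Implicit Defensive.

Import Order.TTheory.

(** * Trees and their clusters *)

Section Clusters.
Variable A : finType.
Implicit Types (s t : ltree A) (a : A).

Definition cluster t (e : edge t) : {set A} := [set a | below (leaf_lab t a) e].

Definition clusters t : {set {set A}} := [set cluster e | e : edge t].

Lemma clusterE t a (e : edge t) : (a \in cluster e) = below (leaf_lab t a) e.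
Proof. by rewrite inE. Qed.

Lemma cluster_in t (e : edge t) : cluster e \in clusters t.
Proof. exact: imset_f. Qed.

Lemma below_linear t (e x y : edge t) : below e x -> below e y -> below x y || below y x.
Proof. by move=> ex ey; apply/orP; exact: connect_det ex ey. Qed.

Lemma cluster_mono t (x y : edge t) : below x y -> cluster x \subset cluster y.
Proof. by move=> xy; apply/subsetP => a; rewrite !clusterE => /connect_trans; exact. Qed.

Lemma below_leaf t a (e : edge t) : below e (leaf_lab t a) -> e = leaf_lab t a.
Proof.
move=> /connect_last[//|[z _ /downP[v [_ _ va]]]].
by have := leaf_labP (leaf_lab t a); rewrite codom_f -va codom_f.
Qed.

Lemma cluster_leaf t a : cluster (leaf_lab t a) = [set a].
Proof.
apply/setP => b; rewrite clusterE inE; apply/idP/eqP => [/below_leaf/leaf_lab_inj//|->].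
exact: connect0.
Qed.

Lemma inn_below t (v : vertex t) e : e \in inn v -> below e (out v).
Proof. by move=> ev; apply: connect1; apply/downP; exists v; rewrite inE. Qed.

Lemma inn_not_below t (v : vertex t) e : e \in inn v -> ~~ below (out v) e.
Proof.
move=> ev; apply/negP => ve; have E := below_anti ve (inn_below ev).
by apply: (@down_irr _ t e); apply/downP; exists v; rewrite inE.
Qed.

(** Two edges below a common leaf are comparable, and a descending path that leaves [e] passes
    through [out v] first, from which no incoming edge of [v] can be reached. *)
Lemma cluster_inn_inj t (v : vertex t) e e' a : e \in inn v -> e' \in inn v ->
  a \in cluster e -> a \in cluster e' -> e = e'.
Proof.
wlog ee' : e e' / below e e' => [H|] ev e'v.
  move=> ae ae'; move: (ae) (ae'); rewrite !clusterE => be be'.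
  by case/orP: (below_linear be be') => [/H|/H]; [exact|move=> <-].
move=> _ _; case: (connect_cases ee') => // -[z ez ze'].
have zE : out v = z by apply: (@down_det _ _ setT) ez; apply/downP; exists v; rewrite inE.
by move: (inn_not_below e'v); rewrite zE /below ze'.
Qed.

(** The number of edges above a given one is the induction measure for climbing towards the
    leaves. *)
Lemma above_proper t (v : vertex t) e : e \in inn v ->
  (#|[set x | below x e]| < #|[set x | below x (out v)]|)%N.
Proof.
move=> ev; apply: proper_card; apply/properP; split.
  by apply/subsetP => x; rewrite !inE => /connect_trans; apply; exact: inn_below.
by exists (out v); rewrite inE; [exact: connect0|exact: inn_not_below].
Qed.

Lemma edge_cases t (e : edge t) : (exists a, e = leaf_lab t a) \/ exists v, e = out v.
Proof.
have [|] := boolP (e \in codom (leaf_lab t)); first by move=> /codomP; left.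
by rewrite leaf_labP negbK => /codomP; right.
Qed.

(** The edges below a common leaf form a chain. *)
Lemma clusters_laminar t B B' a : B \in clusters t -> B' \in clusters t ->
  a \in B -> a \in B' -> (B \subset B') || (B' \subset B).
Proof.
move=> /imsetP[e _ ->] /imsetP[e' _ ->]; rewrite !clusterE => ae ae'.
by case/orP: (below_linear ae ae') => /cluster_mono ->; rewrite ?orbT.
Qed.

Lemma cluster_root t (r : edge t) : (forall v, r \notin inn v) -> cluster r = setT.
Proof.
move=> rN; have [r1 r1N r1top] := rooted t.
by apply/setP => a; rewrite clusterE inE -(below_root rN (r1top r)); exact: r1top.
Qed.

Lemma setT_in_clusters t : setT \in clusters t.
Proof. by have [r rN _] := rooted t; rewrite -(cluster_root rN) cluster_in. Qed.

Lemma set1_in_clusters t a : [set a] \in clusters t.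
Proof. by rewrite -(cluster_leaf t) cluster_in. Qed.

(** * Deleting unary vertices when every vertex has an incoming edge *)

Section Full.
Variable t : ltree A.
Hypothesis full : forall v : vertex t, inn v != set0.

(** Climbing from an edge can only stop at a leaf, since every vertex has an incoming edge. *)
Lemma cluster_neq0 (e : edge t) : cluster e != set0.
Proof.
have [n] := ubnP #|[set x | below x e]|; elim: n e => // n IH e.
have [[a ->] _|[v ->] vn] := edge_cases e; first by rewrite cluster_leaf -card_gt0 cards1.
have /set0Pn[e' e'v] := full v.
have /set0Pn[a ae'] : cluster e' != set0.
  by apply: IH; rewrite -ltnS; apply: leq_trans vn; rewrite ltnS above_proper.
by apply/set0Pn; exists a; apply: (subsetP (cluster_mono (inn_below e'v))).
Qed.

Lemma clusters_neq0 B : B \in clusters t -> B != set0.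
Proof. by move=> /imsetP[e _ ->]; exact: cluster_neq0. Qed.

(** Deleting a unary vertex removes its lower edge, so climbing through unary vertices ends at a
    surviving edge. *)
Lemma lift_kept (e : edge t) : exists2 e', e' \notin [set out d | d in unary t] &
  connect (down (unary t)) e' e.
Proof.
have [n] := ubnP #|[set x | below x e]|; elim: n e => // n IH e en.
have [|eD] := boolP (e \in [set out d | d in unary t]); last by exists e; rewrite ?connect0.
move=> /imsetP[v vu ev]; have /set0Pn[x xv] := full v.
have [|e' e'D e'x] := IH x.
  by rewrite -ltnS; apply: leq_trans en; rewrite ltnS ev above_proper.
exists e' => //; apply: connect_trans e'x (connect1 _).
by apply/downP; exists v.
Qed.

(** A leaf above the outgoing edge of a unary vertex can reach it only through the single incoming
    edge. *)
Lemma cluster_unary (x y : edge t) : connect (down (unary t)) x y -> cluster x = cluster y.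
Proof.
elim/connect_ind => // {}x z xz _ <-; apply/eqP.
rewrite eqEsubset (cluster_mono (connect1 (downT xz))) /=.
have /downP[v [vu xv vz]] := xz; apply/subsetP => a; rewrite !clusterE.
move=> /connect_last[az|[w aw /downP[v' [_ wv' v'z]]]].
  by have := leaf_labP (leaf_lab t a); rewrite codom_f az -vz codom_f.
have E : v' = v by apply: out_inj; rewrite vz.
move: vu xv wv'; rewrite E inE => /cards1P[u ->]; by rewrite !inE => /eqP -> /eqP <-.
Qed.

Lemma cluster_delete_unary (e : edge (delete_unary t)) : cluster e = cluster (val e).
Proof. by apply/setP => a; rewrite !clusterE; exact: sup_below. Qed.

Lemma clusters_delete_unary : clusters (delete_unary t) = clusters t.
Proof.
apply/setP => B; apply/imsetP/imsetP => -[e _ ->].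
  by exists (val e) => //; exact: cluster_delete_unary.
have [e' e'D /cluster_unary E] := lift_kept e.
exists (exist (fun e => e \notin [set out d | d in unary t]) e' e'D) => //.
by rewrite cluster_delete_unary.
Qed.

(** Each incoming edge of a kept vertex lifts to a surviving edge. The lifts are distinct: edges
    with a common lift would be joined through unary vertices, but no step through a unary vertex
    starts at an incoming edge of a kept one. *)
Lemma reduced_delete_unary : reduced (delete_unary t).
Proof.
apply/forallP => v; have vu := sup_vertexP v.
have vn : (1 < #|inn (val v)|)%N.
  by move: vu; rewrite inE ltn_neqAle card_gt0 full andbT eq_sym.
pose k e := sval (sig2W (lift_kept e)).
have kD e : k e \notin [set out d | d in unary t] by rewrite /k; case: sig2W.
have kP e : connect (down (unary t)) (k e) e by rewrite /k; case: sig2W.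
pose k' e : edge (delete_unary t) :=
  exist (fun e => e \notin [set out d | d in unary t]) (k e) (kD e).
have kinj : {in inn (val v) &, injective k'}.
  move=> e e' ev e'v /(congr1 val) /= E; have := kP e'; rewrite -E => ke'.
  have [H|H] := connect_det (kP e) ke'; first exact: connect_out vu ev H.
  exact/esym/(connect_out vu e'v H).
rewrite -(card_in_imset kinj) in vn; apply: leq_trans vn (subset_leq_card _).
apply/subsetP => _ /imsetP[e ev ->]; rewrite inE; apply/existsP; exists e.
by rewrite ev kP.
Qed.

End Full.

(** * Reduced trees are determined by their clusters *)

Section Reduced.
Variable t : ltree A.
Hypothesis red : reduced t.

Lemma reduced_full (v : vertex t) : inn v != set0.
Proof. by rewrite -card_gt0 ltnW //; exact: (forallP red). Qed.

(** If [e'] were strictly above [e], the vertex with outgoing edge [e] would have a second branch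
    besides the one leading to [e']; its leaves lie in [cluster e] but not in [cluster e']. *)
Lemma below_cluster (e e' : edge t) : below e e' = (cluster e \subset cluster e').
Proof.
apply/idP/idP => [|ee']; first exact: cluster_mono.
have /set0Pn[a ae] := cluster_neq0 reduced_full e; have ae' := subsetP ee' a ae.
move: ae ae'; rewrite !clusterE => ae ae'.
case/orP: (below_linear ae ae') => // e'e.
case: (connect_last e'e) => [->|[z e'z /downP[v [_ zv ve]]]]; first exact: connect0.
have /card_gt1P[x [y [xv yv xy]]] : (1 < #|inn v|)%N by exact: (forallP red).
have [w wv wz] : exists2 w, w \in inn v & w != z.
  by case: (eqVneq x z) xy => [<-|xz _]; [exists y; rewrite // eq_sym|exists x].
have /set0Pn[b bw] := cluster_neq0 reduced_full w.
have bz : b \in cluster z.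
  apply: (subsetP (cluster_mono e'z)); apply: (subsetP ee').
  by rewrite -ve; apply: (subsetP (cluster_mono (inn_below wv))).
by rewrite (cluster_inn_inj wv zv bw bz) eqxx in wz.
Qed.

Lemma cluster_inj : injective (@cluster t).
Proof. by move=> e e' E; apply: below_anti; rewrite below_cluster E. Qed.

Lemma root_cluster (e : edge t) : cluster e = setT -> forall v, e \notin inn v.
Proof.
by have [r rN _] := rooted t; rewrite -(cluster_root rN) => /cluster_inj ->.
Qed.

(** As clusters determine edges, only the root has cluster [setT] and only leaves have singleton
    clusters. *)
Lemma has_inner_edgeP : reflect
  (exists B, [/\ B \in clusters t, B != setT & forall a, B != [set a]])
  (has_inner_edge t).
Proof.
rewrite /has_inner_edge; apply: (iffP (set0Pn _)) => [[e]|[B [/imsetP[e _ ->] eT e1]]].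
  rewrite inE => /andP[eo /existsP[v ev]]; exists (cluster e); split.
  - exact: cluster_in.
  - by apply: contraTneq ev => /root_cluster; exact.
  - move=> a; apply: contraTneq eo; rewrite -(cluster_leaf t) => /cluster_inj ->.
    by rewrite -leaf_labP codom_f.
exists e; rewrite inE; apply/andP; split.
  apply: contraT; rewrite -leaf_labP => /codomP[a ea].
  by move: (e1 a); rewrite ea cluster_leaf eqxx.
apply: contraT => /existsPn/cluster_root E; by rewrite E eqxx in eT.
Qed.

End Reduced.

Lemma embeds_cluster s t f : @embeds _ s t f -> forall e, cluster (f e) = cluster e.
Proof.
by move=> [_ fl fb _] e; apply/setP => a; rewrite !clusterE -fl -fb.
Qed.

(** Contractions are embeddings of edge posets that fix the leaves and the root, and the edge poset
    of a reduced tree is its set of clusters ordered by inclusion. *)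
Lemma contracts_clusters s t : reduced s -> reduced t ->
  contracts s t <-> clusters s \subset clusters t.
Proof.
move=> reds redt; split=> [/contractsP[f fE]|st].
  by apply/subsetP => _ /imsetP[e _ ->]; rewrite -(embeds_cluster fE) cluster_in.
have fP (e : edge s) : exists e' : edge t, cluster e' == cluster e.
  by have /imsetP[e' _ ->] := subsetP st _ (cluster_in e); exists e'.
pose f e := xchoose (fP e); have fE e : cluster (f e) = cluster e := eqP (xchooseP (fP e)).
apply/contractsP; exists f; split.
- by move=> e e' /(congr1 (@cluster t)); rewrite !fE => /(cluster_inj reds).
- by move=> a; apply: (cluster_inj redt); rewrite fE !cluster_leaf.
- by move=> e e'; rewrite !below_cluster // !fE.
- by move=> r rN; apply: root_cluster; rewrite // fE cluster_root.
Qed.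

Lemma iso_clusters s t : ltree_iso s t -> clusters s = clusters t.
Proof.
suff H (u v : ltree A) : ltree_iso u v -> clusters u \subset clusters v.
  by move=> st; apply/eqP; rewrite eqEsubset !H //; exact: ltree_iso_sym.
move=> /iso_embeds[f fE]; apply/subsetP => _ /imsetP[e _ ->].
by rewrite -(embeds_cluster fE) cluster_in.
Qed.

(** * Clusters of layered trees *)

Section LayeredClusters.
Variables (p : nat) (c : 'I_p.+1 -> ntpart A).
Hypothesis c_homo : {homo c : i j / (i <= j)%O}.
Notation L := (layered c_homo).

Lemma layer_block i b a : i <= p.+1 -> b \in layer c i -> a \in b ->
  exists b', [/\ b' \in layer c i.+1, a \in b' & b' \subset b].
Proof.
move=> ip bi ab; have : a \in cover (layer c i.+1).
  by rewrite (cover_partition (layer_part c i.+1)).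
move=> /bigcupP[b' b'i ab']; have [b2 b2i b'b2] := layer_refined c_homo ip b'i.
exists b'; split=> //.
by rewrite (part_eq (layer_part c i) bi b2i ab (subsetP b'b2 _ ab')).
Qed.

Lemma layered_full (v : vertex L) : inn v != set0.
Proof.
case: v => -[i b] bP.
have /set0Pn[a ab] := part_neq0 (layer_part c i) bP.
have [b' [b'P _ b'b]] := layer_block (ltn_ord i : i <= p.+1) bP ab.
have ip : i.+1 < p.+3 := ltn_ord i.
apply/set0Pn.
exists (exist (fun x : 'I_p.+3 * {set A} => x.2 \in layer c x.1) (Ordinal ip, b') b'P).
by rewrite inE /= eqxx b'b.
Qed.

(** Blocks grow on the way to the root, so leaves above an edge lie in its block. Conversely an
    element of the block is followed upwards, layer by layer, to its singleton. *)
Lemma cluster_layered (e : edge L) : cluster e = (val e).2.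
Proof.
apply/setP => a; rewrite clusterE; apply/idP/idP.
  rewrite -sub1set; set x := leaf_lab L a.
  rewrite (_ : [set a] = (val x).2) //; elim/connect_ind => // y z.
  move=> /downP[v [_ + <-]] _; rewrite inE => /andP[_ yv].
  exact: subset_trans.
case: e => -[i b] bP /=; move: (bP) => /=.
have [n] := ubnP (p.+2 - i); elim: n i b bP => // n IH i b bP inn bi ab.
have := ltn_ord i; rewrite ltnS leq_eqVlt => /orP[/eqP iE|ip].
  apply: eq_connect0; apply: val_inj => /=; congr (_, _); first exact/esym/val_inj.
  move: bi; rewrite iE /= ltnn => /imsetP[a' _ ba']; move: ab.
  by rewrite ba' inE => /eqP ->.
have [b' [b'P ab' b'b]] := layer_block (ip : i <= p.+1) bi ab.
have ip' : i.+1 < p.+3 by rewrite ltnS.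
apply: connect_trans (IH (Ordinal ip') b' b'P _ b'P ab') _.
  by rewrite /= subnS -ltnS prednK // subn_gt0.
apply: connect1; apply/downP.
exists (exist (fun x : 'I_p.+2 * {set A} => x.2 \in layer c x.1) (Ordinal ip, b) bP).
split; rewrite ?inE //= ?eqxx //.
by apply: val_inj => /=; congr (_, _); exact: val_inj.
Qed.

Lemma clusters_layeredP B : reflect
  [\/ B = setT, exists a, B = [set a] | exists i, B \in val (val (c i))]
  (B \in clusters L).
Proof.
apply: (iffP imsetP) => [[[[i b] bP] _ ->]|].
  rewrite cluster_layered /=; move: bP => /=; case: i => -[|j] jp /=.
    by rewrite inE => /eqP; constructor 1.
  case: ifP => jp'; first by constructor 3; exists (inord j).
  by move=> /imsetP[a _ ->]; constructor 2; exists a.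
case=> [->|[a ->]|[i Bi]].
- by have /imsetP[e _ ->] := setT_in_clusters L; exists e.
- by exists (leaf_lab L a); rewrite ?cluster_leaf.
(* The layers are shifted by one: [c i] is layer [i.+1]. *)
have ip : i.+1 < p.+3 by rewrite !ltnS ltnW.
have BP : B \in layer c (Ordinal ip) by rewrite /= -ltnS ltn_ord inord_val.
exists (exist (fun x : 'I_p.+3 * {set A} => x.2 \in layer c x.1) (Ordinal ip, B) BP) => //.
by rewrite cluster_layered.
Qed.

End LayeredClusters.
End Clusters.

(** * The partition into maximal proper clusters *)

Section RootPartition.
Variable A : finType.
Implicit Types (F : {set {set A}}) (B C : {set A}).

(** For the clusters of a tree these are the sets of leaves above the incoming edges of
    the root vertex. *)
Definition top_blocks F : {set {set A}} :=
  [set B in F | (B != setT) && [forall C in F, (C != setT) ==> (B \subset C) ==> (C == B)]].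

Lemma top_blocksP F B : reflect
  [/\ B \in F, B != setT & forall C, C \in F -> C != setT -> B \subset C -> C = B]
  (B \in top_blocks F).
Proof.
rewrite inE; apply: (iffP and3P) => -[BF BT H]; split=> //.
  by move=> C CF CT BC; apply/eqP; move/forall_inP: H => /(_ C CF)/implyP/(_ CT)/implyP; exact.
by apply/forall_inP => C CF; apply/implyP => CT; apply/implyP => BC; rewrite (H C).
Qed.

Lemma top_above F B : B \in F -> B != setT -> exists2 C, C \in top_blocks F & B \subset C.
Proof.
move=> BF BT; pose P C := [&& C \in F, C != setT & B \subset C].
have PB : P B by rewrite /P BF BT subxx.
pose C := [arg max_(C > B | P C) #|C|].
have [/and3P[CF CT BC] Cmax] : P C /\ forall C', P C' -> (#|C'| <= #|C|)%N.
  by rewrite /C; case: arg_maxnP.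
exists C => //; apply/top_blocksP; split=> // C' C'F C'T CC'; apply/esym/eqP.
by rewrite eqEcard CC' Cmax // /P C'F C'T (subset_trans BC).
Qed.

Section Tree.
Variable t : ltree A.
Hypotheses (red : reduced t) (inner : has_inner_edge t).
Notation F := (clusters t).

(** If [A] had only the element [a], every nonempty cluster would be [[set a]], and there would be
    no inner edge. *)
Lemma set1_neqT a : [set a] != setT :> {set A}.
Proof.
have [B [BF BT B1]] := has_inner_edgeP red inner.
apply: contraNneq (B1 a) => aT; rewrite eqEsubset aT subsetT -aT sub1set.
have /set0Pn[b bB] := clusters_neq0 (reduced_full red) BF.
have : b \in [set a] by rewrite aT inE.
by rewrite inE => /eqP <-.
Qed.

(** Singletons are proper clusters, so the maximal ones cover [A]; by laminarity, overlapping
    maximal clusters coincide. *)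
Lemma top_blocks_partition : partition (top_blocks F) setT.
Proof.
apply/and3P; split.
- apply/eqP/setP => a; rewrite inE; apply/bigcupP.
  have [C CF] := top_above (set1_in_clusters t a) (set1_neqT a).
  by rewrite sub1set; exists C.
- apply/trivIsetP => B C /top_blocksP[BF BT Bm] /top_blocksP[CF CT Cm].
  apply: contraNT; rewrite -setI_eq0 => /set0Pn[a]; rewrite inE => /andP[aB aC].
  by case/orP: (clusters_laminar BF CF aB aC) => H; [rewrite (Bm C)|rewrite (Cm B)].
- by apply/negP => /top_blocksP[/(clusters_neq0 (reduced_full red))]; rewrite eqxx.
Qed.

Definition top_part : setpart A := exist (fun P => partition P setT) _ top_blocks_partition.

(** All blocks are proper, and the block containing the cluster of an inner edge is not a
    singleton. *)
Lemma top_part_nontrivial : (val top_part != indiscrete A) && (val top_part != discrete A).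
Proof.
have [B [BF BT B1]] := has_inner_edgeP red inner.
apply/andP; split; apply/eqP => E.
  have : setT \in top_blocks F by rewrite [top_blocks F]E inE.
  by move=> /top_blocksP[_]; rewrite eqxx.
have [C CF BC] := top_above BF BT; move: CF; rewrite [top_blocks F]E => /imsetP[a _ Ca].
have /set0Pn[b bB] := clusters_neq0 (reduced_full red) BF.
have := subsetP BC b bB; rewrite Ca inE => /eqP ba.
by move: (B1 a); rewrite eqEsubset -Ca BC Ca sub1set -ba bB.
Qed.

Definition root_part : ntpart A :=
  exist (fun P => (val P != indiscrete A) && (val P != discrete A)) _ top_part_nontrivial.

End Tree.

Lemma ntpart_le (P Q : ntpart A) : (P <= Q)%O <->
  forall b, b \in val (val Q) -> exists2 c, c \in val (val P) & b \subset c.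
Proof. by split=> [/refinedP|H]; last exact/refinedP. Qed.

Lemma ntpart_neqT (P : ntpart A) B : B \in val (val P) -> B != setT.
Proof.
move=> BP; have /andP[PI _] := valP P; apply: contraNneq PI => BT; apply/eqP/setP => C.
rewrite inE; apply/idP/eqP => [CP|->]; last by move: BP; rewrite {1}BT.
have /set0Pn[a aC] := part_neq0 (valP (val P)) CP.
have aB : a \in B by rewrite BT inE.
exact: etrans (part_eq (valP (val P)) CP BP aC aB) BT.
Qed.

Lemma ntpart_big_block (P : ntpart A) :
  exists2 B, B \in val (val P) & forall a, B != [set a].
Proof.
have partP := valP (val P); have /andP[_ PD] := valP P.
have [/exists_inP[B BP /forallP B1]|none] :=
    boolP [exists B in val (val P), [forall a, B != [set a]]]; first by exists B.
have one B : B \in val (val P) -> exists a, B = [set a].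
  move=> BP; move: none; rewrite negb_exists_in => /forall_inP/(_ B BP).
  by rewrite negb_forall => /existsP[a]; rewrite negbK => /eqP; exists a.
case/eqP: PD; apply/setP => B; apply/idP/imsetP => [/one[a ->]|[a _ ->]]; first by exists a.
have : a \in cover (val (val P)) by rewrite (cover_partition partP).
move=> /bigcupP[C CP aC]; have [b Cb] := one C CP.
by move: aC CP; rewrite Cb inE => /eqP ->.
Qed.

Lemma ntpart_block (P : ntpart A) a : exists2 B, B \in val (val P) & a \in B.
Proof.
have : a \in cover (val (val P)) by rewrite (cover_partition (valP (val P))).
by move=> /bigcupP[B BP aB]; exists B.
Qed.

(** The blocks of [P] are pairwise incomparable and cofinal among the proper members of [F]. *)
Lemma top_blocks_refine F (P : ntpart A) :
  val (val P) \subset F ->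
  (forall B, B \in F -> B != setT -> exists2 C, C \in val (val P) & B \subset C) ->
  top_blocks F = val (val P).
Proof.
move=> PF FP; apply/setP => B; apply/top_blocksP/idP => [[BF BT Bm]|BP].
  have [C CP BC] := FP B BF BT.
  by rewrite -(Bm C) // ?(subsetP PF) //; exact: ntpart_neqT CP.
split; [exact: (subsetP PF)|exact: ntpart_neqT BP|move=> C CF CT BC].
have [B' B'P CB'] := FP C CF CT; have /set0Pn[a aB] := part_neq0 (valP (val P)) BP.
have E : B = B'.
  have aB' := subsetP (subset_trans BC CB') _ aB.
  exact: part_eq (valP (val P)) BP B'P aB aB'.
by apply/eqP; rewrite eqEsubset BC {1}E CB'.
Qed.

End RootPartition.

Section Vertices.
Variables (d : Order.disp_t) (P : porderType d).
Notation C := (simplices (nerve (poset_category P))).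

Definition vert (s : C) (i : 'I_(projT1 s).+1) : P := fob (projT2 s) i.

Lemma vert_hom (s t : C) (f : Defs.hom s t) i : @vert s i = @vert t (sval f i).
Proof.
have E : act (sval f) (projT2 t) = projT2 s := svalP f.
by rewrite -[RHS]/(fob (act (sval f) (projT2 t)) i) E.
Qed.

End Vertices.

(** * The poset of trees as a finite poset of cluster sets *)

Section TreePosetTheory.
Local Open Scope quotient_scope.
Variable A : finType.
Implicit Types (S T : tree_poset_plus A).

Definition rep_tree T : ltree A := repr (val (val T)).

Lemma rep_reduced T : reduced (rep_tree T).
Proof. exact: valP (val T). Qed.

Lemma rep_inner T : has_inner_edge (rep_tree T).
Proof. exact: valP T. Qed.

Lemma tree_leE S T : (S <= T)%O = (clusters (rep_tree S) \subset clusters (rep_tree T)).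
Proof.
have -> : (S <= T)%O = contractsb (val (val S)) (val (val T)) by [].
rewrite -[val (val S)]reprK -[val (val T)]reprK.
apply/contractsb_pi/idP => [/contracts_clusters|H].
  by apply; exact: rep_reduced.
by apply/contracts_clusters => //; exact: rep_reduced.
Qed.

Lemma clusters_rep_inj : injective (fun T => clusters (rep_tree T)).
Proof. by move=> S T E; apply: le_anti; rewrite !tree_leE E subxx. Qed.

(** A classical partial inverse of the cluster map. It makes the poset of trees a finite type, as
    subdivision requires. *)
Definition tree_of_clusters (F : {set {set A}}) : option (tree_poset_plus A) :=
  if pselect (exists T, clusters (rep_tree T) = F) is left H then Some (sval (cid H))
  else None.

Lemma clusters_repK : pcancel (fun T => clusters (rep_tree T)) tree_of_clusters.
Proof.
move=> T; rewrite /tree_of_clusters; case: pselect => [H|[]]; last by exists T.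
by congr Some; apply: clusters_rep_inj; exact: svalP (cid H).
Qed.

HB.instance Definition _ := Countable.copy (tree_poset_plus A) (pcan_type clusters_repK).
HB.instance Definition _ := isFinite.Build (tree_poset_plus A) (pcan_enumP clusters_repK).


(** Membership in the poset is tested on the chosen representative of a class, so both properties
    are carried along the isomorphism from [t] to it. *)
Lemma tree_class_exists (t : ltree A) : reduced t -> has_inner_edge t ->
  exists T, ltree_iso (rep_tree T) t.
Proof.
move=> red inner; have [u tu] := ord_tree_exists t.
have /asboolP ur : isob u (repr (\pi_(tree_class A) u)) by rewrite -eqmodE reprK.
have tr := ltree_iso_trans tu ur.
have redT : reduced (repr (\pi_(tree_class A) u)) by rewrite -(reduced_iso tr).
pose T0 : tree_poset A := exist (fun T : tree_class A => reduced (repr T)) _ redT.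
have innT : has_inner_edge (repr (val T0)) by rewrite -(has_inner_edge_iso tr).
exists (exist (fun T : tree_poset A => has_inner_edge (repr (val T))) _ innT).
exact: ltree_iso_sym.
Qed.

End TreePosetTheory.

(** * The functor from simplices to trees, and the root partition *)

Section TreeFunctor.
Variable A : finType.
Notation C := (simplices (NP A)).

Lemma layered_full_tree (s : C) (v : vertex (layered_tree (projT2 s))) : inn v != set0.
Proof. exact: layered_full. Qed.

Lemma clusters_simplexP (s : C) B : reflect
  [\/ B = setT, exists a, B = [set a] | exists i, B \in val (val (chain (projT2 s) i))]
  (B \in clusters (delete_unary (layered_tree (projT2 s)))).
Proof.
rewrite clusters_delete_unary; last exact: layered_full_tree.
exact: clusters_layeredP.
Qed.

Lemma simplex_reduced (s : C) : reduced (delete_unary (layered_tree (projT2 s))).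
Proof. by apply: reduced_delete_unary; exact: layered_full_tree. Qed.

Lemma simplex_inner (s : C) : has_inner_edge (delete_unary (layered_tree (projT2 s))).
Proof.
apply/(has_inner_edgeP (simplex_reduced s)).
have [B BP B1] := ntpart_big_block (chain (projT2 s) ord0).
exists B; split=> //; last exact: ntpart_neqT BP.
by apply/clusters_simplexP; constructor 3; exists ord0.
Qed.

Definition tree_ob (s : C) : tree_poset_plus A :=
  sval (cid (tree_class_exists (simplex_reduced s) (simplex_inner s))).

Lemma tree_ob_iso (s : C) :
  ltree_iso (rep_tree (tree_ob s)) (delete_unary (layered_tree (projT2 s))).
Proof. exact: svalP (cid (tree_class_exists (simplex_reduced s) (simplex_inner s))). Qed.

Lemma clusters_tree_obP (s : C) B : reflect
  [\/ B = setT, exists a, B = [set a] | exists i, B \in val (val (vert (s := s) i))]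
  (B \in clusters (rep_tree (tree_ob s))).
Proof. by rewrite (iso_clusters (tree_ob_iso s)); exact: clusters_simplexP. Qed.

(** The whole set and the singletons are clusters of every tree, so only the blocks of the vertices
    impose a condition. *)
Lemma tree_ob_leP (s : C) (T : tree_poset_plus A) :
  (tree_ob s <= T)%O <-> forall i, val (val (vert (s := s) i)) \subset clusters (rep_tree T).
Proof.
rewrite tree_leE; split=> [sT i|sT]; apply/subsetP => B.
  by move=> Bi; apply: (subsetP sT); apply/clusters_tree_obP; constructor 3; exists i.
move=> /clusters_tree_obP[->|[a ->]|[i /(subsetP (sT i))//]].
  exact: setT_in_clusters.
exact: set1_in_clusters.
Qed.

Lemma tree_ob_homo (s t : C) : Defs.hom s t -> (tree_ob s <= tree_ob t)%O.
Proof.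
move=> f; apply/tree_ob_leP => i; apply/subsetP => B Bi; apply/clusters_tree_obP.
by constructor 3; exists (sval f i); rewrite -(vert_hom f).
Qed.

Definition tree_functor : functor C (Tplus A) :=
  @Functor C (Tplus A) tree_ob tree_ob_homo
    (fun _ => bool_irrelevance _ _) (fun _ _ _ _ _ => bool_irrelevance _ _).

Definition root_partition (T : tree_poset_plus A) : ntpart A :=
  root_part (rep_reduced T) (rep_inner T).

Lemma root_partitionE T : val (val (root_partition T)) = top_blocks (clusters (rep_tree T)).
Proof. by []. Qed.

Lemma root_partition_sub T : val (val (root_partition T)) \subset clusters (rep_tree T).
Proof. by rewrite root_partitionE; apply/subsetP => B /top_blocksP[]. Qed.

(** Each block of [P] is a proper cluster and lies in a maximal one. So [root_partition T] is the
    least nontrivial partition into clusters of [T], which makes it a cone point for the slice over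
    [T]. *)
Lemma root_partition_le T (P : ntpart A) :
  val (val P) \subset clusters (rep_tree T) -> (root_partition T <= P)%O.
Proof.
move=> PT; apply/ntpart_le => b bP; rewrite root_partitionE.
by apply: top_above; [exact: (subsetP PT)|exact: ntpart_neqT bP].
Qed.

Lemma root_partition_anti S T : (S <= T)%O -> (root_partition T <= root_partition S)%O.
Proof.
rewrite tree_leE => ST; apply: root_partition_le.
exact: subset_trans (root_partition_sub S) ST.
Qed.

(** All vertices of [s] refine the one at [ord0], so every proper cluster lies in one of its
    blocks. *)
Lemma root_partition_tree_ob (s : C) : root_partition (tree_ob s) = vert (s := s) ord0.
Proof.
apply: val_inj; apply: val_inj; rewrite root_partitionE; apply: top_blocks_refine.
  by apply/subsetP => B B0; apply/clusters_tree_obP; constructor 3; exists ord0.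
move=> B /clusters_tree_obP[->|[a ->] _|[i Bi] _]; first by rewrite eqxx.
  by have [C CP aC] := ntpart_block (vert (s := s) ord0) a; exists C; rewrite ?sub1set.
have : (vert (s := s) ord0 <= vert (s := s) i)%O.
  by apply: (chain_homo (projT2 s)); exact: leq0n.
by move=> /ntpart_le; apply.
Qed.

End TreeFunctor.

From Stdlib Require Import Relation_Operators.
From mathcomp Require Import all_algebra all_classical all_reals all_analysis.
From mathcomp Require Import ring lra.

Import GRing.Theory Num.Theory.
Import numFieldNormedType.Exports.
Local Open Scope ring_scope.
Local Open Scope classical_set_scope.

(** * Homotopies *)

Section Gluing.
Variables (X Y : topologicalType).

(** Pasting over a finite closed cover: a preimage of a closed set is a finite union of closed
    pieces. The [g i] are continuous on all of [X], which avoids subspace topologies. *)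
Lemma continuous_closed_cover (I : finType) (C : I -> set X) (g : I -> X -> Y)
    (f : X -> Y) :
  (forall i, closed (C i)) -> (forall i, continuous (g i)) ->
  (forall x, exists i, C i x) -> (forall i x, C i x -> f x = g i x) ->
  continuous f.
Proof.
move=> cC cg cov fg; apply/continuous_closedP => Z cZ.
rewrite (_ : f @^-1` Z = \bigcup_(i in [set: I]) (C i `&` g i @^-1` Z)).
  apply: closed_bigcup; first exact: finite_finset.
  move=> i _; apply: closedI => //.
  by have /continuous_closedP := cg i; apply.
apply/seteqP; split=> [x Zx|x [i _ [Cx Zx]]] /=; last by rewrite (fg i).
by have [i Ci] := cov x; exists i => //; split => //=; rewrite -fg.
Qed.

Lemma continuous_glue (A B : set X) (g h f : X -> Y) :
  closed A -> closed B -> continuous g -> continuous h ->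
  (forall x, A x \/ B x) -> (forall x, A x -> f x = g x) ->
  (forall x, B x -> f x = h x) -> continuous f.
Proof.
move=> cA cB cg ch AB fg fh.
apply: (@continuous_closed_cover bool (fun b => if b then A else B)
  (fun b => if b then g else h)).
- by case.
- by case.
- by move=> x; case: (AB x); [exists true|exists false].
- by case.
Qed.

End Gluing.

Lemma cont_comp (X Y Z : topologicalType) (f : X -> Y) (g : Y -> Z) :
  continuous f -> continuous g -> continuous (fun x => g (f x)).
Proof. by move=> cf cg x; apply: continuous_comp; [exact: cf|exact: cg]. Qed.

Lemma cont_cst (X Y : topologicalType) (y : Y) : continuous (fun _ : X => y).
Proof. exact: cst_continuous. Qed.

Lemma cont_pair (X Y Z : topologicalType) (f : X -> Y) (g : X -> Z) :
  continuous f -> continuous g -> continuous (fun x => (f x, g x)).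
Proof. by move=> cf cg x; exact: (cvg_pair (cf x) (cg x)). Qed.

Section RealContinuity.
Variables (R : realType) (X : topologicalType).
Implicit Types f g : X -> R.

Lemma cont_add f g : continuous f -> continuous g -> continuous (fun x => f x + g x).
Proof. by move=> cf cg x; exact: (cvgD (cf x) (cg x)). Qed.

Lemma cont_sub f g : continuous f -> continuous g -> continuous (fun x => f x - g x).
Proof. by move=> cf cg x; exact: (cvgB (cf x) (cg x)). Qed.

Lemma cont_opp f : continuous f -> continuous (fun x => - f x).
Proof. by move=> cf x; exact: (cvgN (cf x)). Qed.

Lemma cont_mul f g : continuous f -> continuous g -> continuous (fun x => f x * g x).
Proof. by move=> cf cg x; exact: (cvgM (cf x) (cg x)). Qed.

Lemma cont_inv f : (forall x, f x != 0) -> continuous f -> continuous (fun x => (f x)^-1).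
Proof. by move=> f0 cf x; apply: cvgV; [exact: f0|exact: cf]. Qed.

Lemma cont_max f g : continuous f -> continuous g ->
  continuous (fun x => Num.max (f x) (g x)).
Proof. by move=> cf cg x; exact: (continuous_max (cf x) (cg x)). Qed.

Lemma cont_min f g : continuous f -> continuous g ->
  continuous (fun x => Num.min (f x) (g x)).
Proof. by move=> cf cg x; exact: (continuous_min (cf x) (cg x)). Qed.

Lemma continuous_sumr (I : Type) (r : seq I) (P : pred I) (F : I -> X -> R) :
  (forall i, continuous (F i)) -> continuous (fun x => \sum_(i <- r | P i) F i x).
Proof.
by move=> cF; apply: continuous_big => // x; exact: add_continuous.
Qed.

Lemma continuous_bigmax (I : Type) (r : seq I) (P : pred I) (c : R) (F : I -> X -> R) :
  (forall i, continuous (F i)) ->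
  continuous (fun x => \big[Num.max/c]_(i <- r | P i) F i x).
Proof.
move=> cF; elim: r => [|i r IH].
  rewrite (_ : (fun _ => _) = fun=> c); last by apply/funext => x; rewrite big_nil.
  exact: cst_continuous.
under eq_fun do rewrite big_cons; case: (P i) => //.
by move=> x; apply: continuous_max; [exact: cF|exact: IH].
Qed.

Lemma continuous_bigmin (I : Type) (r : seq I) (P : pred I) (c : R) (F : I -> X -> R) :
  (forall i, continuous (F i)) ->
  continuous (fun x => \big[Num.min/c]_(i <- r | P i) F i x).
Proof.
move=> cF; elim: r => [|i r IH].
  rewrite (_ : (fun _ => _) = fun=> c); last by apply/funext => x; rewrite big_nil.
  exact: cst_continuous.
under eq_fun do rewrite big_cons; case: (P i) => //.
by move=> x; apply: continuous_min; [exact: cF|exact: IH].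
Qed.

Lemma continuous_row n (F : X -> 'rV[R]_n) :
  (forall i, continuous (fun x => F x ord0 i)) -> continuous F.
Proof.
move=> cF x; apply/cvg_ballP => e e0.
have : \forall y \near x, forall i, ball (F x ord0 i) e (F y ord0 i).
  by apply: filter_forall => i; have /cvg_ballP/(_ e e0) := cF i x.
by apply: filterS => y Fy; split=> // i j; rewrite (ord1 i); exact: Fy.
Qed.

Lemma continuous_rowE n (F : 'I_n -> X -> R) :
  (forall i, continuous (F i)) -> continuous (fun x => \row_i F i x).
Proof.
move=> cF; apply: continuous_row => i.
by under eq_fun do rewrite mxE; exact: cF.
Qed.

End RealContinuity.

Section Clamp.
Variable R : realType.

(** Retraction of the line onto the unit interval; precomposing with it turns maps defined on the
    interval into continuous maps on the line. *)
Definition clamp (u : R) : R := Num.max 0 (Num.min 1 u).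

Lemma clamp_ge0 u : 0 <= clamp u.
Proof. by rewrite /clamp le_max lexx. Qed.

Lemma clamp_le1 u : clamp u <= 1.
Proof. by rewrite /clamp ge_max ler01 ge_min lexx. Qed.

Lemma clamp_id u : 0 <= u <= 1 -> clamp u = u.
Proof.
move=> /andP[u0 u1]; rewrite /clamp (min_idPr _) //; exact: max_r.
Qed.

Lemma clamp_eq0 u : u <= 0 -> clamp u = 0.
Proof. by move=> u0; rewrite /clamp max_l // ge_min u0 orbT. Qed.

Lemma clamp_eq1 u : 1 <= u -> clamp u = 1.
Proof. by move=> u1; rewrite /clamp min_l // max_r. Qed.

Lemma clamp_continuous : continuous clamp.
Proof.
move=> u; apply: continuous_max; first exact: cst_continuous.
by apply: continuous_min; [exact: cst_continuous|exact: cvg_id].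
Qed.
End Clamp.

Lemma continuous_within_comp (Z X Y : topologicalType) (A : set X) (f : X -> Y)
    (h : Z -> X) :
  {within A, continuous f} -> continuous h -> (forall z, A (h z)) ->
  continuous (f \o h).
Proof.
move=> /subspace_sigL_continuousP cf ch Ah.
pose k z : A := exist _ (h z) (mem_set (Ah z)).
have ck : continuous k by apply: (@continuous_comp_initial _ _ _ set_val k).
by move=> z; apply: (@continuous_comp _ _ _ k (sigL A f) z (ck z)); exact: cf.
Qed.

Section Homotopy.
Variable R : realType.

(** The time parameter ranges over all of [R], so continuity is that of a map on a plain product. *)
Definition homotopic (X Y : topologicalType) (f g : X -> Y) : Prop :=
  exists H : R * X -> Y, [/\ continuous H, forall x, H (0, x) = f x &
                           forall x, H (1, x) = g x].

Section Reparam.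
Variables (X Y : topologicalType).

Lemma continuous_reparam (H : R * X -> Y) (Z : topologicalType) (u : Z -> R)
    (k : Z -> X) : continuous H -> continuous u -> continuous k ->
  continuous (fun z => H (u z, k z)).
Proof.
by move=> cH cu ck; exact: (cont_comp (cont_pair cu ck) cH).
Qed.

Lemma fst_cont : continuous (fst : R * X -> R).
Proof. by move=> x; exact: cvg_fst. Qed.

Lemma snd_cont : continuous (snd : R * X -> X).
Proof. by move=> x; exact: cvg_snd. Qed.

Lemma concat_homotopy (F G : R * X -> Y) : continuous F -> continuous G ->
  (forall x, F (1, x) = G (0, x)) ->
  exists H : R * X -> Y, [/\ continuous H,
    forall u x, u <= 2^-1 -> H (u, x) = F (2 * u, x) &
    forall u x, 2^-1 <= u -> H (u, x) = G (2 * u - 1, x)].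
Proof.
move=> cF cG FG.
pose H z := if z.1 <= 2^-1 then F (2 * z.1, z.2) else G (2 * z.1 - 1, z.2).
have HG u x : 2^-1 <= u -> H (u, x) = G (2 * u - 1, x).
  rewrite /H /=; case: ifPn => // u1 u2; have -> : u = 2^-1 by apply: le_anti; rewrite u1.
  by rewrite mulfV // subrr.
exists H; split=> //; last by move=> u x u2; rewrite /H /= u2.
have c2 : continuous (fun z : R * X => 2 * z.1).
  by apply: cont_mul; [exact: cont_cst|exact: fst_cont].
apply: (@continuous_glue (R * X)%type Y [set z | z.1 <= 2^-1] [set z | 2^-1 <= z.1]
  (fun z => F (2 * z.1, z.2)) (fun z => G (2 * z.1 - 1, z.2))).
- apply: (@preimage_closed _ _ fst [set u : R | u <= 2^-1]); last exact: closed_le.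
  by move=> *; exact: fst_cont.
- apply: (@preimage_closed _ _ fst [set u : R | 2^-1 <= u]); last exact: closed_ge.
  by move=> *; exact: fst_cont.
- by apply: continuous_reparam => //; exact: snd_cont.
- apply: continuous_reparam => //; last exact: snd_cont.
  by apply: cont_sub; [exact: c2|exact: cont_cst].
- by move=> z; case: (leP z.1 2^-1) => [|/ltW]; [left|right].
- by move=> z z2; rewrite /H z2.
- by move=> [u x] /HG.
Qed.

End Reparam.

Lemma onem_cont : continuous (fun u : R => 1 - u).
Proof. by apply: cont_sub; [exact: cont_cst|move=> u; exact: cvg_id]. Qed.

Section HomotopicTheory.
Variables (X Y : topologicalType).
Implicit Types f g h : X -> Y.

Lemma homotopic_refl f : continuous f -> homotopic f f.
Proof.
by move=> cf; exists (f \o snd); split=> //; exact: cont_comp (@snd_cont _) cf.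
Qed.

Lemma homotopic_sym f g : homotopic f g -> homotopic g f.
Proof.
move=> [H [cH H0 H1]]; exists (fun z => H (1 - z.1, z.2)); split.
- apply: continuous_reparam => //; last exact: snd_cont.
  exact: cont_comp (@fst_cont _) onem_cont.
- by move=> x; rewrite subr0.
- by move=> x; rewrite subrr.
Qed.

Lemma homotopic_trans g f h : homotopic f g -> homotopic g h -> homotopic f h.
Proof.
move=> [F [cF F0 F1]] [G [cG G0 G1]].
have [|H [cH HF HG]] := concat_homotopy cF cG; first by move=> x; rewrite F1 G0.
exists H; split=> // x; first by rewrite HF ?mulr0 // invr_ge0.
rewrite HG ?mulr1 //; first by rewrite (_ : 2 - 1 = 1) //; lra.
by rewrite invf_le1 //; lra.
Qed.

Lemma homotopic_eq f g : continuous f -> f =1 g -> homotopic f g.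
Proof. by move=> cf /funext <-; exact: homotopic_refl. Qed.

End HomotopicTheory.

Lemma homotopic_compl (X Y Z : topologicalType) (k : Y -> Z) (f g : X -> Y) :
  continuous k -> homotopic f g -> homotopic (k \o f) (k \o g).
Proof.
move=> ck [H [cH H0 H1]]; exists (k \o H); split.
- exact: cont_comp cH ck.
- by move=> x /=; rewrite H0.
- by move=> x /=; rewrite H1.
Qed.

Lemma homotopic_compr (X Y Z : topologicalType) (k : X -> Y) (f g : Y -> Z) :
  continuous k -> homotopic f g -> homotopic (f \o k) (g \o k).
Proof.
move=> ck [H [cH H0 H1]]; exists (fun z => H (z.1, k z.2)); split.
- apply: continuous_reparam => //; first exact: fst_cont.
  exact: cont_comp (@snd_cont _) ck.
- by move=> x /=; rewrite H0.
- by move=> x /=; rewrite H1.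
Qed.

Definition homotopy_inverse (X Y : topologicalType) (f : X -> Y) (e : Y -> X) : Prop :=
  [/\ continuous f, continuous e, homotopic id (e \o f) & homotopic id (f \o e)].

(** * Homotopies of spheroids with a moving base point *)

Section Collar.
Variable n : nat.
Implicit Types (t : 'rV[R]_n) (w : R).

Definition clampv t : 'rV[R]_n := \row_i clamp (t ord0 i).

Lemma clampv_cube t : cube (clampv t).
Proof. by move=> i; rewrite mxE clamp_ge0 clamp_le1. Qed.

Lemma clampv_id t : cube t -> clampv t = t.
Proof. by move=> ct; apply/rowP => i; rewrite mxE clamp_id ?ct. Qed.

Lemma clampv_continuous : continuous clampv.
Proof.
apply: continuous_rowE => i; apply: (cont_comp _ (@clamp_continuous R)).
exact: coord_continuous.
Qed.

(** [clampv (stretch w t)] spreads the middle of the cube over the whole cube; the rest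
    of it, where [excess (stretch w t)] is positive, is a collar sent to the boundary. *)
Definition stretch w t : 'rV[R]_n := \row_i ((1 + 2 * w) * t ord0 i - w).

Definition excess t : R :=
  \big[Num.max/0]_(i < n) Num.max (- t ord0 i) (t ord0 i - 1).

Lemma stretch_continuous : continuous (fun z : R * 'rV[R]_n => stretch z.1 z.2).
Proof.
apply: continuous_rowE => i.
apply: cont_sub; last exact: fst_cont.
apply: cont_mul.
  apply: cont_add; first exact: cont_cst.
  by apply: cont_mul; [exact: cont_cst|exact: fst_cont].
apply: (@cont_comp _ _ _ snd (fun t : 'rV[R]_n => t ord0 i)); first exact: snd_cont.
exact: coord_continuous.
Qed.

Lemma excess_continuous : continuous excess.
Proof.
apply: continuous_bigmax => i; apply: cont_max.
  by apply: cont_opp; exact: coord_continuous.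
by apply: cont_sub; [exact: coord_continuous|exact: cont_cst].
Qed.

Lemma excess_ge0 t : 0 <= excess t.
Proof. exact: bigmax_ge_id. Qed.

Lemma excess_gt0 t : 0 < excess t -> cube_boundary (clampv t).
Proof.
move=> t0; split; first exact: clampv_cube.
have [i ti] : exists i, 0 < Num.max (- t ord0 i) (t ord0 i - 1).
  apply: contrapT => H; move: t0; rewrite ltNge => /negP; apply.
  apply: bigmax_le => // i _; rewrite leNgt; apply/negP => ti.
  by apply: H; exists i.
exists i; rewrite mxE; move: ti; rewrite lt_max => /orP[ti|ti].
  by left; apply: clamp_eq0; lra.
by right; apply: clamp_eq1; lra.
Qed.

Lemma excess_stretch_le w t : 0 <= w -> cube t -> excess (stretch w t) <= w.
Proof.
move=> w0 ct; apply: bigmax_le => // i _; rewrite mxE.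
by have /andP[t0 t1] := ct i; rewrite ge_max; apply/andP; split; nra.
Qed.

(** A coordinate 0 or 1 is stretched to [- w] or [1 + w], so the bound [w] is attained. *)
Lemma excess_stretch_boundary w t : 0 <= w -> cube_boundary t ->
  excess (stretch w t) = w.
Proof.
move=> w0 [ct [i ti]]; apply: le_anti; rewrite excess_stretch_le //=.
apply: le_trans (le_bigmax _ _ i); rewrite mxE le_max; apply/orP.
by case: ti => ->; [left|right]; lra.
Qed.

Lemma stretch_boundary w t : 0 <= w -> cube_boundary t ->
  cube_boundary (clampv (stretch w t)).
Proof.
move=> w0 [ct [i ti]]; split; first exact: clampv_cube.
exists i; rewrite !mxE.
by case: ti => ->; [left; apply: clamp_eq0|right; apply: clamp_eq1]; lra.
Qed.

Lemma stretch0 t : stretch 0 t = t.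
Proof. by apply/rowP => i; rewrite mxE; ring. Qed.

Lemma excess0 t : cube t -> excess t = 0.
Proof.
move=> ct; apply: le_anti; rewrite excess_ge0 andbT -{1}(stretch0 t).
exact: excess_stretch_le.
Qed.

Lemma closed_boundary : closed [set t | cube_boundary (clampv t)].
Proof.
(* This product vanishes exactly when some clamped coordinate is 0 or 1. *)
pose P t := \prod_(i < n) (clamp (t ord0 i) * (1 - clamp (t ord0 i))).
rewrite (_ : mkset _ = P @^-1` [set 0]).
  apply: preimage_closed; last exact: (@closed_eq R 0).
  move=> t _; apply: continuous_big => [z|i _]; first exact: mul_continuous.
  have cc : continuous (fun t : 'rV[R]_n => clamp (t ord0 i)).
    by apply: (cont_comp _ (@clamp_continuous R)); exact: coord_continuous.
  by apply: cont_mul => //; apply: cont_sub => //; exact: cont_cst.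
apply/seteqP; split=> [t [_ [i ti]]|t /eqP] /=.
  apply/eqP/prodf_eq0; exists i => //; move: ti; rewrite mxE => -[] ->.
    by rewrite mul0r.
  by rewrite subrr mulr0.
move=> /prodf_eq0[i _]; rewrite mulf_eq0 subr_eq0 => ti; split; first exact: clampv_cube.
by exists i; rewrite mxE; case/orP: ti => /eqP; [left|right].
Qed.

Section Space.
Variable X : topologicalType.
Implicit Types (g h : 'rV[R]_n -> X) (gam : R -> X) (x y : X).

(** The set of positive excess need not be closed. The second piece is therefore the closed set
    where the clamped point is on the boundary; there [k] equals [gam 1], so the two formulas agree
    on the overlap. *)
Lemma collar_continuous (Z : topologicalType) (z : Z -> 'rV[R]_n) (k : Z -> X) gam :
  continuous z -> continuous k -> continuous gam ->
  (forall v, cube_boundary (clampv (z v)) -> k v = gam 1) ->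
  continuous (fun v => if excess (z v) <= 0 then k v else gam (1 - excess (z v))).
Proof.
move=> cz ck cg kB.
have cL : continuous (fun v => excess (z v)).
  exact: cont_comp cz excess_continuous.
apply: (@continuous_glue _ _ [set v | excess (z v) <= 0]
  (z @^-1` [set t | cube_boundary (clampv t)]) k
  (fun v => gam (1 - excess (z v)))) => //.
- apply: (@preimage_closed _ _ (fun v => excess (z v)) [set u : R | u <= 0]).
    by move=> *; exact: cL.
  exact: closed_le.
- by apply: preimage_closed; [move=> *; exact: cz|exact: closed_boundary].
- by apply: (cont_comp _ cg); apply: cont_sub => //; exact: cont_cst.
- by move=> v; case: (leP (excess (z v)) 0) => [|/excess_gt0]; [left|right].
- by move=> v /= ->.
- move=> v /kB E; case: ifPn => // v0; rewrite E (_ : excess (z v) = 0) ?subr0 //.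
  by apply: le_anti; rewrite v0 excess_ge0.
Qed.

(** Spheroids continuous on the whole space rather than within the cube; [spheroid_based] produces
    them by precomposing with [clampv]. *)
Definition based x g : Prop :=
  continuous g /\ forall t, cube_boundary t -> g t = x.

Lemma spheroid_based x g : spheroid x g -> based x (g \o clampv).
Proof.
move=> [cg gx]; split.
  exact: continuous_within_comp cg clampv_continuous clampv_cube.
by move=> t bt /=; rewrite clampv_id ?gx //; exact: bt.1.
Qed.

Lemma based_spheroid x g : based x g -> spheroid x g.
Proof. by move=> [cg gx]; split => //; exact: continuous_subspaceT. Qed.

(** The base point is allowed to travel along [gam], because a homotopy inverse need not preserve
    base points. *)
Definition free_homotopic gam g h : Prop :=
  exists W : R * 'rV[R]_n -> X, [/\ continuous W,
    forall t, cube t -> W (0, t) = g t,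
    forall t, cube t -> W (1, t) = h t &
    forall (s : R) t, 0 <= s <= 1 -> cube_boundary t -> W (s, t) = gam s].

Lemma free_spheroid_homotopic x g h :
  free_homotopic (fun=> x) g h -> spheroid_homotopic x g h.
Proof.
move=> [W [cW W0 W1 Wb]]; exists W; split=> //.
exact: continuous_subspaceT.
Qed.

Lemma spheroid_free_homotopic x g h :
  spheroid_homotopic x g h -> free_homotopic (fun=> x) g h.
Proof.
move=> [H [cH H0 H1 Hb]]; exists (fun z => H (clamp z.1, clampv z.2)); split.
- have cc : continuous (fun z : R * 'rV[R]_n => (clamp z.1, clampv z.2)).
    apply: cont_pair; first exact: cont_comp (@fst_cont _) (@clamp_continuous R).
    exact: cont_comp (@snd_cont _) clampv_continuous.
  apply: (continuous_within_comp cH cc) => z; split=> /=; last exact: clampv_cube.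
  by rewrite in_itv /= clamp_ge0 clamp_le1.
- by move=> t ct /=; rewrite clampv_id // clamp_eq0 // H0.
- by move=> t ct /=; rewrite clampv_id // clamp_eq1 // H1.
- move=> s t s01 bt /=; rewrite clampv_id; last exact: bt.1.
  by rewrite clamp_id // Hb //= in_itv.
Qed.

Lemma free_homotopic_sym gam g h :
  free_homotopic gam g h -> free_homotopic (fun s => gam (1 - s)) h g.
Proof.
move=> [W [cW W0 W1 Wb]]; exists (fun z => W (1 - z.1, z.2)); split.
- apply: continuous_reparam => //; last exact: snd_cont.
  exact: cont_comp (@fst_cont _) onem_cont.
- by move=> t ct; rewrite subr0 W1.
- by move=> t ct; rewrite subrr W0.
- by move=> s t /andP[s0 s1] bt; rewrite Wb //=; apply/andP; split; lra.
Qed.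

Lemma free_homotopic_trans x g h k : free_homotopic (fun=> x) g h ->
  free_homotopic (fun=> x) h k -> free_homotopic (fun=> x) g k.
Proof.
move=> [F [cF F0 F1 Fb]] [G [cG G0 G1 Gb]].
pose c (K : R * 'rV[R]_n -> X) (z : R * 'rV[R]_n) := K (z.1, clampv z.2).
have cc K : continuous K -> continuous (c K).
  move=> cK; apply: continuous_reparam => //; first exact: fst_cont.
  exact: cont_comp (@snd_cont _) clampv_continuous.
have [|H [cH HF HG]] := concat_homotopy (cc _ cF) (cc _ cG).
  by move=> t; rewrite /c /= F1 ?G0 //; exact: clampv_cube.
exists H; split=> //.
- by move=> t ct; rewrite HF ?invr_ge0 // /c mulr0 /= clampv_id // F0.
- move=> t ct; rewrite HG; last by rewrite invf_le1 //; lra.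
  by rewrite /c /= mulr1 (_ : 2 - 1 = 1); [rewrite clampv_id // G1|lra].
- move=> s t /andP[s0 s1] bt; have ct := bt.1; case: (leP s 2^-1) => s2.
    by rewrite HF // /c /= clampv_id // Fb //; apply/andP; split; lra.
  by rewrite HG; [rewrite /c /= clampv_id // Gb //; apply/andP; split; lra|exact: ltW].
Qed.

(** Change of base point along [gam], from [gam 1] to [gam 0]: [h] fills the inner cube, and the
    collar runs back along the path. *)
Definition transport gam h (t : 'rV[R]_n) : X :=
  if excess (stretch 1 t) <= 0 then h (clampv (stretch 1 t))
  else gam (1 - excess (stretch 1 t)).

Lemma stretch1_continuous : continuous (stretch 1).
Proof.
have c : continuous (fun t : 'rV[R]_n => (1 : R, t)).
  by apply: cont_pair; [exact: cont_cst|move=> t; exact: cvg_id].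
exact: (cont_comp c stretch_continuous).
Qed.

Lemma free_homotopic_transport gam g h : free_homotopic gam g h ->
  free_homotopic (fun=> gam 0) g (transport gam h).
Proof.
move=> [W [cW W0 W1 Wb]].
pose st (z : R * 'rV[R]_n) := stretch (clamp z.1) z.2.
have cst : continuous st.
  have c : continuous (fun z : R * 'rV[R]_n => (clamp z.1, z.2)).
    by apply: cont_pair (@snd_cont _); exact: cont_comp (@fst_cont _) (@clamp_continuous R).
  exact: (cont_comp c stretch_continuous).
(* At time [s] the inner cube shows [W] at time [s], and across a collar of width [s] the time runs
   back to 0; the outer boundary thus stays at [gam 0]. *)
exists (fun z => W (clamp z.1 - excess (st z), clampv (st z))); split.
- apply: continuous_reparam => //.
    apply: cont_sub; first exact: cont_comp (@fst_cont _) (@clamp_continuous R).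
    exact: cont_comp cst excess_continuous.
  exact: cont_comp cst clampv_continuous.
- move=> t ct; rewrite /st /= clamp_eq0 // stretch0 excess0 // subr0.
  by rewrite clampv_id // W0.
- move=> t ct; rewrite /st /= clamp_eq1 // /transport; case: ifPn => s1.
    have -> : excess (stretch 1 t) = 0 by apply: le_anti; rewrite s1 excess_ge0.
    by rewrite subr0 W1 //; exact: clampv_cube.
  rewrite Wb //; last by apply: excess_gt0; rewrite ltNge.
  by have := excess_stretch_le ler01 ct; have := excess_ge0 (stretch 1 t); lra.
- move=> s t s01 bt; have /andP[s0 _] := s01; rewrite /st /= clamp_id //.
  rewrite excess_stretch_boundary // subrr Wb //; first by lra.
  exact: stretch_boundary.
Qed.

Lemma transport_free_homotopic gam h : continuous gam -> based (gam 1) h ->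
  free_homotopic gam (transport gam h) h.
Proof.
move=> cg [ch hb].
pose st (z : R * 'rV[R]_n) := stretch (1 - clamp z.1) z.2.
have cst : continuous st.
  have c : continuous (fun z : R * 'rV[R]_n => (1 - clamp z.1, z.2)).
    apply: cont_pair (@snd_cont _); apply: cont_sub; first exact: cont_cst.
    exact: cont_comp (@fst_cont _) (@clamp_continuous R).
  exact: (cont_comp c stretch_continuous).
(* The collar shrinks from width 1 to width 0; at time [s] the outer boundary is at [gam s]. *)
exists (fun z => if excess (st z) <= 0 then h (clampv (st z))
                 else gam (1 - excess (st z))); split.
- apply: (@collar_continuous _ st (fun z => h (clampv (st z)))) => //.
    exact: cont_comp cst (cont_comp clampv_continuous ch).
  by move=> z; exact: hb.
- by move=> t ct; rewrite /st /= clamp_eq0 // subr0.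
- move=> t ct; rewrite /st /= clamp_eq1 // subrr stretch0 excess0 // lexx.
  by rewrite clampv_id.
- move=> s t s01 bt; have /andP[s0 s1] := s01; rewrite /st /= clamp_id //.
  rewrite excess_stretch_boundary //; last by lra.
  case: ifPn => [s1'|_]; last by congr gam; lra.
  have -> : s = 1 by lra.
  by rewrite subrr stretch0 hb // clampv_id //; exact: bt.1.
Qed.

Lemma transport_based gam h : continuous gam -> based (gam 1) h ->
  based (gam 0) (transport gam h).
Proof.
move=> cg [ch hb]; split.
  apply: (@collar_continuous _ (stretch 1) (fun t => h (clampv (stretch 1 t)))) => //.
  - exact: stretch1_continuous.
  - exact: cont_comp stretch1_continuous (cont_comp clampv_continuous ch).
  - by move=> t; exact: hb.
move=> t bt; rewrite /transport excess_stretch_boundary // subrr.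
by rewrite leNgt ltr01.
Qed.

(** The homotopy runs on the inner cube while the collar stays fixed. *)
Lemma transport_homotopic gam h k : continuous gam ->
  free_homotopic (fun=> gam 1) h k ->
  free_homotopic (fun=> gam 0) (transport gam h) (transport gam k).
Proof.
move=> cg [W [cW W0 W1 Wb]].
pose st (z : R * 'rV[R]_n) := stretch 1 z.2.
have cst : continuous st.
  exact: cont_comp (@snd_cont _) stretch1_continuous.
exists (fun z => if excess (st z) <= 0 then W (clamp z.1, clampv (st z))
                 else gam (1 - excess (st z))); split.
- apply: (@collar_continuous _ st (fun z => W (clamp z.1, clampv (st z)))) => //.
    apply: continuous_reparam => //.
      exact: cont_comp (@fst_cont _) (@clamp_continuous R).
    exact: cont_comp cst clampv_continuous.
  by move=> z bz; rewrite Wb // clamp_ge0 clamp_le1.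
- by move=> t ct; rewrite /st /transport /= clamp_eq0 // W0 //; exact: clampv_cube.
- by move=> t ct; rewrite /st /transport /= clamp_eq1 // W1 //; exact: clampv_cube.
- move=> s t s01 bt; rewrite /st /= excess_stretch_boundary // subrr.
  by rewrite leNgt ltr01.
Qed.

(** Relative to the boundary, [g] and [g'] are homotopic to the transports of [h] and [h'], which
    are homotopic to each other. *)
Lemma free_homotopic_inj gam g h g' h' : continuous gam ->
  free_homotopic gam g h -> free_homotopic gam g' h' ->
  free_homotopic (fun=> gam 1) h h' -> free_homotopic (fun=> gam 0) g g'.
Proof.
move=> cg gh g'h' hh'; apply: free_homotopic_trans (free_homotopic_transport gh) _.
apply: free_homotopic_trans (transport_homotopic cg hh') _.
have := free_homotopic_sym (free_homotopic_transport g'h'); exact.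
Qed.

End Space.

Lemma free_homotopic_comp (X Y : topologicalType) (k : X -> Y) gam
    (g h : 'rV[R]_n -> X) : continuous k ->
  free_homotopic gam g h -> free_homotopic (k \o gam) (k \o g) (k \o h).
Proof.
move=> ck [W [cW W0 W1 Wb]]; exists (k \o W); split.
- exact: cont_comp cW ck.
- by move=> t /W0 /= ->.
- by move=> t /W1 /= ->.
- by move=> s t s01 bt /=; rewrite Wb.
Qed.

Lemma homotopy_free (X Y : topologicalType) (H : R * X -> Y) x (g : 'rV[R]_n -> X) :
  continuous H -> based x g ->
  free_homotopic (fun s => H (s, x)) (fun t => H (0, g t)) (fun t => H (1, g t)).
Proof.
move=> cH [cg gx]; exists (fun z => H (z.1, g z.2)); split=> //.
- apply: continuous_reparam => //; first exact: fst_cont.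
  exact: cont_comp (@snd_cont _) cg.
- by move=> s t s01 bt; rewrite /= gx.
Qed.

Lemma continuous_track (X Y : topologicalType) (H : R * X -> Y) x :
  continuous H -> continuous (fun s => H (s, x)).
Proof.
move=> cH; apply: continuous_reparam => //; last exact: cst_continuous.
by move=> s; exact: cvg_id.
Qed.

End Collar.

Lemma free_homotopic_eq n (X : topologicalType) gam (g h g' h' : 'rV[R]_n -> X) :
  (forall t, cube t -> g t = g' t) -> (forall t, cube t -> h t = h' t) ->
  free_homotopic gam g h -> free_homotopic gam g' h'.
Proof.
by move=> gg' hh' [W [cW W0 W1 Wb]]; exists W; split=> // t ct; rewrite ?W0 ?W1 ?gg' ?hh'.
Qed.

Lemma clampv_free_homotopic n (X : topologicalType) gam (g h : 'rV[R]_n -> X) :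
  free_homotopic gam (g \o @clampv n) (h \o @clampv n) -> free_homotopic gam g h.
Proof. by apply: free_homotopic_eq => t ct /=; rewrite clampv_id. Qed.

(** The homotopy from [id] to [e \o f] moves [g] and [h] to their images under [e \o f], with the
    base point following one and the same path. *)
Lemma left_inverse_pi_inj (X Y : topologicalType) (f : X -> Y) (e : Y -> X) n x
    (g h : 'rV[R]_n -> X) :
  continuous f -> continuous e -> homotopic id (e \o f) ->
  based x g -> based x h -> free_homotopic (fun=> f x) (f \o g) (f \o h) ->
  free_homotopic (fun=> x) g h.
Proof.
move=> cf ce [H [cH H0 H1]] gx hx fgh.
have := free_homotopic_inj (@continuous_track _ _ H x cH) (homotopy_free cH gx)
  (homotopy_free cH hx).
rewrite H0 H1 => K.
apply: free_homotopic_eq (K _) => [t _|t _|]; rewrite ?H0 //.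
apply: free_homotopic_eq (free_homotopic_comp ce fgh) => t _ /=; by rewrite H1.
Qed.

(** Paths are read as homotopies of constant maps, so that they inherit reversal and
    concatenation. *)
Lemma path_homotopic (X : topologicalType) (x y : X) :
  path_joined R x y <-> homotopic (fun _ : R => x) (fun=> y).
Proof.
split=> [[g cg [g0 g1]]|[H [cH H0 H1]]]; last first.
  exists (fun s => H (s, 0)) => //; apply: continuous_subspaceT.
  exact: continuous_track.
have cgc : continuous (g \o @clamp R).
  apply: continuous_within_comp cg (@clamp_continuous R) _ => u /=.
  by rewrite in_itv /= clamp_ge0 clamp_le1.
exists (g \o @clamp R \o fst); split.
- exact: cont_comp (@fst_cont _) cgc.
- by move=> u /=; rewrite clamp_eq0.
- by move=> u /=; rewrite clamp_eq1.
Qed.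

Lemma homotopic_path (X Y : topologicalType) (f g : X -> Y) x :
  homotopic f g -> path_joined R (f x) (g x).
Proof.
move=> fg; apply/path_homotopic.
exact: (homotopic_compr (@cst_continuous R X x) fg).
Qed.

Lemma homotopy_inverse_weak_equivalence (X Y : topologicalType) (f : X -> Y) e :
  homotopy_inverse f e -> weak_equivalence R f.
Proof.
move=> [cf ce ef fe]; split=> //; first split.
- move=> x y /path_homotopic xy; apply/path_homotopic.
  apply: (@homotopic_trans _ _ (fun=> e (f x))).
    by apply/path_homotopic; exact: homotopic_path ef.
  apply: (@homotopic_trans _ _ (fun=> e (f y))).
    exact: (homotopic_compl ce xy).
  by apply/homotopic_sym/path_homotopic; exact: homotopic_path ef.
- move=> z; exists (e z); apply/path_homotopic/homotopic_sym/path_homotopic.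
  exact: (homotopic_path z fe).
move=> n x; split.
  move=> g h gx hx fgh; apply/free_spheroid_homotopic/clampv_free_homotopic.
  apply: (left_inverse_pi_inj cf ce ef); [exact: spheroid_based|exact: spheroid_based|].
  apply: free_homotopic_eq (spheroid_free_homotopic fgh) => t ct /=; by rewrite clampv_id.
(* Surjectivity: [e \o k] is based at the end of the path [gam] traced by [x], and transporting it
   back along [gam] gives the preimage [g]. *)
move=> k /spheroid_based kx; have [H [cH H0 H1]] := ef.
set gam := fun s => H (s, x); have cgam : continuous gam := @continuous_track _ _ H x cH.
have ek : based (gam 1) (e \o (k \o @clampv n.+1)).
  case: kx => ck kx; split; last first.
    by move=> t bt; rewrite /gam H1 /=; congr e; exact: kx.
  exact: cont_comp ck ce.
pose g := transport gam (e \o (k \o @clampv n.+1)).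
have gx : based x g by have := transport_based cgam ek; rewrite /gam H0.
exists g; first exact: based_spheroid.
apply/free_spheroid_homotopic.
apply: (@free_homotopic_eq _ _ _ (f \o g) (k \o @clampv n.+1)) => //.
  by move=> t ct /=; rewrite clampv_id.
(* By injectivity for [e], it suffices to compare [e \o f \o g] with [e \o k]; both are freely
   homotopic to [g] along the reverse of [gam]. *)
apply: (left_inverse_pi_inj ce cf fe) => //.
  case: gx => cg gx; split; first exact: cont_comp cg cf.
  by move=> t bt /=; congr f; exact: gx.
have W1 := homotopy_free cH gx; have W2 := transport_free_homotopic cgam ek.
have K : free_homotopic (fun=> x) g g.
  exists (g \o snd); split=> //; first exact: cont_comp (@snd_cont _) gx.1.
  by move=> s t _; exact: gx.2.
have := free_homotopic_inj (cont_comp onem_cont cgam) (free_homotopic_sym W1)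
  (free_homotopic_sym W2).
rewrite /gam subrr subr0 H0 H1 /= => K'.
have : free_homotopic (fun=> x) (fun t => H (0, g t)) g.
  by apply: free_homotopic_eq K => t _ //; rewrite H0.
by move/K'; apply: free_homotopic_eq => t _ //; rewrite H1.
Qed.

Lemma homotopic_const_weakly_contractible (X : topologicalType) (x0 : X) :
  homotopic id (fun _ : X => x0) -> weakly_contractible R X.
Proof.
move=> c; split; first by exists x0.
- move=> x y; apply/path_homotopic; apply: (@homotopic_trans _ _ (fun=> x0)).
    by apply/path_homotopic; exact: homotopic_path c.
  by apply/homotopic_sym/path_homotopic; exact: homotopic_path c.
move=> n x g /spheroid_based gx; apply/free_spheroid_homotopic.
apply: (@clampv_free_homotopic _ _ _ g (fun=> x)).
(* The constant map has [id] as a left inverse up to homotopy, and it identifies all spheroids. *)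
apply: (@left_inverse_pi_inj _ _ (fun=> x0) id n.+1 x) => //.
- exact: cst_continuous.
- by move=> y; exact: cvg_id.
- by split=> // t; exact: cst_continuous.
- by exists (fun=> x0); split => // z; exact: cst_continuous.
Qed.

End Homotopy.

(** * Realizations and barycentric coordinates *)

Section RealizationTheory.
Variable R : realType.
Implicit Types (X Y : sset) (Z : topologicalType).

Lemma point_glue X p q (f : Delta p q) (s : X q) (t : std_simplexT R p) :
  point_of (cell (act f s) t) = point_of (cell s (push f t)).
Proof. by apply/eqmodP/asboolP/rst_step. Qed.

Lemma pointP X (x : realization R X) :
  exists p (s : X p) (t : std_simplexT R p), x = point_of (cell s t).
Proof.
exists (projT1 (projT1 (repr x))), (projT2 (projT1 (repr x))), (projT2 (repr x)).
by rewrite -[LHS]reprK; case: (repr x) => -[].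
Qed.

Lemma continuous_realization X Z (g : realization R X -> Z) :
  (forall p (s : X p), continuous (fun t : std_simplexT R p => g (point_of (cell s t)))) ->
  continuous g.
Proof.
move=> cg; apply/continuousP => U oU; apply/realization_openP => p s.
by have /continuousP/(_ U oU) := cg p s.
Qed.

Lemma continuous_point X p (s : X p) :
  continuous (fun t : std_simplexT R p => point_of (cell s t)).
Proof. by apply/continuousP => U /realization_openP. Qed.

Lemma continuous_realization_map X Y (f : smap X Y) :
  continuous (@realization_map R _ _ f).
Proof.
apply: continuous_realization => p s; under eq_fun do rewrite realization_map_cell.
exact: continuous_point.
Qed.

Section ProductWithReals.
Import ArrowAsCompactOpen.

(** The product with [R] preserves the quotient map that defines the realization,
    since [R] is locally compact. *)
Lemma continuous_realization_prod X Z (H : R * realization R X -> Z) :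
  (forall p (s : X p),
     continuous (fun z : std_simplexT R p * R => H (z.2, point_of (cell s z.1)))) ->
  continuous H.
Proof.
move=> cH; pose G (x : realization R X) (u : R) := H (u, x).
have cG : continuous (G : _ -> (R -> Z)).
  by apply: continuous_realization => p s; have [] := continuous_curry (cH p s).
have cGu x : continuous (G x).
  have [p [s [t ->]]] := pointP x.
  by have [_ /(_ t)] := continuous_curry (cH p s).
have cU : continuous (uncurry G).
  by apply: continuous_uncurry => //; exact: locally_compactR.
have cs : continuous (fun z : R * realization R X => (z.2, z.1)).
  by apply: cont_pair; [exact: snd_cont|exact: fst_cont].
have := cont_comp cs cU; rewrite (_ : (fun _ => _) = H) //.
by apply/funext => -[].
Qed.

End ProductWithReals.

(** A family compatible with the generating gluing steps is constant on the equivalence classes they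
    generate. *)
Lemma realization_lift X (Z : Type) (F : forall p, X p -> std_simplexT R p -> Z) :
  (forall p q (f : Delta p q) s t, F p (act f s) t = F q s (push f t)) ->
  exists G : realization R X -> Z, forall p (s : X p) t,
    G (point_of (cell s t)) = F p s t.
Proof.
move=> FE; pose K (c : cells R X) := F _ (projT2 (projT1 c)) (projT2 c).
exists (fun x => K (repr x)) => p s t.
suff KE a b : glued a b -> K a = K b.
  rewrite -[F p s t]/(K (cell s t)); apply: KE; rewrite -eqmodE; apply/eqP; exact: reprK.
move=> /asboolP; elim=> {a b} [_ _ [p' q f s' t']|//|x y _ -> //|x y z _ -> _ -> //].
exact: FE.
Qed.

Lemma simplex_coord_continuous p (i : 'I_p.+1) :
  continuous (fun t : std_simplexT R p => val t ord0 i).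
Proof.
apply: (@cont_comp _ _ _ (fun t : std_simplexT R p => val t) (fun v => v ord0 i)).
  exact: initial_continuous.
exact: coord_continuous.
Qed.

Lemma continuous_simplex Z p (F : Z -> std_simplexT R p) :
  (forall i, continuous (fun z => val (F z) ord0 i)) -> continuous F.
Proof. by move=> cF; apply: continuous_comp_initial; exact: continuous_row. Qed.

Lemma simplexP p (t : std_simplexT R p) :
  (forall i, 0 <= val t ord0 i) /\ \sum_i val t ord0 i = 1.
Proof. by have : std_simplex (val t) by apply/set_mem; exact: valP t. Qed.

Lemma simplex_eq p (t t' : std_simplexT R p) :
  (forall i, val t ord0 i = val t' ord0 i) -> t = t'.
Proof. by move=> E; apply/val_inj/rowP. Qed.

Lemma classifying_map_comp (B C D : category) (G : functor C D) (F : functor B C) x :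
  @classifying_map R _ _ (fcomp G F) x =
  @classifying_map R _ _ G (@classifying_map R _ _ F x).
Proof.
have [p [s [t ->]]] := pointP x; rewrite /classifying_map !realization_map_cell.
congr (point_of (cell _ t)).
have E : fob (fcomp (fcomp G F) s) = fob (fcomp G (fcomp F s)) by [].
(* The object maps are convertible, so the transport along [E] disappears once [E] is replaced by
   [erefl]. *)
by apply: (functor_eq (E := E)) => i j f; rewrite (Prop_irrelevance E erefl).
Qed.

Lemma continuous_classifying_map (C D : category) (F : functor C D) :
  continuous (@classifying_map R _ _ F).
Proof. exact: continuous_realization_map. Qed.

End RealizationTheory.

Section PosetFunctors.
Variables (d d' : Order.disp_t) (P : porderType d) (Q : porderType d').

Definition mono_functor (f : P -> Q) (fP : {homo f : x y / (x <= y)%O}) :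
    functor (poset_category P) (poset_category Q) :=
  @Functor (poset_category P) (poset_category Q) f fP
    (fun _ => bool_irrelevance _ _) (fun _ _ _ _ _ => bool_irrelevance _ _).

Lemma functor_homo (F : functor (poset_category P) (poset_category Q)) :
  {homo (fob F : P -> Q) : x y / (x <= y)%O}.
Proof. by move=> x y xy; exact: (Defs.fmap F (xy : @Defs.hom (poset_category P) x y)). Qed.

Lemma poset_functor_eq (C : category) (F G : functor C (poset_category Q)) :
  fob F =1 fob G -> F = G.
Proof.
by move=> /funext E; apply: (functor_eq (E := E)) => x y f; exact: bool_irrelevance.
Qed.
End PosetFunctors.

(** * Nonempty chains of a finite poset and their enumerations *)

Section Subdivision.
Variables (d : Order.disp_t) (Q : finPOrderType d).

Definition chainb (S : {set Q}) : bool :=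
  (S != finset.set0) && [forall x in S, forall y in S, (x >=< y)%O].

Definition sd := {S : {set Q} | chainb S}.
HB.instance Definition _ := SubFinite.on sd.

Lemma sd_neq0 (s : sd) : exists x, x \in val s.
Proof. by have /andP[/set0Pn] := valP s. Qed.

Lemma sd_comparable (s : sd) x y : x \in val s -> y \in val s -> (x >=< y)%O.
Proof. by have /andP[_ /forall_inP H] := valP s => /H/forall_inP; exact. Qed.

Definition sd_le : rel sd := fun s t => val s \subset val t.

Fact sd_display : Order.disp_t. Proof. exact: Order.Disp tt tt. Qed.

Lemma sd_le_anti : antisymmetric sd_le.
Proof. by move=> s t; rewrite /sd_le -finset.eqEsubset => /eqP/val_inj. Qed.

Lemma sd_le_refl : reflexive sd_le.
Proof. by move=> s; exact: fintype.subxx. Qed.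

Lemma sd_le_trans : transitive sd_le.
Proof. by move=> t s u; exact: fintype.subset_trans. Qed.

HB.instance Definition _ := Order.Le_isPOrder.Build sd_display sd
  sd_le_refl sd_le_anti sd_le_trans.

Lemma sd_leE (s t : sd) : (s <= t)%O = (val s \subset val t).
Proof. by []. Qed.

Definition chain_seq (s : sd) : seq Q := sort <=%O (enum (val s)).

Lemma mem_chain_seq (s : sd) x : (x \in chain_seq s) = (x \in val s).
Proof. by rewrite mem_sort mem_enum. Qed.

Lemma chain_seq_sorted s : sorted <=%O (chain_seq s).
Proof.
apply: (@sort_sorted_in _ (mem (val s))) => [x y xs ys|].
  by have := sd_comparable xs ys.
by apply/allP => x; rewrite mem_enum.
Qed.

Lemma size_chain_seq s : size (chain_seq s) = #|val s|.-1.+1.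
Proof.
rewrite size_sort -cardE prednK //; apply/card_gt0P.
exact: sd_neq0.
Qed.

Definition chain_dim (s : sd) : nat := #|val s|.-1.

(** The index is always within the sequence, so the default element is never returned. *)
Definition senum (s : sd) (i : 'I_(chain_dim s).+1) : Q :=
  nth (xchoose (sd_neq0 s)) (chain_seq s) i.

Lemma senum_in (s : sd) i : @senum s i \in val s.
Proof. by rewrite -mem_chain_seq mem_nth // size_chain_seq. Qed.

Lemma senum_inj (s : sd) : injective (@senum s).
Proof.
move=> i j /eqP; rewrite nth_uniq ?size_chain_seq //; first by move=> /eqP/val_inj.
by rewrite sort_uniq enum_uniq.
Qed.

Lemma senum_homo (s : sd) : {homo @senum s : i j / (i <= j)%O}.
Proof.
move=> i j ij; apply: (sorted_leq_nth le_trans lexx) => //; rewrite ?inE ?size_chain_seq //.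
exact: chain_seq_sorted.
Qed.

Lemma senum_le (s : sd) i j : (@senum s i <= @senum s j)%O = (i <= j)%O.
Proof.
apply/idP/idP => [ij|]; last exact: senum_homo.
case: (leP i j) => // ji; have := senum_homo (ltW ji) => H.
have E : senum i = senum j by apply: le_anti; rewrite ij.
by rewrite (senum_inj E) ltxx in ji.
Qed.

(** Meaningful for [x] in [s]; for other elements [inord] falls back to [ord0]. *)
Definition srank (s : sd) (x : Q) : 'I_(chain_dim s).+1 := inord (index x (chain_seq s)).

Lemma srankK (s : sd) x : x \in val s -> senum (srank s x) = x.
Proof.
rewrite -mem_chain_seq => xs; rewrite /senum /srank inordK ?nth_index //.
by rewrite -size_chain_seq index_mem.
Qed.

Definition chain_simplex (s : sd) : nerve (poset_category Q) (chain_dim s) :=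
  mono_functor (@senum_homo s).

Lemma srank_homo (s : sd) p (f : 'I_p.+1 -> Q) : {homo f : i j / (i <= j)%O} ->
  (forall i, f i \in val s) -> {homo (fun i => srank s (f i)) : i j / (i <= j)%O}.
Proof. by move=> fP fs i j ij; rewrite -senum_le !srankK ?fP. Qed.

Definition chain_factor (s : sd) p (f : nerve (poset_category Q) p)
    (fs : forall i, fob f i \in val s) : Delta p (chain_dim s) :=
  DeltaMap (srank_homo (functor_homo f) fs).

Lemma chain_factorE (s : sd) p (f : nerve (poset_category Q) p)
    (fs : forall i, fob f i \in val s) : f = act (chain_factor fs) (chain_simplex s).
Proof. by apply: poset_functor_eq => i /=; rewrite srankK. Qed.

End Subdivision.

(** * Barycentric coordinates on the nerve of a finite poset *)

Section Weights.
Variables (R : realType) (d : Order.disp_t) (Q : finPOrderType d).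
Implicit Types (s : sd Q) (q : Q).

(** A point of the order complex of [Q] in barycentric coordinates. *)
Definition is_weight (w : Q -> R) : Prop :=
  [/\ forall q, 0 <= w q, \sum_q w q = 1 &
      forall x y, w x != 0 -> w y != 0 -> (x >=< y)%O].

Definition weight := {w : Q -> R | is_weight w}.

Lemma weight_ge0 (w : weight) q : 0 <= sval w q.
Proof. by have [] := svalP w. Qed.

Lemma weight_sum (w : weight) : \sum_q sval w q = 1.
Proof. by have [] := svalP w. Qed.

Lemma weight_eq (w w' : weight) : sval w =1 sval w' -> w = w'.
Proof. by move=> /funext; apply: eq_sig_hprop => *; exact: Prop_irrelevance. Qed.

Definition supported (w : Q -> R) s : Prop := forall q, q \notin val s -> w q = 0.

Lemma weight_suppP (w : weight) : chainb [set q | sval w q != 0]%SET.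
Proof.
have [w0 w1 wc] := svalP w; apply/andP; split.
  apply/negP => /eqP/finset.setP E; have : \sum_q sval w q = 0.
    by apply: big1 => q _; have := E q; rewrite !inE => /negbFE/eqP.
  by rewrite w1; apply/eqP; rewrite oner_eq0.
apply/forall_inP => x; rewrite inE => x0; apply/forall_inP => y; rewrite inE => y0.
exact: wc.
Qed.

Definition weight_supp (w : weight) : sd Q := exist (fun S => chainb S) _ (weight_suppP w).

Lemma weight_suppE (w : weight) q : (q \in val (weight_supp w)) = (sval w q != 0).
Proof. by rewrite inE. Qed.

Lemma supported_supp (w : weight) : supported (sval w) (weight_supp w).
Proof. by move=> q; rewrite weight_suppE negbK => /eqP. Qed.

Lemma supported_is_weight (w : Q -> R) s : (forall q, 0 <= w q) -> \sum_q w q = 1 ->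
  supported w s -> is_weight w.
Proof.
move=> w0 w1 ws; split=> // x y x0 y0; apply: (sd_comparable (s := s)).
  by apply: contraNT x0 => /ws ->.
by apply: contraNT y0 => /ws ->.
Qed.

Lemma sum_senum s (F : Q -> R) : supported F s ->
  \sum_i F (@senum _ _ s i) = \sum_q F q.
Proof.
move=> Fs; rewrite (bigID (fun q => q \in val s)) /= [X in _ + X]big1 ?addr0; last first.
  by move=> q /Fs.
rewrite [RHS](reindex_onto (@senum _ _ s) (srank s)) /=; last first.
  by move=> q qs; rewrite srankK.
apply: eq_bigl => i; rewrite senum_in /=; apply/esym/eqP/(@senum_inj _ _ s).
by rewrite srankK // senum_in.
Qed.

(** When [w] is supported by [s] these are its values along [s]; otherwise the
    missing mass is put on the least element of [s], which keeps the formula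
    continuous in [w]. *)
Definition restrict_row (w : weight) s : 'rV[R]_(chain_dim s).+1 :=
  \row_i (sval w (senum i) + if i == ord0 then 1 - \sum_k sval w (@senum _ _ s k) else 0).

Lemma restrict_rowP w s : restrict_row w s \in @std_simplex R (chain_dim s).
Proof.
have s1 : \sum_k sval w (@senum _ _ s k) <= 1.
  rewrite -(weight_sum w) [leRHS](bigID (fun q => q \in val s)) /=.
  pose F q := if q \in val s then sval w q else 0.
  rewrite (eq_bigr (fun k => F (senum k))); last by move=> k _; rewrite /F senum_in.
  rewrite sum_senum; last by move=> q /negPf qs; rewrite /F qs.
  rewrite /F -big_mkcond /= lerDl; apply: sumr_ge0 => q _; exact: weight_ge0.
apply/mem_set; split=> [i|].
  rewrite mxE addr_ge0 ?weight_ge0 //; case: ifP => _ //; lra.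
under eq_bigr do rewrite mxE; rewrite big_split /= -big_mkcond big_pred1_eq.
by rewrite addrC subrK.
Qed.

Definition restrict w s : std_simplexT R (chain_dim s) :=
  exist (fun x => x \in @std_simplex R (chain_dim s)) _ (restrict_rowP w s).

Lemma restrictE w s i : supported (sval w) s ->
  val (restrict w s) ord0 i = sval w (senum i).
Proof.
by move=> ws; rewrite mxE sum_senum // weight_sum subrr; case: ifP; rewrite addr0.
Qed.

(** The point of the realization with barycentric coordinates [w]. *)
Definition bary (w : weight) : realization R (nerve (poset_category Q)) :=
  point_of (cell (chain_simplex (weight_supp w)) (restrict w (weight_supp w))).

End Weights.

Section Coordinates.
Variables (R : realType) (d : Order.disp_t) (Q : finPOrderType d).
Implicit Types (s : sd Q) (q : Q).
Notation N := (nerve (poset_category Q)).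

Definition cell_coord p (f : N p) (t : std_simplexT R p) (q : Q) : R :=
  \sum_(i | fob f i == q) val t ord0 i.

Lemma cell_coord_is_weight p (f : N p) t : is_weight (@cell_coord p f t).
Proof.
have [t0 t1] := simplexP t; split.
- by move=> q; apply: sumr_ge0 => i _.
- by rewrite -t1 [RHS](partition_big (fob f : _ -> Q) xpredT).
- move=> x y.
  have fP z : cell_coord f t z != 0 -> exists i, fob f i = z.
    move=> z0; apply: contrapT => H; case/eqP: z0; apply: big1 => i /eqP E.
    by case: H; exists i.
  move=> /fP[i <-] /fP[j <-]; have /orP[ij|ij] := le_total i j.
    by apply/orP; left; exact: functor_homo ij.
  by apply/orP; right; exact: functor_homo ij.
Qed.

Lemma cell_coord_act p r (a : Delta p r) (f : N r) (t : std_simplexT R p) x :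
  cell_coord (act a f) t x = cell_coord f (push a t) x.
Proof.
rewrite /cell_coord /=; under [RHS]eq_bigr do rewrite mxE.
rewrite [LHS](partition_big (a : _ -> _) (fun j => fob f j == x)) //=.
apply: eq_bigr => j /eqP fj; apply: eq_bigl => i.
by case: (a i =P j) => [->|]; rewrite ?andbF ?andbT // fj eqxx.
Qed.

Lemma chain_coord s (w : weight R Q) q : supported (sval w) s ->
  cell_coord (chain_simplex s) (restrict w s) q = sval w q.
Proof.
move=> ws; rewrite /cell_coord; have [qs|qs] := boolP (q \in val s).
  rewrite (big_pred1 (srank s q)); first by rewrite restrictE // srankK.
  move=> i /=; apply/eqP/eqP => [<-|->]; last by rewrite srankK.
  by apply: (@senum_inj _ _ s); rewrite srankK // senum_in.
rewrite (ws _ qs) big1 // => i /eqP /= E; by rewrite -E senum_in in qs.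
Qed.

Lemma push_restrict s (w : weight R Q) p (f : N p) t (fs : forall i, fob f i \in val s) :
  sval w =1 cell_coord f t -> push (chain_factor fs) t = restrict w s.
Proof.
move=> E; apply: simplex_eq => j; rewrite restrictE; last first.
  move=> q qs; rewrite E; apply: big1 => i /eqP fi.
  by move: (fs i); rewrite fi (negPf qs).
rewrite mxE E; apply: eq_bigl => i /=; apply/eqP/eqP => [<-|fi].
  by rewrite srankK.
by apply: (@senum_inj _ _ s); rewrite srankK // fi.
Qed.

End Coordinates.

Section Bary.
Variables (R : realType) (d : Order.disp_t) (Q : finPOrderType d).
Implicit Types (s : sd Q) (q : Q).
Notation N := (nerve (poset_category Q)).

(** A cell is glued to the face spanned by the positive coordinates, and this face
    is a degeneracy of the increasing enumeration of its vertices. *)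
Lemma point_bary p (f : N p) (t : std_simplexT R p) (w : weight R Q) :
  sval w =1 cell_coord f t -> point_of (cell f t) = bary w.
Proof.
move=> E; have [t0 t1] := simplexP t.
(* The coordinates of [t] form a weight on the total order ['I_p.+1]; enumerating its support gives
   the inclusion [a] of the face spanned by the positive coordinates. *)
have tw : is_weight (fun i : 'I_p.+1 => val t ord0 i).
  by split=> // x y _ _; exact: real_leVge.
pose v : weight R 'I_p.+1 := exist (@is_weight R _ _) _ tw.
pose S := weight_supp v.
pose a : Delta (chain_dim S) p := DeltaMap (@senum_homo _ _ S).
have at' : push a (restrict v S) = t.
  apply: simplex_eq => j; rewrite -[RHS]/(sval v j).
  have vS : supported (sval v) S by exact: supported_supp.
  by rewrite -[RHS](chain_coord _ vS) [LHS]mxE.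
have fs i : fob (act a f) i \in val (weight_supp w).
  rewrite weight_suppE E /= psumr_neq0; last by move=> k _; exact: t0.
  apply/hasP; exists (a i); rewrite ?mem_index_enum //= eqxx lt_neqAle t0 andbT eq_sym.
  by have := senum_in i; rewrite weight_suppE.
rewrite -at' -point_glue (chain_factorE fs) point_glue /bary.
congr (point_of (cell _ _)); apply: push_restrict => q.
by rewrite E cell_coord_act at'.
Qed.

Lemma bary_supported s (w : weight R Q) : supported (sval w) s ->
  bary w = point_of (cell (chain_simplex s) (restrict w s)).
Proof. by move=> ws; apply/esym/point_bary => q; rewrite chain_coord. Qed.

Lemma coord_exists : exists G : realization R N -> Q -> R,
  forall p (f : N p) t, G (point_of (cell f t)) = cell_coord f t.
Proof.
apply: (@realization_lift R N (Q -> R) (fun p f t => cell_coord f t)) => p r a f t.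
by apply/funext => x; exact: cell_coord_act.
Qed.

Definition coord_fun := sval (cid coord_exists).

Lemma coord_cell p (f : N p) t : coord_fun (point_of (cell f t)) = cell_coord f t.
Proof. exact: svalP (cid coord_exists) p f t. Qed.

Lemma coord_is_weight x : is_weight (coord_fun x).
Proof.
by have [p [f [t ->]]] := pointP x; rewrite coord_cell; exact: cell_coord_is_weight.
Qed.

Definition bcoord x : weight R Q := exist (@is_weight R d Q) _ (coord_is_weight x).

Lemma coordE p (f : N p) t q : sval (bcoord (point_of (cell f t))) q = cell_coord f t q.
Proof. by rewrite /bcoord /= coord_cell. Qed.

Arguments bcoord : simpl never.

Lemma coordK x : bary (bcoord x) = x.
Proof.
have [p [f [t ->]]] := pointP x; apply/esym/point_bary => q.
exact: coordE.
Qed.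

Lemma baryK w : bcoord (bary w) = w.
Proof.
apply: weight_eq => q; rewrite coordE chain_coord //; exact: supported_supp.
Qed.

Lemma coord_inj x y : sval (bcoord x) =1 sval (bcoord y) -> x = y.
Proof. by move=> /weight_eq E; rewrite -(coordK x) E coordK. Qed.

Lemma bcoord_continuous q : continuous (fun x => sval (bcoord x) q).
Proof.
apply: continuous_realization => p f; under eq_fun do rewrite coordE.
apply: continuous_sumr => i; exact: simplex_coord_continuous.
Qed.

(** There are finitely many chains. Where the weight is supported in a given one, a closed
    condition, the point lies in a single cell, and [restrict] extends its coordinates continuously
    to all of [X]. *)
Lemma bary_continuous (X : topologicalType) (w : X -> weight R Q) :
  (forall q, continuous (fun x => sval (w x) q)) -> continuous (fun x => bary (w x)).
Proof.
move=> cw; apply: (@continuous_closed_cover _ _ (sd Q)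
  (fun s => [set x | supported (sval (w x)) s])
  (fun s x => point_of (cell (chain_simplex s) (restrict (w x) s)))).
- move=> s; rewrite (_ : mkset _ = \bigcap_(q in [set q | q \notin val s])
    (fun x => sval (w x) q) @^-1` [set 0]); last by [].
  apply: closed_bigI => q _; apply: preimage_closed; last exact: (@closed_eq R 0).
  by move=> x _; exact: cw.
- move=> s; apply: (cont_comp _ (@continuous_point _ _ _ _)).
  apply: continuous_simplex => i; under eq_fun do rewrite mxE.
  apply: cont_add; first exact: cw.
  case: (i == ord0); last exact: cont_cst.
  by apply: cont_sub; [exact: cont_cst|apply: continuous_sumr => k; exact: cw].
- by move=> x; exists (weight_supp (w x)); exact: supported_supp.
- by move=> s x /bary_supported.
Qed.

(** Points supported in one chain lie in a common closed simplex, which contains the segment between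
    them. *)
Lemma straight_line_homotopic (X : topologicalType)
    (f g : X -> realization R N) : continuous f -> continuous g ->
  (forall x, exists s, supported (sval (bcoord (f x))) s /\
                       supported (sval (bcoord (g x))) s) ->
  homotopic R f g.
Proof.
move=> cf cg fg.
pose W (z : R * X) q : R := (1 - clamp z.1) * sval (bcoord (f z.2)) q
                        + clamp z.1 * sval (bcoord (g z.2)) q.
have WP z : is_weight (W z).
  have [s [fs gs]] := fg z.2; have c0 := clamp_ge0 z.1; have c1 := clamp_le1 z.1.
  apply: (@supported_is_weight _ _ _ _ s) => [q||q qs].
  - by rewrite addr_ge0 // mulr_ge0 ?weight_ge0 // subr_ge0.
  - by rewrite big_split -!mulr_sumr !weight_sum !mulr1 /= subrK.
  - by rewrite /W fs // gs // !mulr0 addr0.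
exists (fun z => bary (exist (@is_weight R d Q) _ (WP z))); split.
- apply: bary_continuous => q /=.
  have cc : continuous (fun z : R * X => clamp z.1).
    exact: cont_comp (@fst_cont _ _) (@clamp_continuous R).
  have ck k : continuous k -> continuous (fun z : R * X => sval (bcoord (k z.2)) q).
    by move=> ck; exact: (cont_comp (cont_comp (@snd_cont R X) ck) (@bcoord_continuous q)).
  apply: cont_add; apply: cont_mul => //.
  + by apply: cont_sub => //; exact: cont_cst.
  + exact: ck.
  + exact: ck.
- move=> x; apply: coord_inj => q; rewrite baryK /= /W /= clamp_eq0 //.
  by rewrite subr0 mul1r mul0r addr0.
- move=> x; apply: coord_inj => q; rewrite baryK /= /W /= clamp_eq1 //.
  by rewrite subrr mul1r mul0r add0r.
Qed.

End Bary.

Section BaryMap.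
Variables (R : realType) (d d' : Order.disp_t).
Variables (P : finPOrderType d) (Q : finPOrderType d').
Variables (f : P -> Q) (fP : {homo f : x y / (x <= y)%O}).

Lemma coord_map x q : sval (bcoord (@classifying_map R _ _ (mono_functor fP) x)) q =
  \sum_(a | f a == q) sval (bcoord x) a.
Proof.
have [p [s [t ->]]] := pointP x; rewrite /classifying_map realization_map_cell coordE.
under [RHS]eq_bigr do rewrite coordE.
rewrite /cell_coord /=.
rewrite (partition_big (fob s : _ -> P) (fun a => f a == q)) //=.
apply: eq_bigr => a /eqP fa; apply: eq_bigl => i.
by case: (fob s i =P a) => [->|]; rewrite ?andbF // fa eqxx.
Qed.

End BaryMap.

(** * Natural transformations *)

Definition is_natural (C D : category) (F G : functor C D)
    (eta : forall x, Defs.hom (F x) (G x)) : Prop :=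
  forall x y (f : Defs.hom x y), cmp (eta y) (Defs.fmap F f) = cmp (Defs.fmap G f) (eta x).

Section CylinderFunctor.
Variables (C D : category) (F G : functor C D) (eta : forall x, Defs.hom (F x) (G x)).
Hypothesis etaN : is_natural eta.

(** A natural transformation is encoded as a functor on the product of [C] with the order
    [false <= true]. *)
Definition cyl_ob (b : bool) (c : C) : D := if b then G c else F c.

Lemma true_le_false : (true <= false)%O -> False.
Proof. by []. Qed.

Definition cyl_hom (b b' : bool) (c c' : C) (m : Defs.hom c c') :
    (b <= b')%O -> Defs.hom (cyl_ob b c) (cyl_ob b' c') :=
  match b, b' return (b <= b')%O -> Defs.hom (cyl_ob b c) (cyl_ob b' c') with
  | true, true => fun _ => Defs.fmap G m
  | false, true => fun _ => cmp (eta c') (Defs.fmap F m)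
  | false, false => fun _ => Defs.fmap F m
  | true, false => fun h => False_rect _ (true_le_false h)
  end.

Lemma cyl_hom1 b c (h : (b <= b)%O) : cyl_hom (idm c) h = idm (cyl_ob b c).
Proof. by case: b h => h; rewrite /= fmap1. Qed.

Lemma cyl_homM b b' b'' c c' c'' (m : Defs.hom c c') (m' : Defs.hom c' c'')
    (h : (b <= b')%O) (h' : (b' <= b'')%O) (h'' : (b <= b'')%O) :
  cyl_hom (cmp m' m) h'' = cmp (cyl_hom m' h') (cyl_hom m h).
Proof.
case: b b' b'' h h' h'' => -[] [] h h' h'' //=; rewrite ?fmapM //.
- by rewrite cmpA etaN -cmpA.
- by rewrite cmpA.
Qed.

Definition cyl (p : nat) := ('I_p.+1 *p bool)%type.

Lemma cyl_le1 p (x y : cyl p) : (x <= y)%O -> (x.1 <= y.1)%O.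
Proof. by rewrite leEprod => /andP[]. Qed.

Lemma cyl_le2 p (x y : cyl p) : (x <= y)%O -> (x.2 <= y.2)%O.
Proof. by rewrite leEprod => /andP[]. Qed.

Section Fixed.
Variables (p : nat) (s : functor (linear_category p) C).

Definition cyl_fmap (x y : poset_category (cyl p)) (h : Defs.hom x y) :
    Defs.hom (cyl_ob x.2 (s x.1)) (cyl_ob y.2 (s y.1)) :=
  cyl_hom (@Defs.fmap _ _ s x.1 y.1 (cyl_le1 h)) (cyl_le2 h).

Lemma cyl_fmap1 x : cyl_fmap (idm x) = idm (cyl_ob x.2 (s x.1)).
Proof.
rewrite /cyl_fmap -(cyl_hom1 _ (cyl_le2 (idm x))) -fmap1.
by congr cyl_hom; congr Defs.fmap; exact: bool_irrelevance.
Qed.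

Lemma cyl_fmapM x y z (g : Defs.hom y z) (f : Defs.hom x y) :
  cyl_fmap (cmp g f) = cmp (cyl_fmap g) (cyl_fmap f).
Proof.
rewrite /cyl_fmap -(cyl_homM _ _ _ _ (cyl_le2 (cmp g f))) -fmapM.
by congr cyl_hom; congr Defs.fmap; exact: bool_irrelevance.
Qed.

Definition cyl_functor : functor (poset_category (cyl p)) D := Functor cyl_fmap1 cyl_fmapM.
End Fixed.

Lemma cyl_homo p (b : bool) :
  {homo (fun i : 'I_p.+1 => (i, b) : cyl p) : i j / (i <= j)%O}.
Proof. by move=> i j ij; rewrite leEprod /= ij lexx. Qed.

Definition cyl_end p (b : bool) : nerve (poset_category (cyl p)) p :=
  mono_functor (@cyl_homo p b).

Lemma cyl_functor_end p (s : functor (linear_category p) C) (b : bool) :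
  fcomp (cyl_functor s) (cyl_end p b) = fcomp (if b then G else F) s.
Proof.
case: b.
  have E : fob (fcomp (cyl_functor s) (cyl_end p true)) = fob (fcomp G s) by [].
  apply: (functor_eq (E := E)) => x y h; rewrite (Prop_irrelevance E erefl) /=.
  by congr Defs.fmap; congr Defs.fmap; exact: bool_irrelevance.
have E : fob (fcomp (cyl_functor s) (cyl_end p false)) = fob (fcomp F s) by [].
apply: (functor_eq (E := E)) => x y h; rewrite (Prop_irrelevance E erefl) /=.
by congr Defs.fmap; congr Defs.fmap; exact: bool_irrelevance.
Qed.

Lemma cyl_map_homo p q (a : Delta p q) :
  {homo (fun x : cyl p => (a x.1, x.2) : cyl q) : x y / (x <= y)%O}.
Proof.
by move=> x y; rewrite !leEprod /= => /andP[xy ->]; rewrite andbT; exact: Delta_homo.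
Qed.

Definition cyl_map p q (a : Delta p q) := mono_functor (cyl_map_homo a).

Lemma cyl_functor_act p q (a : Delta p q) (s : nerve C q) :
  cyl_functor (act a s) = fcomp (cyl_functor s) (cyl_map a).
Proof.
have E : fob (cyl_functor (act a s)) = fob (fcomp (cyl_functor s) (cyl_map a)) by [].
apply: (functor_eq (E := E)) => x y h; rewrite (Prop_irrelevance E erefl) /=.
rewrite /cyl_fmap /=; congr cyl_hom; last exact: bool_irrelevance.
by congr Defs.fmap; exact: bool_irrelevance.
Qed.

End CylinderFunctor.

(** * The prism over a simplex in barycentric coordinates *)

Section CylinderWeight.
Variable R : realType.

Section Fixed.
Variables (p : nat) (t : std_simplexT R p) (v : R).
Hypothesis v0 : 0 <= v.

(** The simplex coordinates cut [0, 1] into consecutive intervals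
    [[cumul i, cumul i.+1]]; [low i] is the length of the part of the [i]-th one that
    lies below [v]. *)
Definition cumul (n : nat) : R := \sum_(i < n) val t ord0 (inord i).
Definition low (n : nat) : R := Num.min (cumul n.+1) v - Num.min (cumul n) v.

Let t0 i : 0 <= val t ord0 i. Proof. exact: (simplexP t).1. Qed.

Lemma cumulS n : cumul n.+1 = cumul n + val t ord0 (inord n).
Proof. exact: big_ord_recr. Qed.

Lemma cumul_le m n : (m <= n)%N -> cumul m <= cumul n.
Proof.
elim: n => [|n IH]; first by rewrite leqn0 => /eqP->.
rewrite leq_eqVlt => /orP[/eqP->//|/IH mn].
by rewrite cumulS; apply: le_trans mn _; rewrite lerDl.
Qed.

Lemma cumul1 : cumul p.+1 = 1.
Proof.
rewrite -(simplexP t).2; apply: eq_bigr => i _; by rewrite inord_val.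
Qed.

Lemma low_ge0 n : 0 <= low n.
Proof.
by rewrite subr_ge0 le_min !ge_min lexx orbT andbT (cumul_le (leqnSn n)).
Qed.

Lemma low_le (i : 'I_p.+1) : low i <= val t ord0 i.
Proof.
rewrite /low cumulS inord_val; have := t0 i => ti.
by case: (leP (cumul i) v) => cv; case: (leP (_ + _) v) => cv'; lra.
Qed.

Lemma low_gt0 n : low n != 0 -> cumul n < v.
Proof.
apply: contraNT; rewrite -leNgt => vc; rewrite /low !min_r ?subrr //.
exact: le_trans vc (cumul_le (leqnSn n)).
Qed.

Lemma low_lt (i : 'I_p.+1) : val t ord0 i - low i != 0 -> v < cumul i.+1.
Proof.
apply: contraNT; rewrite -leNgt => cv; have := cumul_le (leqnSn i) => c1.
rewrite /low !min_l //; last exact: le_trans c1 cv.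
by rewrite cumulS inord_val; apply/eqP; ring.
Qed.

(** A down-closed [D] is an initial segment, over which the lengths telescope. *)
Lemma sum_low (D : pred 'I_p.+1) : (forall i j : 'I_p.+1, (i <= j)%O -> D j -> D i) ->
  \sum_(i | D i) low i = Num.min (\sum_(i | D i) val t ord0 i) v.
Proof.
move=> Dd.
have [n np Dn] : exists2 n, (n <= p.+1)%N & forall i : 'I_p.+1, D i = (i < n)%N.
  pose P n := [forall i : 'I_p.+1, D i ==> (i < n)%N].
  have exP : exists n, P n by exists p.+1; apply/forallP => i; rewrite ltn_ord implybT.
  case: (ex_minnP exP) => n /forallP Pn nmin; exists n.
    by apply: nmin; apply/forallP => i; rewrite ltn_ord implybT.
  move=> i; apply/idP/idP => [|ni]; first exact: implyP (Pn i).
  apply: contraLR ni => Di; rewrite -leqNgt; apply: nmin; apply/forallP => j.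
  apply/implyP => Dj; rewrite ltnNge; apply: contra Di => ij; exact: Dd Dj.
transitivity (\sum_(i < n) low i).
  by rewrite (big_ord_widen _ low np); apply: eq_bigl.
transitivity (Num.min (cumul n) v).
  rewrite -(big_mkord xpredT low) telescope_sumr // /cumul big_ord0.
  by rewrite (min_l v0) subr0.
congr Num.min; rewrite /cumul (big_ord_widen _ (fun i => val t ord0 (inord i)) np).
by apply: eq_big => // i; rewrite inord_val.
Qed.

(** For [v] in the unit interval, the point over [t] at height [1 - v] of the prism: mass below the
    cut [v] goes to the end [false], the rest to the end [true]. *)
Definition cyl_coord (x : cyl p) : R :=
  if x.2 then val t ord0 x.1 - low x.1 else low x.1.

Lemma sum_cyl (T : cyl p -> R) :
  \sum_x T x = \sum_(i : 'I_p.+1) (T (i, true) + T (i, false)).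
Proof.
transitivity (\sum_(i : 'I_p.+1) \sum_(b : bool) T (i, b)).
  by rewrite pair_bigA /=; apply: eq_bigr => -[].
by apply: eq_bigr => i _; rewrite big_bool.
Qed.

Lemma cyl_coord_is_weight : is_weight cyl_coord.
Proof.
split.
- by move=> [i []]; rewrite /cyl_coord /= ?low_ge0 // subr_ge0 low_le.
- by rewrite sum_cyl -(simplexP t).2; apply: eq_bigr => i _; rewrite /cyl_coord /= subrK.
(* Mass at [(i, false)] means that the [i]-th interval starts below [v], mass at [(j, true)] that
   the [j]-th one ends above [v]; so the support is a chain. *)
have lt (i j : 'I_p.+1) : low i != 0 -> val t ord0 j - low j != 0 -> (i <= j)%O.
  move=> /low_gt0 iv /low_lt vj; rewrite leNgt; apply/negP => ji.
  by have := cumul_le (ji : (j.+1 <= i)%N); lra.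
move=> [i b] [j b']; rewrite /cyl_coord /Order.comparable !leEprod /=.
case: b b' => -[] ib jb; rewrite ?lexx ?andbT ?andbF ?orbF //=; first exact: le_total.
- by rewrite lt.
- by rewrite lt.
- exact: le_total.
Qed.

Definition cyl_weight : weight R (cyl p) := exist _ _ cyl_coord_is_weight.

End Fixed.

(** The preimage under [a] of an initial segment is an initial segment, so [sum_low] computes the
    partial sums of [push a t] cut off at [v]; the lengths are their differences. *)
Lemma cyl_coord_push p q (a : Delta p q) (t : std_simplexT R p) (v : R) y : 0 <= v ->
  cyl_coord (push a t) v y = \sum_(x | (a x.1, x.2) == y) cyl_coord t v x.
Proof.
move=> v0; case: y => j b.
have -> : \sum_(x : cyl p | (a x.1, x.2) == (j, b) :> cyl q) cyl_coord t v x =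
          \sum_(i | a i == j) cyl_coord t v (i, b).
  rewrite big_mkcond sum_cyl [RHS]big_mkcond; apply: eq_bigr => i _.
  rewrite !xpair_eqE; case: (a i == j) => //=; last by rewrite addr0.
  by case: b => /=; rewrite ?addr0 ?add0r.
have low_push : low (push a t) v j = \sum_(i | a i == j) low t v i.
  have cp n : (n <= q.+1)%N -> cumul (push a t) n = \sum_(i | (a i < n)%N) val t ord0 i.
    move=> nq; rewrite /cumul.
    rewrite (big_ord_widen _ (fun k => val (push a t) ord0 (inord k)) nq).
    rewrite [RHS](partition_big (a : _ -> _) (fun k : 'I_q.+1 => (k < n)%N)) //=.
    apply: eq_bigr => k kn; rewrite inord_val mxE; apply: eq_bigl => i.
    by case: (a i =P k) => [->|]; rewrite ?andbF // kn.
  have lp n : (n <= q.+1)%N ->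
      Num.min (cumul (push a t) n) v = \sum_(i | (a i < n)%N) low t v i.
    move=> nq; rewrite cp // sum_low // => i i' ii'.
    by apply: leq_ltn_trans; exact: (Delta_homo a ii').
  rewrite /low !lp //; last by rewrite ltnW.
  rewrite (bigID (fun i => (a i < j)%N)) /=.
  rewrite [X in X + _ - _](eq_bigl (fun i => (a i < j)%N)); last first.
    by move=> i; rewrite ltnS andb_idl // => /ltnW.
  rewrite addrAC subrr add0r; apply: eq_bigl => i.
  by rewrite ltnS -leqNgt -eqn_leq.
rewrite /cyl_coord; case: b => //=.
by rewrite low_push mxE [RHS]sumrB.
Qed.

End CylinderWeight.

Section NaturalHomotopy.
Variables (R : realType) (C D : category) (F G : functor C D).

Theorem natural_homotopic (eta : forall x, Defs.hom (F x) (G x)) : is_natural eta ->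
  homotopic R (@classifying_map R _ _ F) (@classifying_map R _ _ G).
Proof.
move=> etaN; have v0 (u : R) : 0 <= 1 - clamp u by rewrite subr_ge0 clamp_le1.
(* The cut [1 - clamp u] moves from 1 to 0, so the homotopy starts at the end [false], where the
   functor is [F]. *)
pose K p (s : nerve C p) (t : std_simplexT R p) (u : R) : classifying_space R D :=
  @classifying_map R _ _ (cyl_functor etaN s) (bary (cyl_weight t (1 - clamp u))).
have [|H HE] := @realization_lift R (nerve C) _ K.
  move=> p q a s t; apply/funext => u; rewrite /K cyl_functor_act classifying_map_comp.
  congr classifying_map; apply: coord_inj => y.
  by rewrite coord_map !baryK; apply/esym/cyl_coord_push/v0.
(* When all the mass lies over one end of the prism, the point comes from the simplex
   [cyl_end p b]. *)
have Kend p (s : nerve C p) t u b : (forall x, cyl_coord t (1 - clamp u) x =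
    if x.2 == b then val t ord0 x.1 else 0) ->
  K p s t u = @classifying_map R _ _ (if b then G else F) (point_of (cell s t)).
  move=> tb; rewrite /K -(@point_bary _ _ _ p (cyl_end p b) t).
    by rewrite /classifying_map !realization_map_cell /= cyl_functor_end.
  move=> [i c]; rewrite /= tb /cell_coord /=; case: eqP => [->|cb].
    by rewrite (big_pred1 i) // => k; rewrite xpair_eqE eqxx andbT.
  by rewrite big1 // => k /eqP[_ bc]; case: cb.
exists (fun z => H z.2 z.1); split.
- apply: continuous_realization_prod => p s /=; under eq_fun do rewrite HE.
  apply: (cont_comp _ (@continuous_classifying_map R _ _ _)).
  apply: bary_continuous => x /=; rewrite /cyl_coord.
  have cu : continuous (fun z : std_simplexT R p * R => 1 - clamp z.2).
    apply: cont_sub; first exact: cont_cst.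
    by apply: (cont_comp _ (@clamp_continuous R)) => z; exact: cvg_snd.
  have ct i : continuous (fun z : std_simplexT R p * R => val z.1 ord0 i).
    have c1 : continuous (fst : std_simplexT R p * R -> _) by move=> z; exact: cvg_fst.
    exact: (cont_comp c1 (@simplex_coord_continuous R p i)).
  have cl n : continuous (fun z : std_simplexT R p * R => low z.1 (1 - clamp z.2) n).
    by apply: cont_sub; apply: cont_min => //; apply: continuous_sumr.
  by case: x.2 => //; apply: cont_sub.
- move=> x; have [p [s [t ->]]] := pointP x; rewrite HE (Kend _ _ _ _ false) //.
  move=> [i b]; rewrite /cyl_coord /low clamp_eq0 // subr0.
  have c1 n : (n <= p.+1)%N -> cumul t n <= 1 by move=> /(cumul_le t); rewrite cumul1.
  rewrite !min_l ?c1 //= ?ltnS; last by rewrite ltnW.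
  by rewrite cumulS inord_val [_ + _ - _]addrAC subrr add0r; case: b; rewrite //= subrr.
- move=> x; have [p [s [t ->]]] := pointP x; rewrite HE (Kend _ _ _ _ true) //.
  move=> [i b]; rewrite /cyl_coord /low clamp_eq1 // subrr.
  have c0 n : 0 <= cumul t n by apply: sumr_ge0 => k _; exact: (simplexP t).1.
  by rewrite !min_r // subrr; case: b; rewrite //= subr0.
Qed.

End NaturalHomotopy.

(** * Barycentric subdivision *)

Section LastVertex.
Variables (d : Order.disp_t) (Q : finPOrderType d).

Definition chain_max (s : sd Q) : Q := @senum _ _ s ord_max.

Lemma chain_max_in s : chain_max s \in val s.
Proof. exact: senum_in. Qed.

Lemma chain_maxP (s : sd Q) q : q \in val s -> (q <= chain_max s)%O.
Proof. by move=> qs; rewrite -(srankK qs); apply: senum_homo; exact: leq_ord. Qed.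

Lemma chain_max_homo : {homo chain_max : s t / (s <= t)%O}.
Proof. by move=> s t /fintype.subsetP st; apply/chain_maxP/st/chain_max_in. Qed.

Definition last_functor : functor (poset_category (sd Q)) (poset_category Q) :=
  mono_functor chain_max_homo.

End LastVertex.

Section Barycentric.
Variables (R : realType) (d : Order.disp_t) (Q : finPOrderType d).
Implicit Types (s : sd Q) (q : Q) (w : weight R (sd Q)) (tau : weight R Q).

Lemma weight_le1 (T : finPOrderType d) (w : weight R T) (x : T) : sval w x <= 1.
Proof.
rewrite -(weight_sum w) (bigD1 x) //= lerDl; apply: sumr_ge0 => y _; exact: weight_ge0.
Qed.

Lemma card_sd_gt0 s : (0 < #|val s|)%N.
Proof. by apply/card_gt0P; exact: sd_neq0. Qed.

Lemma card_sd_neq0 s : #|val s|%:R != 0 :> R.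
Proof. by rewrite pnatr_eq0 -lt0n card_sd_gt0. Qed.

(** The linear map that sends the vertex [s] of the subdivision to the barycenter of the simplex
    [s]. *)
Definition center_coord w q : R := \sum_(s : sd Q | q \in val s) sval w s / #|val s|%:R.

Lemma supp_top w s : sval w s != 0 -> val s \subset val (chain_max (weight_supp w)).
Proof. by rewrite -weight_suppE => /chain_maxP. Qed.

Lemma center_supported w : supported (center_coord w) (chain_max (weight_supp w)).
Proof.
move=> q qt; apply: big1 => s qs.
have [->|/supp_top/fintype.subsetP/(_ _ qs)] := eqVneq (sval w s) 0.
  by rewrite mul0r.
by rewrite (negPf qt).
Qed.

Lemma center_is_weight w : is_weight (center_coord w).
Proof.
apply: supported_is_weight (@center_supported w) => [q|].
  by apply: sumr_ge0 => s _; rewrite divr_ge0 ?weight_ge0.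
rewrite -(weight_sum w) /center_coord (exchange_big_dep xpredT) //=.
apply: eq_bigr => s _.
by rewrite sumr_const -[LHS]mulr_natr divfK // card_sd_neq0.
Qed.

Definition center w : weight R Q := exist (@is_weight R d Q) _ (center_is_weight w).

(** For nonempty [S] and [f] with values in the unit interval, a positive gap is the length of the
    interval of all [c >= 0] whose superlevel set [{q | c < f q}] is [S]. *)
Definition gap (f : Q -> R) (S : {set Q}) : R :=
  \big[Num.min/1]_(q in S) f q - \big[Num.max/0]_(q | q \notin S) f q.

Lemma gap_gt0 (f : Q -> R) (S : {set Q}) : 0 < gap f S ->
  forall q, q \in S -> 0 < f q /\ forall q', q' \notin S -> f q' < f q.
Proof.
rewrite subr_gt0 => g q qS.
have fq : \big[Num.min/1]_(q in S) f q <= f q by exact: bigmin_le_cond.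
split; first by apply: lt_le_trans fq; apply: le_lt_trans g; exact: bigmax_ge_id.
move=> q' q'S; apply: lt_le_trans fq; apply: le_lt_trans g.
exact: (@le_bigmax_cond _ _ _ _ q' (fun q => q \notin S) f).
Qed.

(** The factor [#|val s|] undoes the division in [center_coord]. *)
Definition level_coord (f : Q -> R) s : R := #|val s|%:R * Num.max 0 (gap f (val s)).

Lemma level_ge0 f s : 0 <= level_coord f s.
Proof. by rewrite mulr_ge0 // le_max lexx. Qed.

Lemma level_gt0 f s : level_coord f s != 0 -> 0 < gap f (val s).
Proof. by apply: contraNT; rewrite -leNgt => g; rewrite /level_coord max_l // mulr0. Qed.

(** Superlevel sets of one function are nested. *)
Lemma level_comparable f s s' :
  level_coord f s != 0 -> level_coord f s' != 0 -> (s >=< s')%O.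
Proof.
move=> /level_gt0/gap_gt0 g /level_gt0/gap_gt0 g'; rewrite /Order.comparable !sd_leE.
case: (boolP (val s \subset val s')) => //= /subsetPn[q qs qs'].
apply/fintype.subsetP => q' q's'; apply: contraT => q's.
by have := (g q qs).2 q' q's; have := (g' q' q's').2 q qs'; lra.
Qed.

(** The set where [tau] is maximal is a chain, because the maximum is positive, and it has a
    positive gap. *)
Lemma sum_level_gt0 tau : 0 < \sum_(s : sd Q) level_coord (sval tau) s.
Proof.
have [q0 _] := sd_neq0 (weight_supp tau).
pose m := [arg max_(q > q0) (sval tau q)]%O.
have mmax q : sval tau q <= sval tau m.
  by rewrite /m; case: arg_maxP => // i _ H; exact: H.
have m0 : 0 < sval tau m.
  rewrite lt_neqAle weight_ge0 andbT eq_sym; apply/eqP => m0.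
  have := weight_sum tau; rewrite big1; first by move/eqP; rewrite eq_sym oner_eq0.
  by move=> q _; apply: le_anti; rewrite weight_ge0 -m0 mmax.
pose S := [set q | sval tau q == sval tau m]%SET.
have SP : chainb S.
  apply/andP; split; first by apply/finset.set0Pn; exists m; rewrite inE.
  apply/forall_inP => x; rewrite inE => /eqP xm.
  apply/forall_inP => y; rewrite inE => /eqP ym.
  have [_ _ c] := svalP tau; by apply: c; rewrite ?xm ?ym gt_eqF.
pose s : sd Q := exist (fun S => chainb S) S SP.
rewrite (bigD1 s) //= ltr_pwDl //; last by apply: sumr_ge0 => s' _; exact: level_ge0.
rewrite mulr_gt0 ?ltr0n ?card_sd_gt0 // lt_max; apply/orP; right.
rewrite subr_gt0; apply: (@lt_le_trans _ _ (sval tau m)).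
  apply: bigmax_lt => // q; rewrite /= inE => qm.
  by rewrite lt_neqAle qm mmax.
by apply: le_bigmin => [|q]; [exact: weight_le1|rewrite /= inE => /eqP ->].
Qed.

Lemma level_is_weight tau : is_weight
  (fun s => level_coord (sval tau) s / \sum_(s : sd Q) level_coord (sval tau) s).
Proof.
have N0 := sum_level_gt0 tau; split.
- by move=> s; rewrite divr_ge0 ?level_ge0 // ltW.
- by rewrite -mulr_suml divff // gt_eqF.
move=> s s' ls ls'; apply: (@level_comparable (sval tau)).
  by apply: contraNN ls => /eqP ->; rewrite mul0r.
by apply: contraNN ls' => /eqP ->; rewrite mul0r.
Qed.

(** The barycentric subdivision in coordinates: the nonzero weights lie on the sets
    [{q | c < tau q}]; inverse to [center]. *)
Definition level tau : weight R (sd Q) := exist (@is_weight R _ (sd Q)) _ (level_is_weight tau).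

Lemma level_supp tau s : sval (level tau) s != 0 -> forall q, q \in val s -> sval tau q != 0.
Proof.
move=> ls; have : level_coord (sval tau) s != 0.
  by apply: contraNN ls => /eqP /= ->; rewrite mul0r.
by move=> /level_gt0/gap_gt0 g q /g[q0 _]; rewrite gt_eqF.
Qed.

Lemma ler_sum_cond (I : finType) (P P' : pred I) (F : I -> R) :
  (forall i, 0 <= F i) -> (forall i, P i -> F i != 0 -> P' i) ->
  \sum_(i | P i) F i <= \sum_(i | P' i) F i.
Proof.
move=> F0 PP'; rewrite big_mkcond [leRHS]big_mkcond; apply: ler_sum => i _.
case: ifP => [Pi|_]; last by case: ifP.
by case: ifP => // P'i; case: (eqVneq (F i) 0) => [->//|/(PP' _ Pi)]; rewrite P'i.
Qed.

(** [center_coord w q] is the sum of [y v] over the chains [v] containing [q], and the chains of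
    nonzero weight are nested. The gap at [s] is found by computing both extrema. *)
Lemma level_center_coord w s : level_coord (center_coord w) s = sval w s.
Proof.
pose y (s' : sd Q) := sval w s' / #|val s'|%:R.
have y0 s' : 0 <= y s' by rewrite divr_ge0 ?weight_ge0.
have yw s' : y s' != 0 -> sval w s' != 0 by apply: contraNN => /eqP E; rewrite /y E mul0r.
have ycmp s1 s2 : y s1 != 0 -> y s2 != 0 ->
    (val s1 \subset val s2) || (val s2 \subset val s1).
  by move=> /yw w1 /yw w2; have [_ _ /(_ _ _ w1 w2)] := svalP w.
pose above (s' : sd Q) := ~~ (val s' \subset val s).
pose Z := \sum_(s' : sd Q | above s') y s'.
have Z0 : 0 <= Z by apply: sumr_ge0.
(* If some chain of nonzero weight is not inside [s], the maximum is attained at a point outside [s]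
   of the smallest such chain, since all the others contain it. Otherwise [Z] is 0. *)
have maxZ : \big[Num.max/0]_(q | q \notin val s) center_coord w q = Z.
  apply: le_anti; apply/andP; split.
    apply: bigmax_le => // q qs; apply: ler_sum_cond => // s' qs' _.
    by apply: contra qs => /fintype.subsetP; exact.
  have [/existsP[v0 vP]|/existsPn none] := boolP [exists v : sd Q, above v && (y v != 0)].
    pose v := [arg min_(v < v0 | above v && (y v != 0)) #|val v|].
    have [/andP[va vy] vmin] : above v && (y v != 0) /\
        forall v', above v' && (y v' != 0) -> (#|val v| <= #|val v'|)%N.
      by rewrite /v; case: arg_minnP.
    have /subsetPn[q qv qs] := va.
    apply: (@le_trans _ _ (center_coord w q)); last first.
      exact: (@le_bigmax_cond _ _ _ _ q (fun q => q \notin val s)).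
    apply: ler_sum_cond => // s' as' ys'.
    have /orP[vs'|s'v] := ycmp _ _ vy ys'; first exact: (fintype.subsetP vs').
    have := vmin s'; rewrite as' ys' => /(_ isT) c.
    by rewrite (_ : val s' = val v) //; apply/eqP; rewrite eqEcard s'v.
  rewrite /Z big1 ?bigmax_ge_id // => s' as'; apply/eqP.
  by have := none s'; rewrite as' /= negbK.
(* A point of [s] outside the largest chain of nonzero weight properly inside [s] sees only [s] and
   chains not inside [s]. *)
have minle : \big[Num.min/1]_(q in val s) center_coord w q <= y s + Z.
  pose part (v : sd Q) := (val v \proper val s) && (y v != 0).
  have [q qs qU] : exists2 q, q \in val s & forall v, part v -> q \notin val v.
    have [/existsP[u0 uP]|/existsPn none] := boolP [exists u : sd Q, part u].
      pose u := [arg max_(u > u0 | part u) #|val u|].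
      have [/andP[us uy] umax] : part u /\ forall u', part u' -> (#|val u'| <= #|val u|)%N.
        by rewrite /u; case: arg_maxnP.
      have /properP[_ [q qs qu]] := us; exists q => // v /[dup] pv /andP[vs vy].
      apply: contra qu; have /orP[/fintype.subsetP vu|uv] := ycmp _ _ vy uy; first exact: vu.
      by rewrite (_ : val v = val u) //; apply/esym/eqP; rewrite eqEcard uv umax.
    by have [q qs] := sd_neq0 s; exists q => // v pv; have := none v; rewrite pv.
  apply: (@le_trans _ _ (center_coord w q)); first exact: bigmin_le_cond.
  have -> : y s + Z = \sum_(s' : sd Q | (s' == s) || above s') y s'.
    rewrite (bigD1 s) ?eqxx //=; congr (_ + _); apply: eq_bigl => s'.
    by rewrite andbC; case: (eqVneq s' s) => [->|]; rewrite /above ?fintype.subxx.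
  apply: ler_sum_cond => // s' qs' ys'; case: eqVneq => //= neq.
  apply/negP => s's; move: (qU s'); rewrite /part ys' finset.properEneq s's qs' andbT andbT.
  by rewrite (inj_eq val_inj) neq => /(_ isT).
(* If [y s] is 0, the gap is not positive. Otherwise every chain of nonzero weight not inside [s]
   contains [s], so the bound of [minle] is the minimum. *)
have [y0s|ys] := eqVneq (y s) 0.
  rewrite /level_coord /gap maxZ max_l ?mulr0; last by rewrite y0s in minle; lra.
  by move/eqP: y0s; rewrite mulf_eq0 invr_eq0 (negPf (card_sd_neq0 s)) orbF => /eqP.
have ley q : q \in val s -> y s + Z <= center_coord w q.
  move=> qs; rewrite /center_coord (bigD1 s) //= lerD2l.
  apply: ler_sum_cond => // s' as' ys'; have /orP[ss'|s's] := ycmp _ _ ys ys'.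
    rewrite (fintype.subsetP ss') //=; by apply: contraNneq as' => ->; rewrite fintype.subxx.
  by rewrite /above s's in as'.
have minE : \big[Num.min/1]_(q in val s) center_coord w q = y s + Z.
  apply: le_anti; rewrite minle /=; apply: le_bigmin => // .
  have [q qs] := sd_neq0 s; apply: le_trans (ley q qs) _; exact: (weight_le1 (center w)).
rewrite /level_coord /gap maxZ minE addrK max_r //.
by rewrite mulrC divfK // card_sd_neq0.
Qed.

Lemma center_level w : level (center w) = w.
Proof.
apply: weight_eq => s; rewrite /= level_center_coord.
under eq_bigr do rewrite level_center_coord.
by rewrite weight_sum divr1.
Qed.

Notation NQ := (realization R (nerve (poset_category Q))).
Notation NsdQ := (realization R (nerve (poset_category (sd Q)))).

Definition center_map (x : NsdQ) : NQ := bary (center (bcoord x)).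
Definition level_map (x : NQ) : NsdQ := bary (level (bcoord x)).

Lemma center_map_continuous : continuous center_map.
Proof.
apply: bary_continuous => q.
apply: (@continuous_sumr R NsdQ _ _ _ (fun s x => sval (bcoord x) s / #|val s|%:R)) => s.
by apply: cont_mul; [exact: bcoord_continuous|exact: cont_cst].
Qed.

Lemma level_map_continuous : continuous level_map.
Proof.
have cl s : continuous (fun x : NQ => level_coord (sval (bcoord x)) s).
  apply: cont_mul; first exact: cont_cst.
  apply: cont_max; first exact: cont_cst.
  apply: cont_sub; first by apply: continuous_bigmin => q; exact: bcoord_continuous.
  by apply: continuous_bigmax => q; exact: bcoord_continuous.
apply: bary_continuous => s; apply: cont_mul => //.
apply: cont_inv; last exact: continuous_sumr.
by move=> x; rewrite gt_eqF // sum_level_gt0.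
Qed.

Lemma center_mapK x : level_map (center_map x) = x.
Proof. by rewrite /level_map /center_map baryK center_level coordK. Qed.

Notation last_map := (@classifying_map R _ _ (last_functor Q)).

Lemma last_map_supported (x : NsdQ) (s : sd Q) :
  (forall u, sval (bcoord x) u != 0 -> chain_max u \in val s) ->
  supported (sval (bcoord (last_map x))) s.
Proof.
move=> xs q qs; rewrite coord_map big1 // => u /eqP uq; apply/eqP.
by apply: contraNT qs => /xs; rewrite uq.
Qed.

(** The largest chain of nonzero weight contains all the others, so its simplex contains both their
    maxima and their barycenters. *)
Lemma last_center_homotopic : homotopic R last_map center_map.
Proof.
apply: straight_line_homotopic; first exact: continuous_classifying_map.
  exact: center_map_continuous.
move=> x; exists (chain_max (weight_supp (bcoord x))); split.
  apply: last_map_supported => u /supp_top/fintype.subsetP; apply; exact: chain_max_in.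
by rewrite baryK; exact: center_supported.
Qed.

(** Chains of nonzero level consist of points in the support of the given point, hence so do their
    maxima. *)
Lemma last_level_homotopic : homotopic R (last_map \o level_map) id.
Proof.
apply: straight_line_homotopic => //.
- exact: cont_comp level_map_continuous (@continuous_classifying_map _ _ _ _).
- by move=> x; exact: cvg_id.
move=> x; exists (weight_supp (bcoord x)); split; last exact: supported_supp.
apply: last_map_supported => u; rewrite baryK => /level_supp H.
by rewrite weight_suppE; apply: H; exact: chain_max_in.
Qed.

Lemma last_homotopy_inverse : homotopy_inverse R last_map level_map.
Proof.
split; [exact: continuous_classifying_map|exact: level_map_continuous| |].
  apply: (@homotopic_trans _ _ _ (level_map \o center_map)).
    by apply: homotopic_eq => [|x]; [move=> x; exact: cvg_id|rewrite /= center_mapK].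
  apply: homotopic_compl; first exact: level_map_continuous.
  exact/homotopic_sym/last_center_homotopic.
exact/homotopic_sym/last_level_homotopic.
Qed.

End Barycentric.

(** * The comparison theorem *)

Section BasicFunctors.
Variables (R : realType) (C D : category).

Definition id_functor : functor C C :=
  @Functor C C id (fun _ _ => id) (fun _ => erefl) (fun _ _ _ _ _ => erefl).

Lemma classifying_map_id : @classifying_map R _ _ id_functor = id.
Proof.
apply/funext => x; have [p [s [t ->]]] := pointP x.
rewrite /classifying_map realization_map_cell; congr (point_of (cell _ t)).
have E : fob (fcomp id_functor s) = fob s by [].
by apply: (functor_eq (E := E)) => i j f; rewrite (Prop_irrelevance E erefl).
Qed.

Lemma classifying_map_fcomp (B : category) (G : functor C D) (F : functor B C) :
  @classifying_map R _ _ (fcomp G F) =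
  @classifying_map R _ _ G \o @classifying_map R _ _ F.
Proof. by apply/funext => x; exact: classifying_map_comp. Qed.

Definition const_functor (d : D) : functor C D :=
  @Functor C D (fun _ => d) (fun _ _ _ => idm d) (fun _ => erefl)
    (fun _ _ _ _ _ => esym (cmp1m (idm d))).

(** A constant functor sends every simplex to a degeneracy of one 0-simplex. *)
Lemma classifying_map_const (d : D) : exists x0 : classifying_space R D,
  forall x, @classifying_map R _ _ (const_functor d) x = x0.
Proof.
have cP p (s : nerve D p) (i : 'I_1) : {homo (fun _ : 'I_p.+1 => i) : a b / (a <= b)%O}.
  by [].
pose s0 : nerve D 0 :=
  @Functor (linear_category 0) D (fun _ => d) (fun _ _ _ => idm d) (fun _ => erefl)
    (fun _ _ _ _ _ => esym (cmp1m (idm d))).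
have t0P : (\row_(i < 1) 1 : 'rV[R]_1) \in @std_simplex R 0.
  by apply/mem_set; split=> [i|]; rewrite ?big_ord1 mxE.
exists (point_of (cell s0 (exist (fun x => x \in @std_simplex R 0) _ t0P))) => x.
have [p [s [t ->]]] := pointP x; rewrite /classifying_map realization_map_cell.
pose a : Delta p 0 := DeltaMap (fun (i j : 'I_p.+1) (_ : (i <= j)%O) => lexx (ord0 : 'I_1)).
have -> : nerve_map (const_functor d) p s = act a s0.
  have E : fob (fcomp (const_functor d) s) = fob (fcomp s0 (Delta_functor a)) by [].
  by apply: (functor_eq (E := E)) => i j f; rewrite (Prop_irrelevance E erefl).
rewrite point_glue; congr (point_of (cell _ _)); apply: simplex_eq => i.
rewrite !mxE -(simplexP t).2; apply: eq_bigl => j; rewrite [i]ord1; exact/eqP.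
Qed.

End BasicFunctors.

Lemma le_homotopic (R : realType) (C : category) (d : Order.disp_t) (Q : porderType d)
    (F G : functor C (poset_category Q)) : (forall x, ((F x : Q) <= G x)%O) ->
  homotopic R (@classifying_map R _ _ F) (@classifying_map R _ _ G).
Proof.
move=> FG; apply: (@natural_homotopic _ _ _ _ _ (FG : forall x, Defs.hom (F x) (G x))).
by move=> x y f; exact: bool_irrelevance.
Qed.

Section ImageChain.
Variables (d d' : Order.disp_t) (P : finPOrderType d) (Q : finPOrderType d').
Variable f : P -> Q.
Hypothesis f_cmp : forall x y, (x <= y)%O -> (f x >=< f y)%O.

(** Comparability is what is asked of [f], so order-reversing maps such as [M] are covered too. *)
Lemma image_chainP (s : sd P) : chainb (f @: val s)%SET.
Proof.
apply/andP; split.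
  by have [x xs] := sd_neq0 s; apply/finset.set0Pn; exists (f x); exact: imset_f.
apply/forall_inP => _ /imsetP[x xs ->]; apply/forall_inP => _ /imsetP[y ys ->].
have /orP[xy|yx] := sd_comparable xs ys; first exact: f_cmp.
by rewrite comparable_sym; exact: f_cmp.
Qed.

Definition image_chain (s : sd P) : sd Q := exist (fun S => chainb S) _ (image_chainP s).

Lemma image_chain_homo : {homo image_chain : s t / (s <= t)%O}.
Proof. by move=> s t st; exact: imsetS. Qed.

Definition image_functor := mono_functor image_chain_homo.
End ImageChain.

Section SimplexChains.
Variables (d : Order.disp_t) (P : finPOrderType d).
Notation C := (simplices (nerve (poset_category P))).

Definition chain_ob (s : sd P) : C := existT _ (chain_dim s) (chain_simplex s).

Definition to_chain (s : C) (c : sd P) (sc : forall i, @vert _ _ s i \in val c) :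
    Defs.hom s (chain_ob c) :=
  exist _ (chain_factor sc) (esym (chain_factorE sc)).

Lemma to_chain_uniq (s : C) (c : sd P) (f g : Defs.hom s (chain_ob c)) : f = g.
Proof.
apply: simplices_hom_eq; apply/funext => i; apply: (@senum_inj _ _ c).
exact: etrans (esym (vert_hom f i)) (vert_hom g i).
Qed.

Lemma chain_obP (c c' : sd P) : (c <= c')%O -> forall i, @vert _ _ (chain_ob c) i \in val c'.
Proof. by move=> /fintype.subsetP cc' i; apply: cc'; exact: senum_in. Qed.

Definition chain_functor : functor (poset_category (sd P)) C :=
  @Functor (poset_category (sd P)) C chain_ob
    (fun c c' cc' => to_chain (chain_obP cc'))
    (fun c => to_chain_uniq _ _) (fun c c' c'' f g => to_chain_uniq _ _).

Lemma vertsP (s : C) : chainb [set vert i | i in 'I_(projT1 s).+1]%SET.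
Proof.
apply/andP; split; first by apply/finset.set0Pn; exists (@vert _ _ s ord0); exact: imset_f.
apply/forall_inP => _ /imsetP[i _ ->]; apply/forall_inP => _ /imsetP[j _ ->].
have /orP[ij|ij] := le_total i j; apply/orP; [left|right];
  exact: (functor_homo (projT2 s) ij).
Qed.

Definition verts (s : C) : sd P := exist (fun S => chainb S) _ (vertsP s).

Lemma vert_in (s : C) i : @vert _ _ s i \in val (verts s).
Proof. exact: imset_f. Qed.

Lemma verts_le (s t : C) : Defs.hom s t -> (verts s <= verts t)%O.
Proof.
move=> f; apply/fintype.subsetP => _ /imsetP[i _ ->]; rewrite (vert_hom f); exact: vert_in.
Qed.

Definition verts_functor : functor C (poset_category (sd P)) :=
  @Functor C (poset_category (sd P)) verts verts_le
    (fun _ => bool_irrelevance _ _) (fun _ _ _ _ _ => bool_irrelevance _ _).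

Lemma natural_to_chain (B : category) (F : functor B C)
    (g : functor B (poset_category (sd P)))
    (eta : forall x, Defs.hom (F x) (chain_ob (g x))) :
  @is_natural _ _ F (fcomp chain_functor g) eta.
Proof. by move=> x y f; exact: to_chain_uniq. Qed.

Lemma chain_homotopic (R : realType) (B : category) (F : functor B C)
    (g : functor B (poset_category (sd P))) :
  (forall x i, @vert _ _ (F x) i \in val (g x : sd P)) ->
  homotopic R (@classifying_map R _ _ F)
    (@classifying_map R _ _ chain_functor \o @classifying_map R _ _ g).
Proof.
move=> Fg; rewrite -classifying_map_fcomp.
exact: (natural_homotopic R (natural_to_chain (fun x => to_chain (Fg x)))).
Qed.

End SimplexChains.

(** The hypotheses record all that is used about trees: [phi] is the functor to the
    poset of trees and [M T] the partition of the leaves into the subtrees above the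
    root vertex of [T]. *)
Section Comparison.
Variables (R : realType) (dP dD : Order.disp_t).
Variables (P : finPOrderType dP) (D : finPOrderType dD).
Notation C := (simplices (nerve (poset_category P))).
Variables (phi : functor C (poset_category D)) (M : D -> P).
Hypothesis M_anti : forall S T, (S <= T)%O -> (M T <= M S)%O.
Hypothesis phi_verts : forall s : C, ((phi (chain_ob (verts s)) : D) <= phi s)%O.
Hypothesis phi_le : forall (c : sd P) T,
  (forall x, x \in val c -> exists2 S, (S <= T)%O & M S = x) ->
  ((phi (chain_ob c) : D) <= T)%O.
Hypothesis M_phi : forall c : sd P, M (phi (chain_ob c)) \in val c.
Hypothesis M_cone : forall (c : sd P) T, ((phi (chain_ob c) : D) <= T)%O ->
  exists c' : sd P, val c' = (M T |: val c)%SET /\ ((phi (chain_ob c') : D) <= T)%O.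

Local Notation "B( F )" := (@classifying_map R _ _ F) (at level 0, F at level 99).
Notation ccm := (@continuous_classifying_map R _ _ _).

Lemma M_cmp S T : (S <= T)%O -> (M S >=< M T)%O.
Proof. by move=> ST; apply/orP; right; exact: M_anti. Qed.

Let G : functor (poset_category (sd D)) C := fcomp (chain_functor P) (image_functor M_cmp).
Let e := B(G) \o @level_map R _ D.

Lemma phi_e : homotopic R (B(phi) \o e) id.
Proof.
apply: (@homotopic_trans _ _ _ (B(last_functor D) \o @level_map R _ D)); last first.
  exact: last_level_homotopic.
rewrite -[_ \o e]/((B(phi) \o B(G)) \o _) -classifying_map_fcomp.
apply: homotopic_compr; first exact: level_map_continuous.
apply: le_homotopic => s; apply: phi_le => _ /imsetP[T Ts ->].
by exists T => //; exact: chain_maxP.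
Qed.

Let phi' := fcomp phi (chain_functor P).

Lemma phi'_cmp (c c' : sd P) : (c <= c')%O -> ((phi' c : D) >=< phi' c')%O.
Proof. by move=> cc'; apply/orP; left; exact: (functor_homo phi' cc'). Qed.

Let sdphi : functor (poset_category (sd (sd P))) (poset_category (sd D)) :=
  image_functor phi'_cmp.

Lemma e_phi' : homotopic R (e \o B(phi')) B(chain_functor P).
Proof.
pose lP := @level_map R _ (sd P); pose lD := @level_map R _ D.
have clP : continuous lP := @level_map_continuous _ _ _.
have clD : continuous lD := @level_map_continuous _ _ _.
(* Subdivision is natural up to homotopy: its inverse, the last vertex functor, is natural up to an
   inequality in [D]. *)
have lphi : homotopic R (lD \o B(phi')) (B(sdphi) \o lP).
  apply: (@homotopic_trans _ _ _ (lD \o B(phi') \o (B(last_functor (sd P)) \o lP))).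
    rewrite -[X in homotopic R X]/((lD \o B(phi')) \o id); apply: homotopic_compl.
      exact: cont_comp ccm clD.
    exact/homotopic_sym/last_level_homotopic.
  apply: (@homotopic_trans _ _ _ (lD \o (B(last_functor D) \o B(sdphi)) \o lP)).
    rewrite -[X in homotopic R X]/(lD \o (B(phi') \o B(last_functor (sd P))) \o lP).
    apply: homotopic_compr => //; apply: homotopic_compl => //.
    rewrite -!classifying_map_fcomp; apply: le_homotopic => s.
    exact/chain_maxP/imset_f/chain_max_in.
  rewrite -[X in homotopic R X]/((lD \o B(last_functor D)) \o (B(sdphi) \o lP)).
  rewrite -[X in homotopic R _ X]/(id \o (B(sdphi) \o lP)).
  apply: homotopic_compr; first exact: cont_comp clP ccm.
  by have [_ _ + _] := @last_homotopy_inverse R _ D; exact: homotopic_sym.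
apply: (@homotopic_trans _ _ _ ((B(G) \o B(sdphi)) \o lP)).
  rewrite -[X in homotopic R X]/(B(G) \o (lD \o B(phi'))).
  by apply: homotopic_compl => //; exact: ccm.
apply: (@homotopic_trans _ _ _ (B(chain_functor P) \o (B(last_functor (sd P)) \o lP))).
  rewrite -[X in homotopic R _ X]/((B(chain_functor P) \o B(last_functor (sd P))) \o lP).
  apply: homotopic_compr => //; rewrite -classifying_map_fcomp.
  (* For a chain of chains [s], each partition [M (phi' c)] lies in [c], hence in the largest member
     of [s]. *)
  apply: chain_homotopic => s; apply: chain_obP.
  apply/fintype.subsetP => _ /imsetP[_ /imsetP[c cs ->] ->].
  by apply: (fintype.subsetP (chain_maxP cs)); exact: M_phi.
rewrite -[X in homotopic R _ X]/(B(chain_functor P) \o id).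
by apply: homotopic_compl; [exact: ccm|exact: last_level_homotopic].
Qed.

Lemma id_chain : homotopic R id (B(chain_functor P) \o B(verts_functor P)).
Proof.
rewrite -[X in homotopic R X](@classifying_map_id R C).
by apply: chain_homotopic => s i; exact: vert_in.
Qed.

Theorem comparison_weak_equivalence : weak_equivalence R B(phi).
Proof.
apply: (@homotopy_inverse_weak_equivalence _ _ _ _ e).
have ce : continuous e by exact: cont_comp (@level_map_continuous _ _ _) ccm.
split=> //; [exact: ccm| |exact/homotopic_sym/phi_e].
apply: homotopic_sym.
(* By [id_chain] the identity factors through chains up to homotopy, so the claim reduces to
   [e_phi']. *)
apply: (@homotopic_trans _ _ _ ((e \o B(phi)) \o (B(chain_functor P) \o B(verts_functor P)))).
  rewrite -[X in homotopic R X]/((e \o B(phi)) \o id); apply: homotopic_compl id_chain.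
  exact: cont_comp ccm ce.
apply: (@homotopic_trans _ _ _ (B(chain_functor P) \o B(verts_functor P))); last first.
  exact/homotopic_sym/id_chain.
rewrite -[X in homotopic R X]/((e \o (B(phi) \o B(chain_functor P))) \o B(verts_functor P)).
rewrite -classifying_map_fcomp; apply: homotopic_compr; first exact: ccm.
exact: e_phi'.
Qed.

Section SliceContractible.
Variable T : D.
Notation S := (slice phi (T : poset_category D)).

Lemma slice_chain (x : S) : ((phi (chain_ob (verts (projT1 x))) : D) <= T)%O.
Proof. exact: le_trans (phi_verts _) (projT2 x). Qed.

Definition cone_chain (x : S) : sd P := sval (cid (M_cone (slice_chain x))).

Lemma cone_chainE (x : S) : val (cone_chain x) = (M T |: val (verts (projT1 x)))%SET.
Proof. by have [] := svalP (cid (M_cone (slice_chain x))). Qed.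

Lemma cone_chain_le (x : S) : ((phi (chain_ob (cone_chain x)) : D) <= T)%O.
Proof. by have [] := svalP (cid (M_cone (slice_chain x))). Qed.

Definition slice_chain_ob (c : sd P) (cT : ((phi (chain_ob c) : D) <= T)%O) : S :=
  existT _ (chain_ob c) cT.

Definition to_slice_chain (x : S) (c : sd P) (cT : ((phi (chain_ob c) : D) <= T)%O)
    (xc : forall i, @vert _ _ (projT1 x) i \in val c) : Defs.hom x (slice_chain_ob cT) :=
  exist _ (to_chain xc) (bool_irrelevance _ _).

Lemma to_slice_chain_uniq (x : S) (c : sd P) (cT : ((phi (chain_ob c) : D) <= T)%O)
  (f g : Defs.hom x (slice_chain_ob cT)) : f = g.
Proof. by apply: slice_hom_eq; exact: to_chain_uniq. Qed.

Lemma cone_chain_vert (x : S) i : @vert _ _ (projT1 x) i \in val (cone_chain x).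
Proof. by rewrite cone_chainE finset.in_setU vert_in orbT. Qed.

Lemma cone_chain_homo (x y : S) : Defs.hom x y -> (cone_chain x <= cone_chain y)%O.
Proof.
by move=> f; rewrite sd_leE !cone_chainE; apply: finset.setUS; exact: verts_le (sval f).
Qed.

Definition cone_functor : functor S S :=
  @Functor S S (fun x => slice_chain_ob (cone_chain_le x))
    (fun x y f => @to_slice_chain (slice_chain_ob (cone_chain_le x)) _ (cone_chain_le y)
       (chain_obP (cone_chain_homo f)))
    (fun _ => to_slice_chain_uniq _ _) (fun _ _ _ _ _ => to_slice_chain_uniq _ _).

Lemma apexP : chainb [set M T]%SET.
Proof.
apply/andP; split; first by apply/finset.set0Pn; exists (M T); rewrite inE.
apply/forall_inP => _ /set1P ->; apply/forall_inP => _ /set1P ->; exact: comparablexx.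
Qed.

Definition apex : sd P := exist (fun S => chainb S) _ apexP.

Lemma apex_le : ((phi (chain_ob apex) : D) <= T)%O.
Proof. by apply: phi_le => _ /set1P ->; exists T. Qed.

Lemma apex_cone (x : S) i : @vert _ _ (chain_ob apex) i \in val (cone_chain x).
Proof.
apply: (@chain_obP _ _ apex); apply/fintype.subsetP => _ /set1P ->.
by rewrite cone_chainE finset.setU11.
Qed.

Theorem slice_weakly_contractible : weakly_contractible R (classifying_space R S).
Proof.
have [x0 cst0] := classifying_map_const R S (slice_chain_ob apex_le).
apply: (@homotopic_const_weakly_contractible _ _ x0).
(* First half of the zigzag: each simplex maps to its cone chain, which contains its vertices. *)
apply: (@homotopic_trans _ _ _ B(cone_functor)).
  rewrite -[X in homotopic R X](@classifying_map_id R S).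
  apply: (@natural_homotopic R S S (id_functor S) cone_functor
    (fun x => to_slice_chain (cone_chain_le x) (@cone_chain_vert x))).
  by move=> x y f; exact: to_slice_chain_uniq.
(* Second half: the apex maps to every cone chain, since each contains [M T]. *)
apply: homotopic_sym; rewrite (_ : (fun=> x0) = B(const_functor S (slice_chain_ob apex_le))).
  apply: (@natural_homotopic R S S (const_functor S (slice_chain_ob apex_le)) cone_functor
    (fun x => @to_slice_chain (slice_chain_ob apex_le) _ (cone_chain_le x) (@apex_cone x))).
  by move=> x y f; exact: to_slice_chain_uniq.
by apply/funext => x; rewrite cst0.
Qed.

End SliceContractible.
End Comparison.

(** * The comparison applied to partitions and trees *)

Theorem theorem1p1 (R : realType) (A : finType) :
  exists phi : functor (simplices (NP A)) (Tplus A),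
    [/\ forall s : simplices (NP A),
          ltree_iso (underlying_tree (phi s)) (delete_unary (layered_tree (projT2 s))),
        forall T : Tplus A,
          weakly_contractible R (classifying_space R (slice phi T)) &
        weak_equivalence R (@classifying_map R _ _ phi)].
Proof.
pose M := @root_partition A.
have Ma : forall S T, (S <= T)%O -> (M T <= M S)%O by exact: root_partition_anti.
have leP (c : sd (ntpart A)) (T : tree_poset_plus A) :
    (tree_functor A (chain_ob c) <= T :> tree_poset_plus A)%O <->
    forall x, x \in val c -> val (val x) \subset clusters (rep_tree T).
  split=> [/tree_ob_leP cT x xc|cT].
    by rewrite -(srankK xc); exact: cT.
  by apply/tree_ob_leP => i; apply: cT; exact: senum_in.
have phi_verts (s : simplices (NP A)) :
    (tree_functor A (chain_ob (verts s)) <= tree_functor A s :> tree_poset_plus A)%O.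
  apply/leP => _ /finset.imsetP[i _ ->]; apply/fintype.subsetP => B Bi; apply/clusters_tree_obP.
  by constructor 3; exists i.
have phi_le (c : sd (ntpart A)) (T : tree_poset_plus A) :
    (forall x, x \in val c -> exists2 S, (S <= T)%O & M S = x) ->
    (tree_functor A (chain_ob c) <= T :> tree_poset_plus A)%O.
  move=> cT; apply/leP => x /cT[S ST <-]; move: ST; rewrite tree_leE.
  exact: fintype.subset_trans (root_partition_sub S).
have M_phi (c : sd (ntpart A)) : M (tree_functor A (chain_ob c)) \in val c.
  by rewrite /M root_partition_tree_ob; exact: senum_in.
have M_cone (c : sd (ntpart A)) (T : tree_poset_plus A) :
    (tree_functor A (chain_ob c) <= T :> tree_poset_plus A)%O ->
    exists c' : sd (ntpart A), val c' = (M T |: val c)%SET /\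
      (tree_functor A (chain_ob c') <= T :> tree_poset_plus A)%O.
  move=> /leP cT.
  (* All blocks in [c] are clusters of [T], so [M T] lies below every member of [c] and can be added
     to the chain. *)
  have MT x : x \in val c -> (M T <= x)%O by move=> /cT; exact: root_partition_le.
  have cP : chainb ((M T |: val c)%SET).
    apply/andP; split; first by apply/finset.set0Pn; exists (M T); rewrite finset.setU11.
    apply/forall_inP => x /finset.setU1P xc; apply/forall_inP => y /finset.setU1P yc.
    case: xc yc => [->|xc] [->|yc]; rewrite ?comparablexx //.
    - by rewrite /Order.comparable MT.
    - by rewrite /Order.comparable MT ?orbT.
    - exact: sd_comparable xc yc.
  exists (exist (fun S => chainb S) _ cP); split=> //; apply/leP => x /finset.setU1P[->|/cT//].
  exact: root_partition_sub.
exists (tree_functor A); split.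
- exact: tree_ob_iso.
- exact: (@slice_weakly_contractible R _ _ _ _ (tree_functor A) M phi_verts phi_le M_cone).
- exact: (@comparison_weak_equivalence R _ _ _ _ (tree_functor A) M Ma phi_le M_phi).
Qed.
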